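(* Let $f\in\mathcal{S}^{*}$ and $M_{\infty}(r,f)=\max_{|q|=r}|f(q)|$ for $r\in(0,1)$. Then the function $\phi(r)=\frac1r(1-r)^{2}M_{\infty}(r,f)$ is decreasing (i.e. non-increasing) on $(0,1)$ and hence tends, as $r\to1^-$, to a limit $\alpha\in[0,1]$. Whatever the value of this limit $\alpha\in[0,1]$, there exists $u\in\partial\mathbb{B}$ such that $$\lim_{r\nearrow1^{-}}(1-r)^{2}|f(ru)|=\alpha.$$
   Context: $\mathbb{H}$ denotes the quaternions, $\mathbb{B}=\{q\in\mathbb{H}:|q|<1\}$, $\mathbb{S}=\{q\in\mathbb{H}:q^2=-1\}$; for $I\in\mathbb{S}$, $\mathbb{C}_I=\mathbb{R}\oplus I\mathbb{R}$ and $\mathbb{B}_I=\mathbb{B}\cap\mathbb{C}_I$. A function $f:\mathbb{B}\to\mathbb{H}$ is (left) slice regular if for every $I\in\mathbb{S}$ the restriction $f_I=f|_{\mathbb{B}_I}$ has continuous partial derivatives and $\frac12\left(\frac{\partial}{\partial x}+I\frac{\partial}{\partial y}\right)f_I(x+yI)=0$ on $\mathbb{B}_I$; equivalently $f(q)=\sum_{n\ge0}q^na_n$ on $\mathbb{B}$ with $a_n\in\mathbb{H}$. Its slice derivative is $f'(x+yI)=\frac12\left(\frac{\partial}{\partial x}-I\frac{\partial}{\partial y}\right)f_I(x+yI)$, i.e. $f'(q)=\sum_{n\ge1}q^{n-1}na_n$. $\mathcal{S}$ is the set of slice regular $f:\mathbb{B}\to\mathbb{H}$ whose zero set is $\mathcal{Z}_f=\{0\}$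 and with $f'(0)=1$. The class of slice starlike functions $\mathcal{S}^{*}$ is the set of $f\in\mathcal{S}$ such that $\mathrm{Re}\big(f(q)^{-1}qf'(q)\big)>0$ for $q\in\mathbb{B}$ (pointwise products; at $q=0$ the expression is understood as its limit value $1$). *)

(* Defs.v *)
From Stdlib Require Import Reals.
From Coquelicot Require Import Coquelicot.
Open Scope R_scope.

(** [(((a, b), c), d)] stands for [a + b i + c j + d k].  As with Coquelicot's
    [C := R * R], the normed module structure over [R] is the product one. *)
Definition Quat : Type := (R * R * R * R)%type.

Declare Scope quat_scope.
Delimit Scope quat_scope with Q.
Bind Scope quat_scope with Quat.

Definition Qre (q : Quat) : R := fst (fst (fst q)).
Definition Qi (q : Quat) : R := snd (fst (fst q)).
Definition Qj (q : Quat) : R := snd (fst q).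
Definition Qk (q : Quat) : R := snd q.

Definition RtoQuat (a : R) : Quat := (a, 0, 0, 0).
Coercion RtoQuat : R >-> Quat.

Definition Qplus (p q : Quat) : Quat :=
  (Qre p + Qre q, Qi p + Qi q, Qj p + Qj q, Qk p + Qk q).
Definition Qopp (q : Quat) : Quat := (- Qre q, - Qi q, - Qj q, - Qk q).
Definition Qmult (p q : Quat) : Quat :=
  (Qre p * Qre q - Qi p * Qi q - Qj p * Qj q - Qk p * Qk q,
   Qre p * Qi q + Qi p * Qre q + Qj p * Qk q - Qk p * Qj q,
   Qre p * Qj q - Qi p * Qk q + Qj p * Qre q + Qk p * Qi q,
   Qre p * Qk q + Qi p * Qj q - Qj p * Qi q + Qk p * Qre q).

Infix "+" := Qplus : quat_scope.
Notation "- q" := (Qopp q) : quat_scope.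
Notation "p - q" := (Qplus p (Qopp q)) : quat_scope.
Infix "*" := Qmult : quat_scope.

Definition Qnorm (q : Quat) : R :=
  sqrt (Qre q ^ 2 + Qi q ^ 2 + Qj q ^ 2 + Qk q ^ 2).
Definition Qconj (q : Quat) : Quat := (Qre q, - Qi q, - Qj q, - Qk q).
Definition Qinv (q : Quat) : Quat := (RtoQuat (/ Qnorm q ^ 2) * Qconj q)%Q.

Definition in_ball (q : Quat) : Prop := Qnorm q < 1.
Definition imag_unit (I : Quat) : Prop := (I * I)%Q = RtoQuat (-1).

(** The point [x + y I] of the slice [C_I]. *)
Definition slice_pt (I : Quat) (x y : R) : Quat := (RtoQuat x + RtoQuat y * I)%Q.

(** The derivative of a curve in [Quat]; meaningful when [ex_derive g t]. *)
Definition Qderive (g : R -> Quat) (t : R) : Quat :=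
  (Derive (fun s => Qre (g s)) t, Derive (fun s => Qi (g s)) t,
   Derive (fun s => Qj (g s)) t, Derive (fun s => Qk (g s)) t).

Definition slice_dx (f : Quat -> Quat) (I : Quat) (x y : R) : Quat :=
  Qderive (fun t => f (slice_pt I t y)) x.
Definition slice_dy (f : Quat -> Quat) (I : Quat) (x y : R) : Quat :=
  Qderive (fun t => f (slice_pt I x t)) y.

(** Functions on the open unit ball are represented by total functions whose
    values outside the ball are irrelevant. *)
Definition slice_regular (f : Quat -> Quat) : Prop :=
  forall I : Quat, imag_unit I ->
  forall x y : R, in_ball (slice_pt I x y) ->
    ex_derive (fun t => f (slice_pt I t y)) x /\
    ex_derive (fun t => f (slice_pt I x t)) y /\
    continuous (fun p : R * R => slice_dx f I (fst p) (snd p)) (x, y) /\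
    continuous (fun p : R * R => slice_dy f I (fst p) (snd p)) (x, y) /\
    (RtoQuat (/ 2) * (slice_dx f I x y + I * slice_dy f I x y))%Q = RtoQuat 0.

(** Every [q] is [slice_pt (slice_unit q) (Qre q) (im_norm q)].  For real [q] the
    unit is arbitrary; we take [i].  For slice regular [f] the choice does not
    affect [slice_derivative], since then [- I * df/dy = df/dx]. *)
Definition im_norm (q : Quat) : R := sqrt (Qi q ^ 2 + Qj q ^ 2 + Qk q ^ 2).
Definition slice_unit (q : Quat) : Quat :=
  if Req_dec_T (im_norm q) 0 then (0, 1, 0, 0)
  else (0, Qi q / im_norm q, Qj q / im_norm q, Qk q / im_norm q).

Definition slice_derivative (f : Quat -> Quat) (q : Quat) : Quat :=
  let I := slice_unit q in
  let x := Qre q in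
  let y := im_norm q in
  (RtoQuat (/ 2) * (slice_dx f I x y - I * slice_dy f I x y))%Q.

Definition class_S (f : Quat -> Quat) : Prop :=
  slice_regular f /\
  (forall q : Quat, in_ball q -> (f q = RtoQuat 0 <-> q = RtoQuat 0)) /\
  slice_derivative f (RtoQuat 0) = RtoQuat 1.

(** At [q = 0] the expression is read as its limit value [1], so the condition
    holds there automatically. *)
Definition slice_starlike (f : Quat -> Quat) : Prop :=
  class_S f /\
  forall q : Quat, in_ball q -> q <> RtoQuat 0 ->
    0 < Qre (Qinv (f q) * q * slice_derivative f q)%Q.

Definition is_max_modulus (f : Quat -> Quat) (r m : R) : Prop :=
  (exists q : Quat, Qnorm q = r /\ Qnorm (f q) = m) /\
  (forall q : Quat, Qnorm q = r -> Qnorm (f q) <= m).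

(** A total supremum; it is the maximum as soon as the latter exists. *)
Definition M_infty (r : R) (f : Quat -> Quat) : R :=
  real (Lub_Rbar (fun m => exists q : Quat, Qnorm q = r /\ m = Qnorm (f q))).

Definition phi (f : Quat -> Quat) (r : R) : R :=
  1 / r * (1 - r) ^ 2 * M_infty r f.

(* Main.v *)
Require Import Defs.
From Stdlib Require Import Reals.
From Coquelicot Require Import Coquelicot.
From Stdlib Require Import Lra Lia Classical IndefiniteDescription.
Open Scope R_scope.

(** On a ray, [r d/dr log |f(ru)| = Re p(ru)] for the pointwise product
    [p(q) = f(q)^(-1) q f'(q)], so that [(1-r)^2 |f(ru)| / r] decreases as soon as
    [Re p(q) <= (1 + |q|) / (1 - |q|)].  The function [p] is not slice regular, but
    [p(Tq)] is, for the transformation [Tq = f^c(q)^(-1) q f^c(q)], which permutes each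
    sphere [x + yS].  Writing [f(x + yI) = a + I b], where [a + ib] is a holomorphic
    function with values in the complexified quaternions, the real part of
    [p(T(x + yI))] is, for each fixed [I], the real part of a holomorphic function on the
    disc; it is positive and equals 1 at 0, and Harnack's inequality applies.  A cluster
    point of the directions in which the maximum modulus is attained, as [r -> 1], is the
    required [u]. *)

(** * Continuity and differentiability of complex-valued functions *)

(** The bound [(1 + r) / (1 - r)] is the logarithmic derivative [r d/dr log] of the Koebe function
    [r / (1 - r)^2], and the quantity to be shown decreasing is [|f(ru)|] divided by that function;
    the two match exactly, with nothing to spare. Starlikeness is a pointwise condition, whereas
    holomorphy is available only with a unit [I] held fixed. The bridge is the relation
    [f(x+yJ) I = J f(x+yJ)]. At the point of interest it is solved for [I]; with that [I] kept, it
    is solved for a new [J] at every other point of the disc, so that positivity holds on the whole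
    disc. Solvability there rests on the absence of zeros off the origin. Slice regularity gives
    smoothness only inside each slice. Continuity across slices, on which both the attainment of the
    maximum and the cluster direction depend, comes from the representation formula. A cluster
    direction loses nothing: a direction maximal at radius [r_n] has, by monotonicity on its ray,
    normalised modulus at least the limit [alpha] at every radius below [r_n], and this lower bound
    passes to the limit at each fixed radius. *)

Lemma continuous_C_intro {T : UniformSpace} (F : T -> C) (t : T) :
  continuous (fun s => Re (F s)) t -> continuous (fun s => Im (F s)) t ->
  continuous F t.
Proof.
  intros H1 H2.
  apply (continuous_ext (fun s => (Re (F s), Im (F s)) : C)).
  - intros s; destruct (F s); reflexivity.
  - apply (continuous_comp_2 (U := T) (V := R_UniformSpace) (W := R_UniformSpace) (X := C_UniformSpace)
      (fun s => Re (F s)) (fun s => Im (F s)) (fun a b => (a, b) : C)); try assumption.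
    apply (continuous_ext (fun x : R * R => x)); [intros []; reflexivity | apply continuous_id].
Qed.

Lemma continuous_Re {T : UniformSpace} (F : T -> C) (t : T) :
  continuous F t -> continuous (fun s => Re (F s)) t.
Proof.
  intros H; apply (continuous_comp F (fun c : C_UniformSpace => Re c : R_UniformSpace)); auto.
  destruct (F t); apply (continuous_fst (U := R_UniformSpace) (V := R_UniformSpace)).
Qed.

Lemma continuous_Im {T : UniformSpace} (F : T -> C) (t : T) :
  continuous F t -> continuous (fun s => Im (F s)) t.
Proof.
  intros H; apply (continuous_comp F (fun c : C_UniformSpace => Im c : R_UniformSpace)); auto.
  destruct (F t); apply (continuous_snd (U := R_UniformSpace) (V := R_UniformSpace)).
Qed.

Lemma continuous_Rplus {T : UniformSpace} (f g : T -> R) (t : T) :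
  continuous f t -> continuous g t -> continuous (fun s => f s + g s) t.
Proof. exact (continuous_plus (V := R_NormedModule) f g t). Qed.
Lemma continuous_Rminus {T : UniformSpace} (f g : T -> R) (t : T) :
  continuous f t -> continuous g t -> continuous (fun s => f s - g s) t.
Proof. exact (continuous_minus (V := R_NormedModule) f g t). Qed.
Lemma continuous_Ropp {T : UniformSpace} (f : T -> R) (t : T) :
  continuous f t -> continuous (fun s => - f s) t.
Proof. exact (continuous_opp (V := R_NormedModule) f t). Qed.
Lemma continuous_Rmult {T : UniformSpace} (f g : T -> R) (t : T) :
  continuous f t -> continuous g t -> continuous (fun s => f s * g s) t.
Proof. exact (continuous_mult (K := R_AbsRing) f g t). Qed.
Lemma continuous_Rinv_gen {T : UniformSpace} (f : T -> R) (t : T) :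
  continuous f t -> f t <> 0 -> continuous (fun s => / f s) t.
Proof.
  intros H H0; apply (continuous_comp f (fun x : R_UniformSpace => / x : R_UniformSpace)); auto.
  now apply continuous_Rinv.
Qed.

Lemma continuous_Cplus {T : UniformSpace} (F G : T -> C) (t : T) :
  continuous F t -> continuous G t -> continuous (fun s => F s + G s)%C t.
Proof.
  intros HF HG; apply continuous_C_intro.
  - apply (continuous_Rplus (fun s => Re (F s)) (fun s => Re (G s))); apply continuous_Re; auto.
  - apply (continuous_Rplus (fun s => Im (F s)) (fun s => Im (G s))); apply continuous_Im; auto.
Qed.
Lemma continuous_Copp {T : UniformSpace} (F : T -> C) (t : T) :
  continuous F t -> continuous (fun s => - F s)%C t.
Proof.
  intros HF; apply continuous_C_intro.
  - apply (continuous_Ropp (fun s => Re (F s))); apply continuous_Re; auto.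
  - apply (continuous_Ropp (fun s => Im (F s))); apply continuous_Im; auto.
Qed.
Lemma continuous_Cminus {T : UniformSpace} (F G : T -> C) (t : T) :
  continuous F t -> continuous G t -> continuous (fun s => F s - G s)%C t.
Proof. intros; apply continuous_Cplus; [|apply continuous_Copp]; assumption. Qed.
Lemma continuous_normsq {T : UniformSpace} (F : T -> C) (t : T) :
  continuous F t -> continuous (fun s => Re (F s) ^ 2 + Im (F s) ^ 2) t.
Proof.
  intros HF. assert (H1 := continuous_Re F t HF). assert (H2 := continuous_Im F t HF).
  apply (continuous_ext (fun s => Re (F s) * Re (F s) + Im (F s) * Im (F s))).
  - intros s; simpl; ring.
  - exact (continuous_Rplus _ _ _ (continuous_Rmult _ _ _ H1 H1) (continuous_Rmult _ _ _ H2 H2)).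
Qed.
Lemma continuous_Cmult {T : UniformSpace} (F G : T -> C) (t : T) :
  continuous F t -> continuous G t -> continuous (fun s => F s * G s)%C t.
Proof.
  intros HF HG. assert (H1 := continuous_Re F t HF). assert (H2 := continuous_Im F t HF).
  assert (H3 := continuous_Re G t HG). assert (H4 := continuous_Im G t HG).
  apply continuous_C_intro.
  - exact (continuous_Rminus _ _ _ (continuous_Rmult _ _ _ H1 H3) (continuous_Rmult _ _ _ H2 H4)).
  - exact (continuous_Rplus _ _ _ (continuous_Rmult _ _ _ H1 H4) (continuous_Rmult _ _ _ H2 H3)).
Qed.
Lemma continuous_Cconj {T : UniformSpace} (F : T -> C) (t : T) :
  continuous F t -> continuous (fun s => Cconj (F s)) t.
Proof.
  intros HF; apply continuous_C_intro.
  - apply (continuous_Re F t HF).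
  - apply (continuous_Ropp (fun s => Im (F s))), (continuous_Im F t HF).
Qed.
Lemma C_normsq_neq_0 (c : C) : c <> 0%C -> fst c ^ 2 + snd c ^ 2 <> 0.
Proof.
  intros H E; apply H. destruct c as [a b]; simpl in E.
  assert (a = 0) by nra. assert (b = 0) by nra. now subst.
Qed.
Lemma continuous_Cinv {T : UniformSpace} (F : T -> C) (t : T) :
  continuous F t -> F t <> 0%C -> continuous (fun s => / F s)%C t.
Proof.
  intros HF H0.
  assert (Hd : continuous (fun s => / (Re (F s) ^ 2 + Im (F s) ^ 2)) t).
  { apply continuous_Rinv_gen; [|apply C_normsq_neq_0, H0]. now apply continuous_normsq. }
  apply continuous_C_intro.
  - apply (continuous_Rmult (fun s => Re (F s)) (fun s => / (Re (F s) ^ 2 + Im (F s) ^ 2))); auto.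
    apply continuous_Re; auto.
  - apply (continuous_Rmult (fun s => - Im (F s)) (fun s => / (Re (F s) ^ 2 + Im (F s) ^ 2))); auto.
    apply (continuous_Ropp (fun s => Im (F s))), continuous_Im; auto.
Qed.
Lemma continuous_RtoC {T : UniformSpace} (f : T -> R) (t : T) :
  continuous f t -> continuous (fun s => RtoC (f s)) t.
Proof. intros H; apply continuous_C_intro; [exact H | apply continuous_const]. Qed.

Lemma continuous_Cmod {T : UniformSpace} (F : T -> C) (t : T) :
  continuous F t -> continuous (fun s => Cmod (F s)) t.
Proof.
  intros HF.
  apply (continuous_comp (fun s => fst (F s) ^ 2 + snd (F s) ^ 2) sqrt).
  - exact (continuous_normsq F t HF).
  - apply continuous_sqrt.
Qed.

Ltac ctn :=
  lazymatch goal with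
  | |- continuous (fun s => Cminus _ _) _ => apply continuous_Cminus; ctn
  | |- continuous (fun s => Cplus _ _) _ => apply continuous_Cplus; ctn
  | |- continuous (fun s => Copp _) _ => apply continuous_Copp; ctn
  | |- continuous (fun s => Cmult _ _) _ => apply continuous_Cmult; ctn
  | |- continuous (fun s => Cconj _) _ => apply continuous_Cconj; ctn
  | |- continuous (fun s => s) _ => apply continuous_id
  | |- continuous (fun s => Cinv _) _ => apply continuous_Cinv; [ctn|]
  | |- continuous _ _ => first [assumption | apply continuous_const | idtac]
  | |- _ => idtac
  end.

Lemma locally_Cmod (z : C) (d : R) : 0 < d -> locally (T := C_UniformSpace) z (fun w => Cmod (w - z) < d).
Proof.
  intros Hd.
  assert (H : continuous (T := C_UniformSpace) (fun w : C => Cmod (w - z)) z).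
  { apply continuous_Cmod; ctn. }
  apply (H (fun r => r < d)).
  replace (z - z)%C with (RtoC 0) by ring. rewrite Cmod_0.
  exists (mkposreal d Hd). intros y Hy. 
  unfold ball in Hy; simpl in Hy; unfold AbsRing_ball, abs, minus, plus, opp in Hy; simpl in Hy.
  apply Rabs_def2 in Hy; lra.
Qed.

Lemma locally_Cmod_lt (z : C) (d : R) : Cmod z < d -> locally (T := C_UniformSpace) z (fun w => Cmod w < d).
Proof.
  intros Hd. apply (filter_imp (fun w => Cmod (w - z) < d - Cmod z)).
  - intros w Hw. replace w with (z + (w - z))%C by ring.
    apply Rle_lt_trans with (1 := Cmod_triangle _ _). lra.
  - apply locally_Cmod; lra.
Qed.

Lemma locally_C_exists (z : C) (P : C -> Prop) :
  locally (T := C_UniformSpace) z P -> exists d, 0 < d /\ forall w, Cmod (w - z) < d -> P w.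
Proof.
  intros [d Hd]. exists d; split; [apply cond_pos|].
  intros w Hw; apply Hd. 
  generalize (Rmax_Cmod (w - z)%C); intros HM.
  split.
  - apply Rle_lt_trans with (2 := Hw), Rle_trans with (2 := HM). apply (Rmax_l (Rabs (fst (w - z)%C))).
  - apply Rle_lt_trans with (2 := Hw), Rle_trans with (2 := HM). apply (Rmax_r (Rabs (fst (w - z)%C))).
Qed.

(** Filter arguments leave goals typed in the carrier of [C_UniformSpace]; [ring] and [rewrite] need
    the syntactic type [C]. *)
Ltac asC := change (UniformSpace.sort C_UniformSpace) with C in *; lazymatch goal with |- ?a = ?b => change (@eq C a b) end.

(** Carathéodory's form of complex differentiability. *)
Definition Cder (F : C -> C) (z l : C) : Prop :=
  exists Phi : C -> C, continuous (T := C_UniformSpace) (U := C_UniformSpace) Phi z /\ Phi z = l /\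
    locally (T := C_UniformSpace) z (fun w => F w = F z + Phi w * (w - z))%C.

Lemma Cder_ext_loc (F G : C -> C) (z l : C) :
  locally (T := C_UniformSpace) z (fun w => F w = G w) -> Cder F z l -> Cder G z l.
Proof.
  intros HL [P [H1 [H2 H3]]]. exists P; split; [|split]; auto.
  assert (Hz := locally_singleton _ _ HL). simpl in Hz.
  generalize (filter_and _ _ HL H3). apply filter_imp.
  intros w [E1 E2]. now rewrite <- E1, <- Hz.
Qed.

Lemma Cder_ext (F G : C -> C) (z l : C) :
  (forall w, F w = G w) -> Cder F z l -> Cder G z l.
Proof. intros H; apply Cder_ext_loc, filter_forall, H. Qed.

Lemma Cder_continuous (F : C -> C) (z l : C) : Cder F z l -> continuous (T := C_UniformSpace) F z.
Proof.
  intros [P [H1 [H2 H3]]].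
  apply (continuous_ext_loc F (fun w => F z + P w * (w - z))%C); [|ctn].
  revert H3; apply filter_imp; intros w ->; reflexivity.
Qed.

Lemma Cder_const (c z : C) : Cder (fun _ => c) z 0.
Proof.
  exists (fun _ => 0%C); split; [ctn|split]; auto.
  apply filter_forall; intros; asC; ring.
Qed.
Lemma Cder_id (z : C) : Cder (fun w => w) z 1.
Proof.
  exists (fun _ => 1%C); split; [ctn|split]; auto.
  apply filter_forall; intros; asC; ring.
Qed.
Lemma Cder_plus (F G : C -> C) (z l m : C) :
  Cder F z l -> Cder G z m -> Cder (fun w => F w + G w)%C z (l + m).
Proof.
  intros [P [HP [Pz HF]]] [Q [HQ [Qz HG]]].
  exists (fun w => P w + Q w)%C; split; [ctn|split]; [now rewrite Pz, Qz|].
  generalize (filter_and _ _ HF HG). apply filter_imp; intros w [E1 E2]; asC.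
  rewrite E1, E2; asC; ring.
Qed.
Lemma Cder_mult (F G : C -> C) (z l m : C) :
  Cder F z l -> Cder G z m -> Cder (fun w => F w * G w)%C z (l * G z + F z * m).
Proof.
  intros DF DG. assert (CG := Cder_continuous _ _ _ DG). revert DF DG.
  intros [P [HP [Pz HF]]] [Q [HQ [Qz HG]]].
  exists (fun w => P w * G w + F z * Q w)%C; split; [ctn|split]; [now rewrite Pz, Qz|].
  generalize (filter_and _ _ HF HG). apply filter_imp; intros w [E1 E2]; asC.
  rewrite E1. rewrite E2 at 1. rewrite E2. asC; ring.
Qed.
Lemma Cder_inv (F : C -> C) (z l : C) :
  Cder F z l -> F z <> 0%C -> Cder (fun w => / F w)%C z (- l * / (F z * F z)).
Proof.
  intros DF H0. assert (CF := Cder_continuous _ _ _ DF). revert DF.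
  intros [P [HP [Pz HF]]].
  assert (HN : locally (T := C_UniformSpace) z (fun w => F w <> 0%C)).
  { assert (CM := continuous_Cmod _ _ CF).
    assert (Hpos : 0 < Cmod (F z)) by now apply Cmod_gt_0.
    assert (H := CM (fun r => 0 < r) (open_gt 0 _ Hpos)). unfold filtermap in H.
    revert H. apply filter_imp. intros w Hw; now apply Cmod_gt_0. }
  exists (fun w => - P w * / (F z * F w))%C; split; [|split].
  - ctn. now apply Cmult_neq_0.
  - now rewrite Pz.
  - generalize (filter_and _ _ HF HN). apply filter_imp; intros w [E1 E2]; asC.
    replace (- P w * / (F z * F w) * (w - z))%C with (- (P w * (w - z)) * / (F z * F w))%C by ring.
    replace (P w * (w - z))%C with (F w - F z)%C by (rewrite E1; ring).
    field. split; assumption.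
Qed.

(** The slope is the difference quotient, completed by [l] at [z]. The factorisation then holds
    everywhere, and the estimate serves only for continuity at [z]. *)
Lemma Cder_eps (F : C -> C) (z l : C) :
  (forall eps, 0 < eps -> locally (T := C_UniformSpace) z (fun w => Cmod (F w - F z - l * (w - z)) <= eps * Cmod (w - z))) ->
  Cder F z l.
Proof.
  intros H.
  set (P := fun w => if Ceq_dec w z then l else ((F w - F z) / (w - z))%C).
  assert (Pz : P z = l) by (unfold P; destruct (Ceq_dec z z); congruence).
  exists P; split; [|split]; auto.
  - apply (proj2 (filterlim_locally (U := C_UniformSpace) P (P z))). intros eps.
    assert (He : 0 < eps / 2) by (destruct eps; simpl; lra).
    generalize (H _ He). apply filter_imp. intros w Hw.
    assert (HC : Cmod (P w - P z) < eps).
    { rewrite Pz. unfold P. destruct (Ceq_dec w z) as [->|N].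
      - replace (l - l)%C with (RtoC 0) by ring. rewrite Cmod_0; apply cond_pos.
      - assert (N' : (w - z <> 0)%C) by now apply Cminus_eq_contra.
        replace ((F w - F z) / (w - z) - l)%C with ((F w - F z - l * (w - z)) / (w - z))%C by (field; auto).
        rewrite Cmod_div; auto. apply Rle_lt_trans with (eps / 2); [|destruct eps; simpl in *; lra].
        apply Cmod_gt_0 in N'. apply Rle_div_l; auto. }
    generalize (Rmax_Cmod (P w - P z)%C); intros HM.
    split.
    + apply Rle_lt_trans with (2 := HC), Rle_trans with (2 := HM). apply (Rmax_l (Rabs (fst (P w - P z)%C))).
    + apply Rle_lt_trans with (2 := HC), Rle_trans with (2 := HM). apply (Rmax_r (Rabs (fst (P w - P z)%C))).
  - apply filter_forall. intros w. unfold P. destruct (Ceq_dec w z) as [->|N].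
    + ring.
    + field. now apply Cminus_eq_contra.
Qed.

Definition Rder (g : R -> C) (t : R) (l : C) : Prop :=
  is_derive (fun s => Re (g s)) t (Re l) /\ is_derive (fun s => Im (g s)) t (Im l).

Lemma Rder_continuous (g : R -> C) (t : R) (l : C) : Rder g t l -> continuous g t.
Proof.
  intros [H1 H2]; apply continuous_C_intro.
  - apply (ex_derive_continuous (fun s => Re (g s))). now exists (Re l).
  - apply (ex_derive_continuous (fun s => Im (g s))). now exists (Im l).
Qed.

(** As [v t = 0], the difference quotient of the product is [u (t + h)] times that of [v], so
    continuity of [u] suffices. The chain rule in Carathéodory form meets exactly this: a merely
    continuous slope times an increment vanishing at [t]. *)
Lemma is_derive_mult_vanish (u v : R -> R) (t l : R) :
  continuous u t -> v t = 0 -> is_derive v t l -> is_derive (fun s => u s * v s) t (u t * l).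
Proof.
  intros Hu Hv Dv. apply is_derive_Reals. apply is_derive_Reals in Dv.
  assert (L1 : limit1_in (fun h => u (t + h)) (fun h => h <> 0) (u t) 0).
  { assert (Hu' : continuity_pt u t) by (apply continuity_pt_filterlim; exact Hu).
    intros e Hep. destruct (Hu' e Hep) as [a [Ha1 Ha2]]. exists a; split; auto.
    intros x [Hx1 Hx2]. apply Ha2. simpl in *. unfold Rdist in *. split.
    - split; [exact I|]. intros E. apply Hx1; lra.
    - replace (t + x - t) with (x - 0) by ring. auto. }
  assert (L2 : limit1_in (fun h => (v (t + h) - v t) / h) (fun h => h <> 0) l 0).
  { intros e Hep. destruct (Dv e Hep) as [a Ha]. exists a; split; [apply cond_pos|].
    intros x [Hx1 Hx2]. simpl in *. unfold Rdist in *. rewrite Rminus_0_r in Hx2. now apply Ha. }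
  assert (H := limit_mul _ _ _ _ _ _ L1 L2).
  intros e Hep. destruct (H e Hep) as [a [Ha1 Ha2]]. exists (mkposreal a Ha1).
  intros h Hh Hh'. simpl in *. unfold Rdist in *.
  replace ((u (t + h) * v (t + h) - u t * v t) / h) with (u (t + h) * ((v (t + h) - v t) / h))
    by (rewrite Hv; unfold Rdiv; ring).
  apply Ha2. rewrite Rminus_0_r. auto.
Qed.

Lemma Rder_comp (F : C -> C) (g : R -> C) (t : R) (l m : C) :
  Cder F (g t) l -> Rder g t m -> Rder (fun s => F (g s)) t (l * m).
Proof.
  intros [P [HP [Pz HF]]] Dg.
  assert (Cg := Rder_continuous _ _ _ Dg). destruct Dg as [D1 D2].
  assert (CP : continuous (fun s => P (g s)) t).
  { apply (continuous_comp (V := C_UniformSpace) (W := C_UniformSpace) g P); auto. }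
  assert (E : locally t (fun s => F (g s) = F (g t) + P (g s) * (g s - g t))%C) by exact (Cg _ HF).
  assert (A1 : is_derive (fun s => Re (g s) - Re (g t)) t (Re m)).
  { evar_last. apply @is_derive_minus; [exact D1|apply @is_derive_const]. unfold minus, plus, opp, zero; simpl; ring. }
  assert (A2 : is_derive (fun s => Im (g s) - Im (g t)) t (Im m)).
  { evar_last. apply @is_derive_minus; [exact D2|apply @is_derive_const]. unfold minus, plus, opp, zero; simpl; ring. }
  assert (C1 := continuous_Re _ _ CP). assert (C2 := continuous_Im _ _ CP).
  split.
  - apply (is_derive_ext_loc (fun s => Re (F (g t)) + (Re (P (g s)) * (Re (g s) - Re (g t)) - Im (P (g s)) * (Im (g s) - Im (g t))))).
    + revert E. apply filter_imp. intros s ->. unfold Re, Im; simpl. ring.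
    + evar_last. apply @is_derive_plus; [apply @is_derive_const|].
      apply @is_derive_minus; (apply is_derive_mult_vanish; [assumption|ring|eassumption]).
      cbv beta; rewrite Pz. unfold minus, plus, opp, zero; simpl. rewrite ?re_mult. unfold Re, Im; simpl; ring.
  - apply (is_derive_ext_loc (fun s => Im (F (g t)) + (Re (P (g s)) * (Im (g s) - Im (g t)) + Im (P (g s)) * (Re (g s) - Re (g t))))).
    + revert E. apply filter_imp. intros s ->. unfold Re, Im; simpl. ring.
    + evar_last. apply @is_derive_plus; [apply @is_derive_const|].
      apply @is_derive_plus; (apply is_derive_mult_vanish; [assumption|ring|eassumption]).
      cbv beta; rewrite Pz. unfold minus, plus, opp, zero; simpl. rewrite ?re_mult. unfold Re, Im; simpl; ring.
Qed.

(** Restriction to the horizontal line through [z] reduces this to uniqueness of real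
    derivatives. *)
Lemma Cder_unique (F : C -> C) (z l m : C) : Cder F z l -> Cder F z m -> l = m.
Proof.
  intros D1 D2.
  assert (Dg : Rder (fun s => z + RtoC s)%C 0 1).
  { split; unfold Re, Im; simpl; auto_derive; auto. }
  assert (Ez : (z + RtoC 0 = z)%C) by ring.
  assert (R1 : Rder (fun s => F (z + RtoC s)%C) 0 (l * 1)) by (apply (Rder_comp F); [now rewrite Ez|exact Dg]).
  assert (R2 : Rder (fun s => F (z + RtoC s)%C) 0 (m * 1)) by (apply (Rder_comp F); [now rewrite Ez|exact Dg]).
  destruct R1 as [A1 A2], R2 as [B1 B2].
  apply is_derive_unique in A1, A2, B1, B2.
  replace l with (l * 1)%C by ring. replace m with (m * 1)%C by ring.
  apply injective_projections; [change (Re (l * 1) = Re (m * 1))|change (Im (l * 1) = Im (m * 1))]; congruence.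
Qed.

(** * Means over the circle *)

Lemma two_PI_pos : 0 < 2 * PI.
Proof. generalize PI_RGT_0; lra. Qed.

Lemma ex_RInt_cont (f : R -> R) (a b : R) : (forall t, continuous f t) -> ex_RInt f a b.
Proof. intros H; apply (ex_RInt_continuous f); intros; apply H. Qed.

Definition Cmean (g : R -> C) : C :=
  (RInt (fun t => Re (g t)) 0 (2 * PI) / (2 * PI), RInt (fun t => Im (g t)) 0 (2 * PI) / (2 * PI)).

Lemma Cmean_ext (g h : R -> C) : (forall t, g t = h t) -> Cmean g = Cmean h.
Proof.
  intros H; unfold Cmean; f_equal; f_equal; apply RInt_ext; intros; now rewrite H.
Qed.

Lemma RInt_cont_plus (f g : R -> R) a b : (forall t, continuous f t) -> (forall t, continuous g t) ->
  RInt (fun t => f t + g t) a b = RInt f a b + RInt g a b.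
Proof. intros; apply (RInt_plus f g); now apply ex_RInt_cont. Qed.
Lemma RInt_cont_minus (f g : R -> R) a b : (forall t, continuous f t) -> (forall t, continuous g t) ->
  RInt (fun t => f t - g t) a b = RInt f a b - RInt g a b.
Proof. intros; apply (RInt_minus f g); now apply ex_RInt_cont. Qed.
Lemma RInt_cont_scal (c : R) (f : R -> R) a b : (forall t, continuous f t) ->
  RInt (fun t => c * f t) a b = c * RInt f a b.
Proof. intros; apply (RInt_scal f); now apply ex_RInt_cont. Qed.

Lemma Cmean_plus (g h : R -> C) : (forall t, continuous g t) -> (forall t, continuous h t) ->
  Cmean (fun t => g t + h t)%C = (Cmean g + Cmean h)%C.
Proof.
  intros Hg Hh. unfold Cmean, Cplus; simpl.
  f_equal.
  - rewrite (RInt_cont_plus (fun t => Re (g t)) (fun t => Re (h t))); [unfold Rdiv; ring|..];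
      intros t; apply continuous_Re; auto.
  - rewrite (RInt_cont_plus (fun t => Im (g t)) (fun t => Im (h t))); [unfold Rdiv; ring|..];
      intros t; apply continuous_Im; auto.
Qed.

Lemma Cmean_scal (c : C) (g : R -> C) : (forall t, continuous g t) ->
  Cmean (fun t => c * g t)%C = (c * Cmean g)%C.
Proof.
  intros Hg.
  assert (H1 : forall t, continuous (fun t => Re (g t)) t) by (intros t; apply continuous_Re; auto).
  assert (H2 : forall t, continuous (fun t => Im (g t)) t) by (intros t; apply continuous_Im; auto).
  assert (S1 : forall k t, continuous (fun t => k * Re (g t)) t)
    by (intros; apply continuous_Rmult; [apply continuous_const|auto]).
  assert (S2 : forall k t, continuous (fun t => k * Im (g t)) t)
    by (intros; apply continuous_Rmult; [apply continuous_const|auto]).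
  unfold Cmean, Cmult; simpl. f_equal.
  - rewrite (RInt_cont_minus (fun t => fst c * Re (g t)) (fun t => snd c * Im (g t))); auto.
    rewrite !RInt_cont_scal; auto. unfold Rdiv; ring.
  - rewrite (RInt_cont_plus (fun t => fst c * Im (g t)) (fun t => snd c * Re (g t))); auto.
    rewrite !RInt_cont_scal; auto. unfold Rdiv; ring.
Qed.

Lemma Cmean_const (c : C) : Cmean (fun _ => c) = c.
Proof.
  unfold Cmean. rewrite !RInt_const. unfold scal; simpl; unfold mult; simpl.
  generalize PI_RGT_0; intros. destruct c; unfold Re, Im; simpl. f_equal; field; lra.
Qed.

Lemma Cmean_conj (g : R -> C) : (forall t, continuous g t) ->
  Cmean (fun t => Cconj (g t)) = Cconj (Cmean g).
Proof.
  intros Hg. unfold Cmean, Cconj; simpl. f_equal.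
  rewrite (RInt_ext _ (fun t => -1 * Im (g t))).
  - rewrite RInt_cont_scal; [unfold Rdiv; ring|]. intros t; apply continuous_Im; auto.
  - intros; simpl. unfold Im. ring.
Qed.

(** Real and imaginary parts are bounded separately, which costs [sqrt 2], rounded up to 2. The loss
    is harmless where the bound is used: there a geometric factor tends to 0. *)
Lemma Cmean_bound (g : R -> C) (B : R) : (forall t, continuous g t) ->
  (forall t, 0 <= t <= 2 * PI -> Cmod (g t) <= B) -> Cmod (Cmean g) <= 2 * B.
Proof.
  intros Hg HB. assert (HP := two_PI_pos).
  assert (HK : forall f : R -> R, (forall t, continuous f t) -> (forall t, 0 <= t <= 2 * PI -> Rabs (f t) <= B) ->
    Rabs (RInt f 0 (2 * PI) / (2 * PI)) <= B).
  { intros f Hf Hb. unfold Rdiv. rewrite Rabs_mult, (Rabs_right (/ (2 * PI)))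
      by (left; now apply Rinv_0_lt_compat).
    apply Rle_div_l; auto.
    apply Rle_trans with ((2 * PI - 0) * B); [|lra].
    apply abs_RInt_le_const; [lra|now apply ex_RInt_cont|auto]. }
  assert (H1 := HK (fun t => Re (g t)) (fun t => continuous_Re g t (Hg t))
     (fun t Ht => Rle_trans _ _ _ (re_le_Cmod (g t)) (HB t Ht))).
  assert (H2 := HK (fun t => Im (g t)) (fun t => continuous_Im g t (Hg t))
     (fun t Ht => Rle_trans _ _ _ (Rle_trans _ _ _ (Rmax_r _ _) (Rmax_Cmod (g t))) (HB t Ht))).
  apply Rle_trans with (1 := Cmod_2Rmax _).
  assert (B0 : 0 <= B) by (generalize (Rabs_pos (RInt (fun t => Re (g t)) 0 (2 * PI) / (2 * PI))); lra).
  apply Rmult_le_compat.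
  - apply sqrt_pos.
  - apply Rle_trans with (2 := Rmax_l _ _), Rabs_pos.
  - assert (H : sqrt 2 * sqrt 2 = 2) by (apply sqrt_sqrt; lra). generalize (sqrt_pos 2); nra.
  - apply Rmax_lub; assumption.
Qed.

Lemma Cmean_derive (g g' : R -> C) :
  (forall t, Rder g t (g' t)) -> (forall t, continuous g' t) -> g (2 * PI) = g 0 ->
  Cmean g' = 0%C.
Proof.
  intros D Hc E. unfold Cmean, RtoC.
  assert (H1 : is_RInt (fun t => Re (g' t)) 0 (2 * PI) (minus (Re (g (2 * PI))) (Re (g 0)))).
  { apply (is_RInt_derive (fun t => Re (g t))).
    - intros t _; apply (D t).
    - intros t _; apply continuous_Re, Hc. }
  assert (H2 : is_RInt (fun t => Im (g' t)) 0 (2 * PI) (minus (Im (g (2 * PI))) (Im (g 0)))).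
  { apply (is_RInt_derive (fun t => Im (g t))).
    - intros t _; apply (D t).
    - intros t _; apply continuous_Im, Hc. }
  assert (U1 := is_RInt_unique (V := R_CompleteNormedModule) _ _ _ _ H1).
  assert (U2 := is_RInt_unique (V := R_CompleteNormedModule) _ _ _ _ H2).
  rewrite U1, U2, E, !minus_eq_zero.
  unfold zero; simpl; f_equal; unfold Rdiv; ring.
Qed.

(** Joint continuity at the points [(z, t)] becomes uniform in [t] by compactness of [[a, b]]. *)
Lemma RInt_param_continuous {T : UniformSpace} (g : T -> R -> R) (z : T) (a b : R) : a <= b ->
  locally z (fun w => forall t, continuous (g w) t) ->
  (forall t, continuous (fun p : T * R => g (fst p) (snd p)) (z, t)) ->
  continuous (fun w => RInt (g w) a b) z.
Proof.
  intros Hab Hl Hc. assert (Hz := locally_singleton _ _ Hl). simpl in Hz.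
  apply (proj2 (filterlim_locally (fun w => RInt (g w) a b) (RInt (g z) a b))).
  intros eps.
  (* The [+ 1] keeps the denominator positive when [a = b]. *)
  set (e := eps / (b - a + 1)).
  assert (He : 0 < e) by (apply Rdiv_lt_0_compat; [apply cond_pos|lra]).
  assert (Hd : forall t, exists d : posreal, forall w s, ball z d w -> Rabs (s - t) < d ->
     Rabs (g w s - g z t) < e / 2).
  { intros t.
    assert (He2 : 0 < e / 2) by lra.
    destruct (proj1 (filterlim_locally (fun p : T * R => g (fst p) (snd p)) (g z t)) (Hc t) (mkposreal _ He2)) as [d Hd].
    exists d. intros w s Hw Hs. apply (Hd (w, s)). split; [exact Hw|exact Hs]. }
  apply functional_choice in Hd. destruct Hd as [delta Hd].
  destruct (compactness_value_1d a b delta) as [d Hdd].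
  generalize (filter_and _ _ Hl (locally_ball z d)). apply filter_imp.
  intros w [Hw Bw].
  assert (HB : forall s, a <= s <= b -> Rabs (g w s - g z s) <= e).
  (* The covering point near [s] is supplied by [compactness_value_1d] only under a double
     negation. *)
  { intros s Hs. apply NNPP. intros Hn. apply (Hdd s Hs). intros [t [Ht [Hst Hdt]]].
    apply Hn.
    assert (A1 := Hd t w s (ball_le _ _ _ Hdt _ Bw) Hst).
    assert (A2 := Hd t z s (ball_center _ _) Hst).
    replace (g w s - g z s) with ((g w s - g z t) - (g z s - g z t)) by ring.
    apply Rle_trans with (1 := Rabs_triang _ _). rewrite Rabs_Ropp. lra. }
  change (Rabs (RInt (g w) a b - RInt (g z) a b) < eps).
  rewrite <- (RInt_minus (g w) (g z)) by (now apply ex_RInt_cont).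
  apply Rle_lt_trans with ((b - a) * e).
  - apply abs_RInt_le_const; auto.
    apply (ex_RInt_cont (fun s => g w s - g z s)). intros; apply continuous_Rminus; auto.
  - unfold e.
    replace ((b - a) * (eps / (b - a + 1))) with (((b - a) * eps) / (b - a + 1)) by (field; lra).
    apply Rlt_div_l; [lra|]. assert (H1 := cond_pos eps). nra.
Qed.

Lemma Cmean_param_continuous {T : UniformSpace} (g : T -> R -> C) (z : T) :
  locally z (fun w => forall t, continuous (g w) t) ->
  (forall t, continuous (fun p : T * R => g (fst p) (snd p)) (z, t)) ->
  continuous (fun w => Cmean (g w)) z.
Proof.
  intros Hl Hc. assert (HP := two_PI_pos). apply continuous_C_intro.
  - apply (continuous_Rmult (fun w => RInt (fun t => Re (g w t)) 0 (2 * PI)) (fun _ => / (2 * PI)));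
      [|apply continuous_const].
    apply (RInt_param_continuous (fun w t => Re (g w t))); [lra| |].
    + revert Hl; apply filter_imp. intros w Hw t; apply continuous_Re, Hw.
    + intros t; exact (continuous_Re _ _ (Hc t)).
  - apply (continuous_Rmult (fun w => RInt (fun t => Im (g w t)) 0 (2 * PI)) (fun _ => / (2 * PI)));
      [|apply continuous_const].
    apply (RInt_param_continuous (fun w t => Im (g w t))); [lra| |].
    + revert Hl; apply filter_imp. intros w Hw t; apply continuous_Im, Hw.
    + intros t; exact (continuous_Im _ _ (Hc t)).
Qed.

(** The mean of the Carathéodory slopes is a slope for the mean, so differentiation under the
    integral reduces to continuity in the parameter. *)
Lemma Cmean_Cder (k Phi : C -> R -> C) (z : C) :
  (forall t, continuous (k z) t) ->
  locally (T := C_UniformSpace) z (fun w => forall t, k w t = (k z t + Phi w t * (w - z))%C) ->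
  locally (T := C_UniformSpace) z (fun w => forall t, continuous (Phi w) t) ->
  (forall t, continuous (fun p : C_UniformSpace * R => Phi (fst p) (snd p)) (z, t)) ->
  Cder (fun w => Cmean (k w)) z (Cmean (Phi z)).
Proof.
  intros Hk HE HPc HPj.
  exists (fun w => Cmean (Phi w)). split; [|split]; auto.
  - now apply (Cmean_param_continuous (T := C_UniformSpace) Phi z).
  - generalize (filter_and _ _ HE HPc). apply filter_imp. intros w [E Hc]; asC.
    rewrite (Cmean_ext _ (fun t => k z t + (w - z) * Phi w t)%C).
    + rewrite Cmean_plus, Cmean_scal; auto; [ring|]. intros t; ctn. apply Hc.
    + intros t; rewrite E; asC; ring.
Qed.

Lemma RInt_is_derive_param (f f' : R -> R -> R) (a b x : R) :
  locally x (fun u => forall t, is_derive (fun v => f v t) u (f' u t)) ->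
  locally x (fun u => forall t, continuous (f u) t) ->
  (forall t, continuous (fun p : R * R => f' (fst p) (snd p)) (x, t)) ->
  is_derive (fun u => RInt (f u) a b) x (RInt (f' x) a b).
Proof.
  intros H1 H2 H3.
  assert (H0 := locally_singleton _ _ H1). simpl in H0.
  evar_last. apply (is_derive_RInt_param f a b x).
  - revert H1; apply filter_imp. intros u Hu t _. now exists (f' u t).
  - intros t _. apply continuity_2d_pt_filterlim.
    pose (D := fun z : R * R => Derive (fun v => f v (snd z)) (fst z)).
    assert (HD : continuous (T := prod_UniformSpace R_UniformSpace R_UniformSpace) (U := R_UniformSpace) D (x, t)).
    { refine (continuous_ext_loc (T := prod_UniformSpace R_UniformSpace R_UniformSpace) (U := R_UniformSpace)
        D (fun p : R * R => f' (fst p) (snd p)) (x, t) _ (H3 t)).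
      destruct H1 as [d Hd]. exists d. intros y [Hy _]. symmetry. apply is_derive_unique, Hd, Hy. }
    exact HD.
  - revert H2; apply filter_imp. intros u Hu. now apply ex_RInt_cont.
  - apply RInt_ext. intros t _. apply is_derive_unique, H0.
Qed.

Lemma Cmean_Rder (E E' : R -> R -> C) (x : R) :
  locally x (fun u => forall t, Rder (fun v => E v t) u (E' u t)) ->
  locally x (fun u => forall t, continuous (E u) t) ->
  (forall t, continuous (fun p : R * R => E' (fst p) (snd p)) (x, t)) ->
  Rder (fun u => Cmean (E u)) x (Cmean (E' x)).
Proof.
  intros H1 H2 H3. split.
  - apply (is_derive_ext (fun u => / (2 * PI) * RInt (fun t => Re (E u t)) 0 (2 * PI))).
    { intros u; simpl; unfold Rdiv; ring. }
    evar_last. apply is_derive_scal. apply (RInt_is_derive_param (fun u t => Re (E u t)) (fun u t => Re (E' u t))).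
    + revert H1; apply filter_imp. intros u Hu t; apply (Hu t).
    + revert H2; apply filter_imp. intros u Hu t; apply continuous_Re, (Hu t).
    + intros t; exact (continuous_Re _ _ (H3 t)).
    + simpl; unfold Rdiv; ring.
  - apply (is_derive_ext (fun u => / (2 * PI) * RInt (fun t => Im (E u t)) 0 (2 * PI))).
    { intros u; simpl; unfold Rdiv; ring. }
    evar_last. apply is_derive_scal. apply (RInt_is_derive_param (fun u t => Im (E u t)) (fun u t => Im (E' u t))).
    + revert H1; apply filter_imp. intros u Hu t; apply (Hu t).
    + revert H2; apply filter_imp. intros u Hu t; apply continuous_Im, (Hu t).
    + intros t; exact (continuous_Im _ _ (H3 t)).
    + simpl; unfold Rdiv; ring.
Qed.

(** * Cauchy's formula and its consequences *)

Lemma continuous_C_id (z : C) : continuous (T := C_UniformSpace) (U := C_UniformSpace) (fun w : C => w) z.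
Proof. apply continuous_id. Qed.

Definition holo (rho : R) (F F' : C -> C) : Prop :=
  forall z, Cmod z < rho -> Cder F z (F' z) /\ continuous (T := C_UniformSpace) (U := C_UniformSpace) F' z.

Definition circ (r t : R) : C := (r * cos t, r * sin t).

Lemma Cmod_circ (r t : R) : 0 <= r -> Cmod (circ r t) = r.
Proof.
  intros Hr. unfold Cmod, circ; simpl fst; simpl snd.
  replace ((r * cos t) ^ 2 + (r * sin t) ^ 2) with (r ^ 2).
  - now apply sqrt_pow2.
  - generalize (sin2_cos2 t); unfold Rsqr; intros H. replace (r ^ 2) with (r ^ 2 * 1) by ring. rewrite <- H; ring.
Qed.

Lemma Rder_circ (r t : R) : Rder (circ r) t (Ci * circ r t)%C.
Proof.
  unfold circ; split; unfold Re, Im; simpl; auto_derive; auto; ring.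
Qed.

Lemma continuous_circ (r t : R) : continuous (circ r) t.
Proof. eapply Rder_continuous, Rder_circ. Qed.

Lemma circ_period (r : R) : circ r (2 * PI) = circ r 0.
Proof. unfold circ. rewrite cos_2PI, sin_2PI, cos_0, sin_0; reflexivity. Qed.

Lemma circ_neq (r t : R) (z : C) : Cmod z < r -> (circ r t - z <> 0)%C.
Proof.
  intros Hz E. assert (H : circ r t = z) by (replace (circ r t) with (circ r t - z + z)%C by ring; rewrite E; ring).
  assert (H0 := Cmod_ge_0 z). rewrite <- H in Hz, H0. rewrite Cmod_circ in Hz; lra.
Qed.

Lemma Cder_eq (F : C -> C) (z l m : C) : l = m -> Cder F z l -> Cder F z m.
Proof. now intros ->. Qed.
Lemma Cder_scal (c : C) (F : C -> C) (z l : C) : Cder F z l -> Cder (fun w => c * F w)%C z (c * l).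
Proof.
  intros H. apply (Cder_eq _ _ (0 * F z + c * l)%C); [ring|].
  apply (Cder_mult (fun _ => c)); [apply Cder_const|exact H].
Qed.

Lemma Rder_plus (f g : R -> C) (t : R) (l m : C) :
  Rder f t l -> Rder g t m -> Rder (fun s => f s + g s)%C t (l + m).
Proof.
  intros [A1 A2] [B1 B2]; split.
  - exact (is_derive_plus (fun s => Re (f s)) (fun s => Re (g s)) t _ _ A1 B1).
  - exact (is_derive_plus (fun s => Im (f s)) (fun s => Im (g s)) t _ _ A2 B2).
Qed.
Lemma Rder_const (c : C) (t : R) : Rder (fun _ => c) t 0.
Proof. split; apply @is_derive_const. Qed.
Lemma Rder_scal (c : C) (f : R -> C) (t : R) (l : C) :
  Rder f t l -> Rder (fun s => c * f s)%C t (c * l).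
Proof.
  intros H. apply (Rder_comp (fun w => c * w)%C); auto.
  apply (Cder_eq _ _ (c * 1)%C); [ring|]. apply (Cder_scal c (fun w => w)), Cder_id.
Qed.
Lemma Rder_RtoC (t : R) : Rder RtoC t 1.
Proof. split; unfold Re, Im; simpl; auto_derive; auto. Qed.
Lemma Rder_eq (f : R -> C) (t : R) (l m : C) : l = m -> Rder f t l -> Rder f t m.
Proof. now intros ->. Qed.

Lemma Rder_ext (f g : R -> C) (t : R) (l : C) : (forall s, f s = g s) -> Rder f t l -> Rder g t l.
Proof.
  intros E [A1 A2]; split.
  - apply (is_derive_ext (fun s => Re (f s))); auto. intros; now rewrite E.
  - apply (is_derive_ext (fun s => Im (f s))); auto. intros; now rewrite E.
Qed.

Lemma Rder_zero_const (K : R -> C) (a b : R) : a < b ->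
  (forall t, a <= t <= b -> Rder K t 0) -> K a = K b.
Proof.
  intros Hab H. apply injective_projections.
  - apply (eq_is_derive (fun s => Re (K s)) a b); auto. intros t Ht; apply (H t Ht).
  - apply (eq_is_derive (fun s => Im (K s)) a b); auto. intros t Ht; apply (H t Ht).
Qed.

Lemma continuous_comp_C {T : UniformSpace} (F : C -> C) (g : T -> C) (t : T) :
  continuous (T := C_UniformSpace) (U := C_UniformSpace) F (g t) -> continuous g t -> continuous (fun s => F (g s)) t.
Proof. intros HF Hg. apply (continuous_comp (V := C_UniformSpace) (W := C_UniformSpace) g F); auto. Qed.

Lemma Cmean_circ (r : R) : Cmean (circ r) = 0%C.
Proof.
  rewrite (Cmean_ext _ (fun t => Ci * (- Ci * circ r t))%C).
  - apply (Cmean_derive (fun t => - Ci * circ r t)%C).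
    + intros t. apply (Rder_eq _ _ (- Ci * (Ci * circ r t))%C); [ring|]. apply Rder_scal, Rder_circ.
    + intros t. assert (H := continuous_circ r t). ctn.
    + now rewrite circ_period.
  - intros t. apply injective_projections; simpl; ring.
Qed.

Section Cauchy.
Variables (rho : R) (F F' : C -> C) (r : R) (z : C).
Hypotheses (HF : holo rho F F') (Hr : r < rho) (Hz : Cmod z < r).

Let pt (l t : R) : C := (z + RtoC l * (circ r t - z))%C.

Let Cmod_pt (l t : R) : Cmod (pt l t) <= (Rabs (1 - l) + Rabs l) * r.
Proof.
  unfold pt. assert (H0 := Cmod_ge_0 z).
  replace (z + l * (circ r t - z))%C with (RtoC (1 - l) * z + RtoC l * circ r t)%C
    by (rewrite RtoC_minus; ring).
  apply Rle_trans with (1 := Cmod_triangle _ _).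
  rewrite !Cmod_mult, !Cmod_R, Cmod_circ by lra.
  generalize (Rabs_pos (1 - l)) (Rabs_pos l). nra.
Qed.

(** At [l = 1] a two-sided derivative needs values of the parameter slightly beyond 1, where the
    path leaves the disc of radius [r]. Since [|1 - m| + |m| <= 1 + 2 |m - l|], the margin
    [(rho - r) / (2 r)] keeps it inside radius [rho]. *)
Let near_unit (l : R) : 0 <= l <= 1 -> locally l (fun m => forall t, Cmod (pt m t) < rho).
Proof.
  intros Hl. assert (H0 := Cmod_ge_0 z).
  assert (Hd : 0 < (rho - r) / (2 * r)) by (apply Rdiv_lt_0_compat; lra).
  exists (mkposreal _ Hd). intros m Hm t. change (Rabs (m - l) < (rho - r) / (2 * r)) in Hm.
  apply Rlt_div_r in Hm; [|lra].
  apply Rle_lt_trans with (1 := Cmod_pt m t).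
  assert (Rabs (1 - m) <= (1 - l) + Rabs (m - l)).
  { replace (1 - m) with ((1 - l) - (m - l)) by ring. apply Rle_trans with (1 := Rabs_triang _ _).
    rewrite Rabs_Ropp, (Rabs_right (1 - l)); lra. }
  assert (Rabs m <= l + Rabs (m - l)).
  { replace m with (l + (m - l)) at 1 by ring. apply Rle_trans with (1 := Rabs_triang _ _).
    rewrite (Rabs_right l); lra. }
  generalize (Rabs_pos (m - l)). nra.
Qed.

Let continuous_pt_snd (l t : R) : continuous (pt l) t.
Proof. assert (H := continuous_circ r t). unfold pt. ctn. Qed.

Let continuous_pt (l t : R) : continuous (fun p : R * R => pt (fst p) (snd p)) (l, t).
Proof.
  unfold pt. assert (H : continuous (fun p : R * R => circ r (snd p)) (l, t)).
  { apply (continuous_comp (fun p : R * R => snd p) (circ r)); [apply continuous_snd|apply continuous_circ]. }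
  assert (H1 : continuous (fun p : R * R => RtoC (fst p)) (l, t)).
  { apply continuous_RtoC, continuous_fst. }
  ctn.
Qed.

Let continuous_ker (t : R) : continuous (fun t => circ r t / (circ r t - z))%C t.
Proof.
  assert (H := continuous_circ r t). unfold Cdiv. ctn. apply circ_neq, Hz.
Qed.

(** The mean of [F (z + l (zeta - z)) zeta / (zeta - z)] does not depend on [l], since its
    integrand has as [l]-derivative a multiple of the angular derivative of [F (z + l (zeta - z))]. *)
Lemma Cmean_Cauchy_kernel :
  Cmean (fun t => F (circ r t) * (circ r t / (circ r t - z)))%C =
  (F z * Cmean (fun t => circ r t / (circ r t - z)))%C.
Proof.
  assert (H0 := Cmod_ge_0 z).
  set (K := fun l => Cmean (fun t => F (pt l t) * (circ r t / (circ r t - z)))%C).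
  assert (CF : forall w, Cmod w < rho -> continuous (T := C_UniformSpace) (U := C_UniformSpace) F w).
  { intros w Hw. eapply Cder_continuous, HF, Hw. }
  assert (DK : forall l, 0 <= l <= 1 -> Rder K l (Cmean (fun t => F' (pt l t) * circ r t)%C)).
  { intros l Hl. unfold K.
    apply (Cmean_Rder (fun l t => F (pt l t) * (circ r t / (circ r t - z)))%C (fun l t => F' (pt l t) * circ r t)%C).
    - generalize (near_unit l Hl). apply filter_imp. intros u Hu t.
      assert (N := circ_neq r t z Hz).
      apply (Rder_eq _ _ (F' (pt u t) * ((circ r t - z) * 1) * (circ r t / (circ r t - z)))%C); [field; auto|].
      apply (Rder_ext (fun s => (circ r t / (circ r t - z)) * F (pt s t))%C); [intros; ring|].
      apply (Rder_eq _ _ ((circ r t / (circ r t - z)) * (F' (pt u t) * (0 + (circ r t - z) * 1)))%C); [ring|].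
      apply Rder_scal, Rder_comp; [apply HF, Hu|]. apply Rder_plus; [apply Rder_const|].
      apply (Rder_ext (fun s => (circ r t - z) * RtoC s)%C); [intros; ring|]. apply Rder_scal, Rder_RtoC.
    - generalize (near_unit l Hl). apply filter_imp. intros u Hu t.
      apply continuous_Cmult; [|apply continuous_ker].
      apply continuous_comp_C; [apply CF, Hu|apply continuous_pt_snd].
    - intros t. apply continuous_Cmult.
      + apply (continuous_comp_C F' (fun p : R * R => pt (fst p) (snd p))); [|apply continuous_pt].
        apply HF. apply (locally_singleton _ _ (near_unit l Hl)).
      + apply (continuous_comp (fun p : R * R => snd p) (circ r)); [apply continuous_snd|apply continuous_circ]. }
  assert (ZK : forall l, 0 <= l <= 1 -> Cmean (fun t => F' (pt l t) * circ r t)%C = 0%C).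
  { intros l Hl. assert (Hin := locally_singleton _ _ (near_unit l Hl)). simpl in Hin.
    (* The antiderivative in the angle carries a factor [1 / (i l)]. At [l = 0] the integrand is
       instead a constant times [circ r], of mean zero. *)
    destruct (Req_dec l 0) as [->|Nl].
    - rewrite (Cmean_ext _ (fun t => F' z * circ r t)%C).
      + rewrite Cmean_scal, Cmean_circ; [ring|]. intros; apply continuous_circ.
      + intros t. unfold pt. f_equal; f_equal; ring.
    - assert (Nl' : RtoC l <> 0%C) by (intros E; apply Nl, RtoC_inj, E).
      apply (Cmean_derive (fun t => / (Ci * l) * F (pt l t))%C).
      + intros t. apply (Rder_eq _ _ (/ (Ci * l) * (F' (pt l t) * (0 + l * (Ci * circ r t + - 0))))%C).
        * field. split; [exact Nl'|apply Ci_nz].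
        * apply Rder_scal, Rder_comp; [apply HF, Hin|].
          apply Rder_plus; [apply Rder_const|]. apply Rder_scal, Rder_plus; [apply Rder_circ|].
          replace (- 0)%C with (RtoC 0) by ring. apply Rder_const.
      + intros t. assert (Hc := continuous_circ r t). apply continuous_Cmult; auto.
        apply continuous_comp_C; [apply HF, Hin|apply continuous_pt_snd].
      + unfold pt. now rewrite circ_period. }
  (* At [l = 1] the path is the circle itself, at [l = 0] it has shrunk to the point [z]. *)
  assert (E : K 0 = K 1).
  { apply Rder_zero_const; [lra|]. intros t Ht. rewrite <- (ZK t Ht). apply DK, Ht. }
  unfold K in E. rewrite (Cmean_ext _ (fun t => F (pt 1 t) * (circ r t / (circ r t - z)))%C).
  - rewrite <- E. rewrite <- Cmean_scal by apply continuous_ker.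
    apply Cmean_ext. intros t. unfold pt. f_equal; f_equal; ring.
  - intros t. f_equal; f_equal. unfold pt. ring.
Qed.
End Cauchy.


(** * Calculus of holomorphic functions on a disc *)

Lemma holo_continuous (rho : R) (F F' : C -> C) (z : C) : holo rho F F' -> Cmod z < rho ->
  continuous (T := C_UniformSpace) (U := C_UniformSpace) F z.
Proof. intros H Hz. eapply Cder_continuous, H, Hz. Qed.

Lemma holo_le (rho sigma : R) (F F' : C -> C) : sigma <= rho -> holo rho F F' -> holo sigma F F'.
Proof. intros Hs H z Hz; apply H; lra. Qed.

Lemma holo_const (rho : R) (c : C) : holo rho (fun _ => c) (fun _ => 0%C).
Proof. intros z _; split; [apply Cder_const|apply continuous_const]. Qed.
Lemma holo_id (rho : R) : holo rho (fun w => w) (fun _ => 1%C).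
Proof. intros z _; split; [apply Cder_id|apply continuous_const]. Qed.
Lemma holo_plus (rho : R) (F F' G G' : C -> C) : holo rho F F' -> holo rho G G' ->
  holo rho (fun w => F w + G w)%C (fun w => F' w + G' w)%C.
Proof.
  intros HF HG z Hz. destruct (HF z Hz), (HG z Hz). split; [now apply Cder_plus|ctn].
Qed.
Lemma holo_mult (rho : R) (F F' G G' : C -> C) : holo rho F F' -> holo rho G G' ->
  holo rho (fun w => F w * G w)%C (fun w => F' w * G w + F w * G' w)%C.
Proof.
  intros HF HG z Hz. assert (C1 := holo_continuous _ _ _ z HF Hz). assert (C2 := holo_continuous _ _ _ z HG Hz).
  destruct (HF z Hz), (HG z Hz). split; [now apply Cder_mult|ctn].
Qed.
Lemma holo_inv (rho : R) (F F' : C -> C) : holo rho F F' -> (forall z, Cmod z < rho -> F z <> 0%C) ->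
  holo rho (fun w => / F w)%C (fun w => - F' w * / (F w * F w))%C.
Proof.
  intros HF H0 z Hz. assert (C1 := holo_continuous _ _ _ z HF Hz).
  destruct (HF z Hz). assert (N := H0 z Hz). split; [now apply Cder_inv|ctn]. now apply Cmult_neq_0.
Qed.

Definition Holo (rho : R) (F : C -> C) : Prop := exists F', holo rho F F'.

Lemma Holo_const rho c : Holo rho (fun _ => c).
Proof. eexists; apply holo_const. Qed.
Lemma Holo_id rho : Holo rho (fun w => w).
Proof. eexists; apply holo_id. Qed.
Lemma Holo_plus rho F G : Holo rho F -> Holo rho G -> Holo rho (fun w => F w + G w)%C.
Proof. intros [? ?] [? ?]; eexists; eapply holo_plus; eassumption. Qed.
Lemma Holo_mult rho F G : Holo rho F -> Holo rho G -> Holo rho (fun w => F w * G w)%C.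
Proof. intros [? ?] [? ?]; eexists; eapply holo_mult; eassumption. Qed.
Lemma Holo_inv rho F : Holo rho F -> (forall z, Cmod z < rho -> F z <> 0%C) -> Holo rho (fun w => / F w)%C.
Proof. intros [? ?] ?; eexists; eapply holo_inv; eassumption. Qed.
Lemma Holo_ext rho F G : (forall z, F z = G z) -> Holo rho F -> Holo rho G.
Proof.
  intros E [F' H]. exists F'. intros z Hz. destruct (H z Hz); split; auto. now apply (Cder_ext F).
Qed.
Lemma Holo_opp rho F : Holo rho F -> Holo rho (fun w => - F w)%C.
Proof.
  intros H. apply (Holo_ext _ (fun w => Copp 1 * F w)%C); [intros; ring|]. apply Holo_mult; auto using Holo_const.
Qed.
Lemma Holo_minus rho F G : Holo rho F -> Holo rho G -> Holo rho (fun w => F w - G w)%C.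
Proof. intros; apply Holo_plus; auto using Holo_opp. Qed.
Lemma Holo_continuous rho F z : Holo rho F -> Cmod z < rho -> continuous (T := C_UniformSpace) (U := C_UniformSpace) F z.
Proof. intros [? ?]; eauto using holo_continuous. Qed.

(** The local derivatives may come from a different [G] at each point. A global derivative is
    obtained by choice, and [Cder_unique] identifies it near each point with the local one, which
    gives its continuity. *)
Lemma Holo_local (rho : R) (F : C -> C) :
  (forall z, Cmod z < rho -> exists G G',
     locally (T := C_UniformSpace) z (fun w => F w = G w /\ Cder G w (G' w)) /\
     continuous (T := C_UniformSpace) (U := C_UniformSpace) G' z) ->
  Holo rho F.
Proof.
  intros H.
  assert (D : forall z, Cmod z < rho -> exists G G',
     locally (T := C_UniformSpace) z (fun w => Cder F w (G' w)) /\
     continuous (T := C_UniformSpace) (U := C_UniformSpace) G' z /\ G = F).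
  { intros z Hz. destruct (H z Hz) as [G [G' [H1 H2]]]. exists F, G'; split; auto.
    apply locally_locally in H1. revert H1. apply filter_imp. intros w Hw.
    apply (Cder_ext_loc G).
    - revert Hw; apply filter_imp. now intros y [-> _].
    - apply (locally_singleton _ _ Hw). }
  assert (E : forall z, exists l, Cmod z < rho -> Cder F z l).
  { intros z. destruct (Rlt_dec (Cmod z) rho) as [Hz|Hz]; [|exists 0%C; tauto].
    destruct (D z Hz) as [G [G' [H1 _]]]. exists (G' z). intros _. apply (locally_singleton _ _ H1). }
  apply functional_choice in E. destruct E as [F' HF']. exists F'.
  intros z Hz. split; [now apply HF'|].
  destruct (D z Hz) as [G [G' [H1 [H2 _]]]].
  apply (continuous_ext_loc F' G'); auto.
  generalize (filter_and _ _ (locally_Cmod_lt z rho Hz) H1). apply filter_imp. intros w [Hw Dw].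
  eapply Cder_unique; [exact Dw|now apply HF'].
Qed.

Lemma Cmean_holo (rho r : R) (F : C -> C) : Holo rho F -> 0 < r < rho ->
  Cmean (fun t => F (circ r t)) = F 0%C.
Proof.
  intros [F' HF] Hr.
  assert (Hz : Cmod 0 < r) by (rewrite Cmod_0; lra).
  assert (E : forall t, (circ r t / (circ r t - 0) = 1)%C).
  { intros t. assert (N := circ_neq r t 0 Hz). replace (circ r t - 0)%C with (circ r t) in * by ring. field; auto. }
  assert (H := Cmean_Cauchy_kernel rho F F' r 0 HF (proj2 Hr) Hz).
  rewrite (Cmean_ext (fun t => circ r t / (circ r t - 0))%C (fun _ => 1%C)) in H by auto.
  rewrite Cmean_const, Cmult_1_r in H. rewrite <- H. apply Cmean_ext. intros t. rewrite E. ring.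
Qed.

Lemma circ_conj (r t : R) : (circ r t * Cconj (circ r t) = RtoC (r ^ 2))%C.
Proof.
  apply injective_projections; simpl; [|ring].
  generalize (sin2_cos2 t); unfold Rsqr; intros H.
  replace (r * (r * 1)) with (r * r * (sin t * sin t + cos t * cos t)) by (rewrite H; ring). ring.
Qed.

(** On the circle [Cconj w = r^2 / w], so the conjugate of [w / (w - z)] is [1 / (1 - c w)] with
    [c = Cconj z / r^2]. This is holomorphic on a disc of radius [r^2 / |z| > r], and its mean is
    its value 1 at the origin. No series expansion is involved. *)
Lemma Cmean_kernel (r : R) (z : C) : Cmod z < r -> Cmean (fun t => circ r t / (circ r t - z))%C = 1%C.
Proof.
  intros Hz. assert (H0 := Cmod_ge_0 z).
  assert (Hc : forall t, circ r t <> 0%C).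
  { intros t E. assert (N := circ_neq r t 0). rewrite Cmod_0 in N. apply N; [lra|]. rewrite E; ring. }
  (* The case [z = 0] is apart because the radius [r ^ 2 / Cmod z] would divide by zero. *)
  destruct (Ceq_dec z 0) as [->|Nz].
  - rewrite (Cmean_ext _ (fun _ => 1%C)); [apply Cmean_const|].
    intros t. specialize (Hc t). field. replace (circ r t - 0)%C with (circ r t) by ring; auto.
  - assert (Hp : 0 < Cmod z) by now apply Cmod_gt_0.
    set (c := (Cconj z / RtoC (r ^ 2))%C).
    assert (Nr : RtoC (r ^ 2) <> 0%C) by (intros E; apply RtoC_inj in E; nra).
    assert (Hcm : Cmod c = Cmod z / r ^ 2).
    { unfold c. rewrite Cmod_div, Cmod_conj, Cmod_R by auto. rewrite Rabs_right; auto. nra. }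
    assert (ND : forall w, Cmod w < r ^ 2 / Cmod z -> (1 - c * w <> 0)%C).
    { intros w Hw E. assert (E' : (c * w)%C = 1%C) by (replace (c * w)%C with (1 - (1 - c * w))%C by ring; rewrite E; ring).
      assert (Em : Cmod c * Cmod w = 1) by (rewrite <- Cmod_mult, E', Cmod_1; auto).
      rewrite Hcm in Em. apply Rlt_div_r in Hw; [|lra].
      assert (Cmod w * Cmod z = r ^ 2); [|lra]. field_simplify_eq in Em; [lra|]. nra. }
    assert (HG : Holo (r ^ 2 / Cmod z) (fun w => / (1 - c * w))%C).
    { apply Holo_inv; auto. apply Holo_minus; [apply Holo_const|]. apply Holo_mult; [apply Holo_const|apply Holo_id]. }
    assert (Hrr : 0 < r < r ^ 2 / Cmod z).
    { split; [lra|]. apply Rlt_div_r; [lra|]. nra. }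
    assert (M := Cmean_holo _ r _ HG Hrr).
    apply (f_equal Cconj) in M. rewrite <- Cmean_conj in M.
    + transitivity (Cconj (/ (1 - c * 0))).
      * rewrite <- M. apply Cmean_ext. intros t.
        assert (N1 := ND (circ r t)). rewrite Cmod_circ in N1 by lra. specialize (N1 (proj2 Hrr)).
        assert (N2 := circ_neq r t z Hz). specialize (Hc t).
        rewrite Cinv_conj by auto. rewrite Cminus_conj, Cmult_conj. unfold c.
        rewrite Cdiv_conj by auto. rewrite Cconj_conj.
        assert (Er : forall x : R, Cconj x = x) by (intros; apply injective_projections; simpl; ring).
        rewrite !Er. rewrite <- (circ_conj r t).
        assert (N3 : Cconj (circ r t) <> 0%C).
        { intros E. apply Hc. rewrite <- (Cconj_conj (circ r t)), E. apply Er. }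
        field. repeat split; auto.
      * replace (1 - c * 0)%C with (RtoC 1) by ring. apply injective_projections; simpl; field.
    + intros t. assert (H := continuous_circ r t). ctn. apply ND. rewrite Cmod_circ; lra.
Qed.

Lemma Cauchy_formula (rho r : R) (F : C -> C) (z : C) : Holo rho F -> r < rho -> Cmod z < r ->
  F z = Cmean (fun t => F (circ r t) * (circ r t / (circ r t - z)))%C.
Proof.
  intros [F' HF] Hr Hz. rewrite (Cmean_Cauchy_kernel rho F F' r z HF Hr Hz).
  rewrite Cmean_kernel by auto. ring.
Qed.

(** The exponent makes the family closed under differentiation in [z]; the weight is free so that it
    may be [F] on the circle, with or without the factor [circ r t]. *)
Definition Cauchy_int (w : R -> C) (r : R) (n : nat) (z : C) : C :=
  Cmean (fun t => w t * (/ (circ r t - z)) ^ n)%C.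

(** The slope of a power of the resolvent. For [a = 1 / (zeta - y)] and [b = 1 / (zeta - z)] one has
    [a - b = a b (y - z)], and [a^n - b^n] is [y - z] times this polynomial in [a] and [b], which is
    visibly continuous. *)
Fixpoint pow_slope (n : nat) (a b : C) : C :=
  match n with O => 0%C | S m => (a * pow_slope m a b + b ^ m * (a * b))%C end.

Lemma pow_slope_correct (n : nat) (a b h : C) : (a - b = a * b * h)%C ->
  (a ^ n - b ^ n = pow_slope n a b * h)%C.
Proof.
  intros H. induction n as [|n IH]; simpl; [ring|].
  replace (a * a ^ n - b * b ^ n)%C with (a * (a ^ n - b ^ n) + b ^ n * (a - b))%C by ring.
  rewrite IH, H. ring.
Qed.

Lemma pow_slope_diag (n : nat) (b : C) : (pow_slope n b b = RtoC (INR n) * b ^ S n)%C.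
Proof.
  induction n as [|n IH]; [simpl; ring|].
  change (pow_slope (S n) b b) with (b * pow_slope n b b + b ^ n * (b * b))%C.
  rewrite IH, S_INR, RtoC_plus. simpl. ring.
Qed.

Lemma continuous_Cpow {T : UniformSpace} (F : T -> C) (n : nat) (t : T) :
  continuous F t -> continuous (fun s => F s ^ n)%C t.
Proof.
  intros H; induction n as [|n IH]; simpl; [apply continuous_const|]. now apply continuous_Cmult.
Qed.

Lemma continuous_pow_slope {T : UniformSpace} (F G : T -> C) (n : nat) (t : T) :
  continuous F t -> continuous G t -> continuous (fun s => pow_slope n (F s) (G s)) t.
Proof.
  intros HF HG; induction n as [|n IH]; simpl; [apply continuous_const|].
  assert (H := continuous_Cpow G n t HG). ctn.
Qed.

Lemma Cder_Cauchy_int (w : R -> C) (r : R) (n : nat) (z : C) :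
  (forall t, continuous w t) -> Cmod z < r ->
  Cder (Cauchy_int w r n) z (RtoC (INR n) * Cauchy_int w r (S n) z)%C.
Proof.
  intros Hw Hz.
  assert (Hc : forall y, Cmod y < r -> forall t, continuous (fun t => / (circ r t - y))%C t).
  { intros y Hy t. assert (H := continuous_circ r t). ctn. now apply circ_neq. }
  assert (Hcw : forall y, Cmod y < r -> forall t, continuous (fun t => w t * pow_slope n (/ (circ r t - y)) (/ (circ r t - z)))%C t).
  { intros y Hy t. apply continuous_Cmult; auto. apply continuous_pow_slope; auto. }
  apply (Cder_eq _ _ (Cmean (fun t => w t * pow_slope n (/ (circ r t - z)) (/ (circ r t - z))))%C).
  { unfold Cauchy_int. rewrite <- Cmean_scal.
    - apply Cmean_ext. intros t. rewrite pow_slope_diag. ring.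
    - intros t. apply continuous_Cmult; auto. apply continuous_Cpow; auto. }
  apply (Cmean_Cder (fun y t => w t * (/ (circ r t - y)) ^ n)%C
    (fun y t => w t * pow_slope n (/ (circ r t - y)) (/ (circ r t - z)))%C).
  - intros t. apply continuous_Cmult; auto. apply continuous_Cpow; auto.
  - generalize (locally_Cmod_lt z r Hz). apply filter_imp. intros y Hy t. asC.
    assert (N1 := circ_neq r t z Hz). assert (N2 := circ_neq r t y Hy).
    rewrite <- Cmult_assoc. rewrite <- (pow_slope_correct n (/ (circ r t - y)) (/ (circ r t - z)) (y - z)).
    + ring.
    + field. split; auto.
  - generalize (locally_Cmod_lt z r Hz). apply filter_imp. intros y Hy t. now apply Hcw.
  - intros t.
    assert (P1 : continuous (fun p : C_UniformSpace * R => w (snd p)) (z, t)).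
    { apply (continuous_comp (fun p : C_UniformSpace * R => snd p) w); [apply continuous_snd|apply Hw]. }
    assert (P2 : continuous (fun p : C_UniformSpace * R => circ r (snd p)) (z, t)).
    { apply (continuous_comp (fun p : C_UniformSpace * R => snd p) (circ r)); [apply continuous_snd|apply continuous_circ]. }
    assert (P3 : continuous (U := C_UniformSpace) (fun p : C_UniformSpace * R => fst p) (z, t)).
    { apply continuous_fst. }
    apply continuous_Cmult; [exact P1|]. apply (continuous_pow_slope (fun p : C_UniformSpace * R => / (circ r (snd p) - fst p))%C (fun p : C_UniformSpace * R => / (circ r (snd p) - z))%C).
    + ctn. now apply circ_neq.
    + ctn. now apply circ_neq.
Qed.

Lemma continuous_Cauchy_int (w : R -> C) (r : R) (n : nat) (z : C) :
  (forall t, continuous w t) -> Cmod z < r ->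
  continuous (T := C_UniformSpace) (U := C_UniformSpace) (Cauchy_int w r n) z.
Proof. intros; eapply Cder_continuous, Cder_Cauchy_int; auto. Qed.

Lemma continuous_on_circ (rho r : R) (F : C -> C) : Holo rho F -> 0 < r < rho ->
  forall t, continuous (fun t => F (circ r t)) t.
Proof.
  intros HF Hr t. apply continuous_comp_C; [|apply continuous_circ].
  apply (Holo_continuous rho); auto. rewrite Cmod_circ; lra.
Qed.

(** Near [z], Cauchy's formula writes [F] as the Cauchy integral with exponent 1. By uniqueness [F']
    is the one with exponent 2, whose derivative is twice the one with exponent 3. *)
Lemma Holo_derive (rho : R) (F F' : C -> C) : holo rho F F' -> Holo rho F'.
Proof.
  intros HF. apply Holo_local. intros z Hz. assert (H0 := Cmod_ge_0 z).
  set (r := (Cmod z + rho) / 2). assert (Hr : 0 < r < rho) by (unfold r; lra).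
  assert (Hzr : Cmod z < r) by (unfold r; lra).
  set (w := fun t => (F (circ r t) * circ r t)%C).
  assert (Hw : forall t, continuous w t).
  { intros t. apply continuous_Cmult; [|apply continuous_circ]. apply (continuous_on_circ rho); auto. now exists F'. }
  exists (Cauchy_int w r 2), (fun y => RtoC (INR 2) * Cauchy_int w r 3 y)%C. split.
  - generalize (locally_Cmod_lt z r Hzr). apply filter_imp. intros y Hy. split; [|now apply Cder_Cauchy_int].
    apply (Cder_unique F y); [apply HF; lra|].
    apply (Cder_eq _ _ (RtoC (INR 1) * Cauchy_int w r 2 y)%C); [simpl; ring|].
    apply (Cder_ext_loc (Cauchy_int w r 1)); [|now apply Cder_Cauchy_int].
    generalize (locally_Cmod_lt y r Hy). apply filter_imp. intros x Hx. asC.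
    rewrite (Cauchy_formula rho r F x); auto; [|now exists F'|lra].
    unfold Cauchy_int, w. apply Cmean_ext. intros t. simpl. unfold Cdiv. ring.
  - assert (H := continuous_Cauchy_int w r 3 z Hw Hzr). ctn.
Qed.

(** Since [zeta / (zeta - z) = 1 + z / (zeta - z)] and the mean of [F] is [F 0], Cauchy's formula
    reads [F z = F 0 + z G z] with [G] a Cauchy integral. That integral removes the singularity at
    0; away from 0 the plain quotient serves, and the two agree where both make sense. *)
Lemma Holo_div (rho : R) (F : C -> C) : 0 < rho -> Holo rho F ->
  exists G, Holo rho G /\ forall z, Cmod z < rho -> F z = (F 0 + z * G z)%C.
Proof.
  intros Hrho HF.
  set (r := rho / 2). assert (Hr : 0 < r < rho) by (unfold r; lra).
  set (w := fun t => F (circ r t)).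
  assert (Hw : forall t, continuous w t) by (apply (continuous_on_circ rho); auto).
  assert (Hk : forall z, Cmod z < r -> F z = (F 0 + z * Cauchy_int w r 1 z)%C).
  { intros z Hz. rewrite <- (Cmean_holo rho r F HF Hr) at 1. unfold Cauchy_int.
    assert (Hc : forall t, continuous (fun t => w t * (/ (circ r t - z)) ^ 1)%C t).
    { intros t. apply continuous_Cmult; auto. apply continuous_Cpow.
      assert (H := continuous_circ r t). ctn. now apply circ_neq. }
    rewrite <- Cmean_scal by auto. rewrite <- Cmean_plus; auto.
    - rewrite (Cauchy_formula rho r F z) by (auto; lra). apply Cmean_ext. intros t. unfold w.
      simpl. field. now apply circ_neq.
    - intros t. apply (continuous_Cmult (fun _ => z)); [apply continuous_const|apply Hc]. }
  set (G := fun z : C => if Rlt_dec (Cmod z) r then Cauchy_int w r 1 z else ((F z - F 0) * / z)%C).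
  assert (GE : forall z : C, z <> 0%C -> G z = ((F z - F 0) * / z)%C).
  { intros z Nz. unfold G. destruct (Rlt_dec (Cmod z) r) as [H|H]; auto. rewrite (Hk z H). field. auto. }
  exists G. split.
  - apply Holo_local. intros z Hz. destruct (Ceq_dec z 0) as [->|Nz].
    + exists (Cauchy_int w r 1), (fun y => RtoC (INR 1) * Cauchy_int w r 2 y)%C.
      assert (H0 : Cmod 0 < r) by (rewrite Cmod_0; lra). split.
      * generalize (locally_Cmod_lt 0 r H0). apply filter_imp. intros y Hy. split; [|now apply Cder_Cauchy_int].
        unfold G. destruct (Rlt_dec (Cmod y) r) as [H|H]; [auto|contradiction].
      * assert (H := continuous_Cauchy_int w r 2 0 Hw H0). ctn.
    + destruct HF as [F' HF].
      exists (fun y => (F y - F 0) * / y)%C, (fun y => (F' y + 0) * / y + (F y - F 0) * (- (1) * / (y * y)))%C.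
      assert (Hp : 0 < Cmod z) by now apply Cmod_gt_0.
      split.
      * generalize (filter_and _ _ (locally_Cmod_lt z rho Hz) (locally_Cmod z (Cmod z) Hp)).
        apply filter_imp. intros y [Hy Hy0].
        assert (Ny : (y : C) <> 0%C).
        { intros E. rewrite E in Hy0. replace (0 - z)%C with (- z)%C in Hy0 by ring. rewrite Cmod_opp in Hy0. lra. }
        split; [now apply GE|].
        apply (Cder_mult (fun y => F y - F 0)%C (fun y => / y)%C);
          [|apply (Cder_inv (fun y => y)); [apply Cder_id|auto]].
        apply (Cder_plus F (fun _ => - F 0)%C); [now apply HF|apply Cder_const].
      * assert (H1 := holo_continuous _ _ _ z HF Hz). destruct (HF z Hz) as [_ H2].
        assert (H3 := continuous_C_id z). 
        assert (H4 : (z * z <> 0)%C) by now apply Cmult_neq_0.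
        assert (H5 := continuous_Cinv (fun y : C => y) z H3 Nz).
        ctn; auto.
  - intros z Hz. destruct (Ceq_dec z 0) as [->|Nz]; [ring|]. rewrite GE by auto. field. auto.
Qed.


(** * Identity principle, Poisson's formula and Harnack's inequality *)

Lemma Cmod_sub_ge (r t : R) (z : C) : 0 <= r -> r - Cmod z <= Cmod (circ r t - z).
Proof.
  intros Hr. assert (H := Cmod_triangle (circ r t - z) z).
  replace (circ r t - z + z)%C with (circ r t) in H by ring. rewrite Cmod_circ in H; lra.
Qed.

Lemma continuous_kernel (r : R) (z : C) (t : R) : Cmod z < r ->
  continuous (fun t => circ r t / (circ r t - z))%C t.
Proof.
  intros Hz. assert (H := continuous_circ r t). unfold Cdiv. ctn. now apply circ_neq.
Qed.

Lemma bounded_on_circ (rho r : R) (F : C -> C) : Holo rho F -> 0 < r < rho ->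
  exists M, 0 <= M /\ forall t, 0 <= t <= 2 * PI -> Cmod (F (circ r t)) <= M.
Proof.
  intros HF Hr. assert (HP := two_PI_pos).
  destruct (continuity_ab_maj (fun t => Cmod (F (circ r t))) 0 (2 * PI)) as [m [Hm _]]; [lra| |].
  - intros t _. apply continuity_pt_filterlim.
    apply (continuous_Cmod (fun t => F (circ r t))), (continuous_on_circ rho); auto.
  - exists (Cmod (F (circ r m))). split; [apply Cmod_ge_0|auto].
Qed.

Lemma real_zero_at_0 (rho : R) (G : C -> C) : 0 < rho -> Holo rho G ->
  (forall x : R, x <> 0 -> Rabs x < rho -> G x = 0%C) -> G 0%C = 0%C.
Proof.
  intros Hrho HG H. apply NNPP. intros N.
  assert (H0 : Cmod 0 < rho) by (rewrite Cmod_0; lra).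
  assert (CM := continuous_Cmod G (RtoC 0) (Holo_continuous _ _ _ HG H0)).
  assert (Hpos : 0 < Cmod (G 0%C)) by now apply Cmod_gt_0.
  assert (HL := CM (fun r => 0 < r) (open_gt 0 _ Hpos)). unfold filtermap in HL.
  apply locally_C_exists in HL. destruct HL as [d [Hd HL]].
  set (x := Rmin d rho / 2).
  assert (Hx : 0 < x < Rmin d rho) by (unfold x; generalize (Rmin_glb_lt _ _ _ Hd Hrho); lra).
  assert (Hxd := Rmin_l d rho). assert (Hxr := Rmin_r d rho).
  specialize (HL (RtoC x)). rewrite H in HL.
  - rewrite Cmod_0 in HL. apply (Rlt_irrefl 0), HL.
    replace (x - 0)%C with (RtoC x) by ring. rewrite Cmod_R, Rabs_right; lra.
  - lra.
  - rewrite Rabs_right; lra.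
Qed.

(** Each division by [z] keeps the zeros on the real diameter, except possibly at the origin, where
    continuity restores the zero so that the division can be repeated. *)
Lemma Holo_div_pow (rho : R) (F : C -> C) (n : nat) : 0 < rho -> Holo rho F ->
  (forall x : R, Rabs x < rho -> F x = 0%C) ->
  exists G, Holo rho G /\ (forall x : R, Rabs x < rho -> G x = 0%C) /\
    forall z : C, Cmod z < rho -> F z = (z ^ n * G z)%C.
Proof.
  intros Hrho HF H0. induction n as [|n [G [HG [HG0 E]]]].
  - exists F. split; [|split]; auto. intros; simpl; ring.
  - destruct (Holo_div rho G Hrho HG) as [G1 [HG1 E1]].
    assert (E0 : G 0%C = 0%C) by (apply HG0; rewrite Rabs_R0; lra).
    assert (HN : forall x : R, x <> 0 -> Rabs x < rho -> G1 x = 0%C).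
    { intros x Nx Hx. assert (A := E1 (RtoC x)). rewrite Cmod_R in A. specialize (A Hx).
      rewrite HG0, E0 in A by auto.
      assert (Nx' : RtoC x <> 0%C) by (intros e; apply Nx, RtoC_inj, e).
      apply NNPP. intros N. apply (Cmult_neq_0 _ _ Nx' N). rewrite A. ring. }
    exists G1. split; [|split]; auto.
    + intros x Hx. destruct (Req_dec x 0) as [->|Nx]; auto. now apply (real_zero_at_0 rho).
    + intros z Hz. rewrite E, E1, E0 by auto. simpl. ring.
Qed.

(** [F] is divisible by every power of [z], and Cauchy's formula bounds the quotient [F / z^n]
    at [z] by a constant times [r^(-n)], with [|z| < r]. *)
Lemma identity_principle (rho : R) (F : C -> C) (z : C) : Holo rho F ->
  (forall x : R, Rabs x < rho -> F x = 0%C) -> Cmod z < rho -> F z = 0%C.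
Proof.
  intros HF H0 Hz. assert (Hz0 := Cmod_ge_0 z).
  set (r := (Cmod z + rho) / 2). assert (Hr : 0 < r < rho) by (unfold r; lra).
  assert (Hzr : Cmod z < r) by (unfold r; lra).
  destruct (bounded_on_circ rho r F HF Hr) as [M [HM0 HM]].
  set (B := 2 * (M * (r / (r - Cmod z)))).
  assert (HB : forall n, Cmod (F z) <= (Cmod z / r) ^ n * B).
  { intros n. destruct (Holo_div_pow rho F n) as [G [HG [_ E]]]; auto; [lra|].
    rewrite E by auto. rewrite Cmod_mult, Cmod_pow.
    assert (Hrn : 0 < r ^ n) by (apply pow_lt; lra).
    assert (HGb : Cmod (G z) <= 2 * (M / r ^ n * (r / (r - Cmod z)))).
    { rewrite (Cauchy_formula rho r G z) by (auto; lra). apply Cmean_bound.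
      - intros t. apply continuous_Cmult; [apply (continuous_on_circ rho); auto|now apply continuous_kernel].
      - intros t Ht. assert (N := circ_neq r t z Hzr). rewrite Cmod_mult, Cmod_div, Cmod_circ by (auto; lra).
        assert (D := Cmod_sub_ge r t z (Rlt_le _ _ (proj1 Hr))).
        apply Rmult_le_compat.
        + apply Cmod_ge_0.
        + apply Rdiv_le_0_compat; lra.
        + apply Rle_div_r; auto. specialize (HM t Ht). rewrite E in HM by (rewrite Cmod_circ; lra).
          rewrite Cmod_mult, Cmod_pow, Cmod_circ in HM by lra. lra.
        + apply Rmult_le_compat_l; [lra|]. apply Rinv_le_contravar; lra. }
    apply Rle_trans with (Cmod z ^ n * (2 * (M / r ^ n * (r / (r - Cmod z))))).
    - apply Rmult_le_compat_l; auto. now apply pow_le.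
    - right. unfold B. unfold Rdiv. rewrite Rpow_mult_distr, pow_inv by lra. ring. }
  apply NNPP. intros N. apply Cmod_gt_0 in N.
  assert (Hq : Rabs (Cmod z / r) < 1).
  { rewrite Rabs_right; [|apply Rle_ge, Rdiv_le_0_compat; lra]. apply Rlt_div_l; lra. }
  assert (HB0 : 0 <= B).
  { unfold B. assert (0 <= r / (r - Cmod z)) by (apply Rdiv_le_0_compat; lra). nra. }
  assert (He : 0 < Cmod (F z) / (B + 1)) by (apply Rdiv_lt_0_compat; lra).
  destruct (pow_lt_1_zero _ Hq _ He) as [n Hn]. specialize (Hn n (le_n n)).
  specialize (HB n). apply Rabs_def2 in Hn. destruct Hn as [Hn _]. apply Rlt_div_r in Hn; [|lra].
  assert (0 <= (Cmod z / r) ^ n) by (apply pow_le, Rdiv_le_0_compat; lra). nra.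
Qed.

(** With [w] on the circle, [r^2 = w * Cconj w] turns the second term into the conjugate of
    [z / (w - z)], while the first is [1 + z / (w - z)]; the sum is therefore real. *)
Lemma Poisson_kernel_real (r t : R) (z : C) : Cmod z < r ->
  (circ r t / (circ r t - z) + Cconj z * circ r t / (RtoC (r ^ 2) - Cconj z * circ r t))%C =
  RtoC ((r ^ 2 - Cmod z ^ 2) / Cmod (circ r t - z) ^ 2).
Proof.
  intros Hz. assert (N := circ_neq r t z Hz).
  set (w := circ r t) in *. assert (Ew : (w * Cconj w = RtoC (r ^ 2))%C) by apply circ_conj.
  assert (Nw : w <> 0%C).
  { intros E. assert (H := Cmod_ge_0 z). assert (K : Cmod w = r) by (apply Cmod_circ; lra).
    rewrite E, Cmod_0 in K. lra. }
  assert (Nc : Cconj (w - z) <> 0%C).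
  { intros E. apply N. rewrite <- (Cconj_conj (w - z)), E. apply injective_projections; simpl; ring. }
  rewrite Cminus_conj in Nc.
  assert (Hp := proj1 (Cmod_gt_0 _) N).
  rewrite RtoC_div by nra. rewrite RtoC_minus. rewrite <- Ew.
  rewrite !RtoC_pow, <- !RtoC_pow, !Cmod2_conj, Cminus_conj.
  rewrite <- ?Ew. field. repeat split; auto.
  replace (w * Cconj w - Cconj z * w)%C with (w * (Cconj w - Cconj z))%C by ring. now apply Cmult_neq_0.
Qed.

(** The term added to the Cauchy kernel is holomorphic in [w] past the circle and vanishes at 0, so
    its product with [F] has mean zero. *)
Lemma Poisson_formula (rho r : R) (F : C -> C) (z : C) : Holo rho F -> r < rho -> Cmod z < r ->
  F z = Cmean (fun t => F (circ r t) * RtoC ((r ^ 2 - Cmod z ^ 2) / Cmod (circ r t - z) ^ 2))%C.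
Proof.
  intros HF Hr Hz. assert (Hz0 := Cmod_ge_0 z).
  (* The pole of the added term has modulus [r^2 / |z|]. The midpoint of [|z|] and [r] in place of
     [|z|] gives a smaller radius, still above [r], and avoids a division by zero at [z = 0]. *)
  set (rho1 := Rmin rho (r ^ 2 / ((Cmod z + r) / 2))).
  assert (Hrho1 : r < rho1).
  { apply Rmin_glb_lt; auto. apply Rlt_div_r; nra. }
  assert (ND : forall w : C, Cmod w < rho1 -> (RtoC (r ^ 2) - Cconj z * w <> 0)%C).
  { intros w Hw E. assert (E' : (Cconj z * w = RtoC (r ^ 2))%C).
    { replace (Cconj z * w)%C with (RtoC (r ^ 2) - (RtoC (r ^ 2) - Cconj z * w))%C by ring. rewrite E; ring. }
    apply (f_equal Cmod) in E'. rewrite Cmod_mult, Cmod_conj, Cmod_R, Rabs_right in E' by nra.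
    assert (A : Cmod w < r ^ 2 / ((Cmod z + r) / 2)) by (apply Rlt_le_trans with (1 := Hw), Rmin_r).
    apply Rlt_div_r in A; [|lra]. assert (Hw0 := Cmod_ge_0 w). nra. }
  assert (HF1 : Holo rho1 F).
  { destruct HF as [F' HF]. exists F'. apply (holo_le rho); auto. apply Rmin_l. }
  assert (HG : Holo rho1 (fun w => F w * (Cconj z * w * / (RtoC (r ^ 2) - Cconj z * w)))%C).
  { apply Holo_mult; auto. apply Holo_mult; [apply Holo_mult; [apply Holo_const|apply Holo_id]|].
    apply Holo_inv; auto. apply Holo_minus; [apply Holo_const|apply Holo_mult; [apply Holo_const|apply Holo_id]]. }
  assert (Hr' : 0 < r < rho1) by lra.
  assert (M := Cmean_holo rho1 r _ HG Hr'). cbv beta in M.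
  rewrite (Cauchy_formula rho r F z HF Hr Hz).
  replace (Cmean (fun t => F (circ r t) * (circ r t / (circ r t - z))))%C with
    (Cmean (fun t => F (circ r t) * (circ r t / (circ r t - z))) +
     Cmean (fun t => F (circ r t) * (Cconj z * circ r t * / (RtoC (r ^ 2) - Cconj z * circ r t))))%C
    by (rewrite M; ring).
  rewrite <- Cmean_plus.
  - apply Cmean_ext. intros t. rewrite <- (Poisson_kernel_real r t z Hz). unfold Cdiv. ring.
  - intros t. apply continuous_Cmult; [apply (continuous_on_circ rho1); auto|now apply continuous_kernel].
  - exact (continuous_on_circ rho1 r _ HG Hr').
Qed.

Lemma Re_Cmean_le (g h : R -> C) : (forall t, continuous g t) -> (forall t, continuous h t) ->
  (forall t, Re (g t) <= Re (h t)) -> Re (Cmean g) <= Re (Cmean h).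
Proof.
  intros Hg Hh H. unfold Cmean; simpl. assert (HP := two_PI_pos).
  apply Rmult_le_compat_r; [left; now apply Rinv_0_lt_compat|].
  apply RInt_le; [lra|apply ex_RInt_cont|apply ex_RInt_cont|auto]; intros t; apply continuous_Re; auto.
Qed.

(** As [|circ r t - z| >= r - |z|], the Poisson kernel is at most [(r + |z|) / (r - |z|)];
    positivity of [Re F] on the circle lets this bound be integrated. *)
Lemma Harnack_lt (rho r : R) (F : C -> C) (z : C) : Holo rho F -> r < rho -> Cmod z < r ->
  (forall w, Cmod w < rho -> 0 <= Re (F w)) ->
  (r - Cmod z) * Re (F z) <= (r + Cmod z) * Re (F 0%C).
Proof.
  intros HF Hr Hz Hpos. assert (Hz0 := Cmod_ge_0 z).
  assert (Hr' : 0 < r < rho) by lra.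
  set (k := (r + Cmod z) / (r - Cmod z)).
  assert (A : Re (F z) <= k * Re (F 0%C)).
  { rewrite <- (Cmean_holo rho r F HF Hr').
    rewrite (Poisson_formula rho r F z HF Hr Hz).
    assert (CF := continuous_on_circ rho r F HF Hr').
    assert (ES : k * Re (Cmean (fun t => F (circ r t))) = Re (Cmean (fun t => RtoC k * F (circ r t))%C)).
    { rewrite Cmean_scal by auto. now rewrite re_scal_l. }
    rewrite ES. apply Re_Cmean_le.
    - intros t. apply continuous_Cmult; auto. apply continuous_RtoC. apply continuous_Rmult; [apply continuous_const|].
      assert (Hc := continuous_circ r t).
      assert (Hm : continuous (fun t => Cmod (circ r t - z)) t) by (apply continuous_Cmod; ctn).
      assert (Nm := proj1 (Cmod_gt_0 _) (circ_neq r t z Hz)).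
      apply continuous_Rinv_gen; [|nra].
      apply (continuous_ext (fun t => Cmod (circ r t - z) * Cmod (circ r t - z))); [intros; simpl; ring|].
      exact (continuous_Rmult _ _ t Hm Hm).
    - intros t. apply continuous_Cmult; auto. apply continuous_const.
    - intros t. rewrite re_scal_r, re_scal_l, Rmult_comm. 
      apply Rmult_le_compat_r; [apply Hpos; rewrite Cmod_circ; lra|].
      assert (D := Cmod_sub_ge r t z (Rlt_le _ _ (proj1 Hr'))).
      unfold k. replace ((r + Cmod z) / (r - Cmod z)) with ((r ^ 2 - Cmod z ^ 2) / (r - Cmod z) ^ 2) by (field; lra).
      apply Rmult_le_compat_l; [nra|]. apply Rinv_le_contravar; [apply pow_lt; lra|]. apply pow_incr; lra. }
  unfold k in A.
  apply (Rmult_le_compat_l (r - Cmod z)) in A; [|lra].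
  replace ((r - Cmod z) * ((r + Cmod z) / (r - Cmod z) * Re (F 0%C))) with ((r + Cmod z) * Re (F 0%C)) in A by (field; lra).
  exact A.
Qed.

Lemma Harnack (rho : R) (F : C -> C) (z : C) : Holo rho F -> Cmod z < rho ->
  (forall w, Cmod w < rho -> 0 <= Re (F w)) ->
  (rho - Cmod z) * Re (F z) <= (rho + Cmod z) * Re (F 0%C).
Proof.
  intros HF Hz Hpos. assert (Hz0 := Cmod_ge_0 z).
  apply Rnot_lt_le. intros HC.
  set (A := Re (F z)) in *. set (B := Re (F 0%C)) in *.
  assert (HB : 0 <= B) by (apply Hpos; rewrite Cmod_0; lra).
  assert (HA : 0 <= A) by (apply Hpos; lra).
  set (gap := (rho - Cmod z) * A - (rho + Cmod z) * B).
  (* The radius [rho - d] must stay above [|z|], which is the first bound. Shrinking by [d] changes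
     the inequality by at most [d A], which the second bound keeps below [gap]; the [+ 1] covers
     [A = 0]. *)
  set (d := Rmin ((rho - Cmod z) / 2) (gap / (2 * (A + 1)))).
  assert (Hg : 0 < gap) by (unfold gap; lra).
  assert (Hd : 0 < d) by (apply Rmin_glb_lt; [lra|apply Rdiv_lt_0_compat; lra]).
  assert (Hd1 := Rmin_l ((rho - Cmod z) / 2) (gap / (2 * (A + 1)))). fold d in Hd1.
  assert (Hd2 := Rmin_r ((rho - Cmod z) / 2) (gap / (2 * (A + 1)))). fold d in Hd2.
  apply Rle_div_r in Hd2; [|lra].
  assert (H := Harnack_lt rho (rho - d) F z HF ltac:(lra) ltac:(lra) Hpos). fold A in H. fold B in H.
  unfold gap in *. nra.
Qed.

(** * Quaternions and stem functions *)

Lemma Q_ext (p q : Quat) : Qre p = Qre q -> Qi p = Qi q -> Qj p = Qj q -> Qk p = Qk q -> p = q.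
Proof.
  destruct p as [[[a b] c] d], q as [[[a' b'] c'] d']; unfold Qre, Qi, Qj, Qk; simpl.
  now intros -> -> -> ->.
Qed.

Ltac qcomp := apply Q_ext; unfold Qmult, Qplus, Qopp, RtoQuat, Qconj, Qre, Qi, Qj, Qk; simpl; ring.

Lemma Qmult_assoc (p q r : Quat) : (p * (q * r) = p * q * r)%Q.
Proof. qcomp. Qed.
Lemma Qmult_plus_distr_r (p q r : Quat) : ((p + q) * r = p * r + q * r)%Q.
Proof. qcomp. Qed.
Lemma Qmult_plus_distr_l (p q r : Quat) : (p * (q + r) = p * q + p * r)%Q.
Proof. qcomp. Qed.
Lemma Qmult_opp_r (p q : Quat) : (p * - q = - (p * q))%Q.
Proof. qcomp. Qed.
Lemma Qmult_opp_l (p q : Quat) : (- p * q = - (p * q))%Q.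
Proof. qcomp. Qed.
Lemma Qmult_1_l (q : Quat) : (RtoQuat 1 * q = q)%Q.
Proof. qcomp. Qed.
Lemma Qmult_1_r (q : Quat) : (q * RtoQuat 1 = q)%Q.
Proof. qcomp. Qed.
Lemma Qmult_m1_l (q : Quat) : (RtoQuat (-1) * q = - q)%Q.
Proof. qcomp. Qed.
Lemma Qopp_opp (q : Quat) : (- - q = q)%Q.
Proof. qcomp. Qed.

Definition Qnsq (q : Quat) : R := Qre q ^ 2 + Qi q ^ 2 + Qj q ^ 2 + Qk q ^ 2.
Definition Qdot (p q : Quat) : R := Qre p * Qre q + Qi p * Qi q + Qj p * Qj q + Qk p * Qk q.

Lemma Qnsq_ge_0 (q : Quat) : 0 <= Qnsq q.
Proof. unfold Qnsq; nra. Qed.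
Lemma Qnorm_sq (q : Quat) : Qnorm q ^ 2 = Qnsq q.
Proof. unfold Qnorm. apply pow2_sqrt, Qnsq_ge_0. Qed.
Lemma Qnorm_ge_0 (q : Quat) : 0 <= Qnorm q.
Proof. apply sqrt_pos. Qed.
Lemma Qnsq_eq_0 (q : Quat) : Qnsq q = 0 -> q = RtoQuat 0.
Proof.
  unfold Qnsq; intros H. apply Q_ext; unfold RtoQuat, Qre, Qi, Qj, Qk in *; simpl in *; nra.
Qed.
Lemma Qnsq_pos (q : Quat) : q <> RtoQuat 0 -> 0 < Qnsq q.
Proof.
  intros H. destruct (Qnsq_ge_0 q) as [|E]; auto. exfalso; apply H, Qnsq_eq_0; auto.
Qed.
Lemma Qnsq_mult (p q : Quat) : Qnsq (p * q)%Q = Qnsq p * Qnsq q.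
Proof. unfold Qnsq, Qmult, Qre, Qi, Qj, Qk; simpl; ring. Qed.
Lemma Qnorm_mult (p q : Quat) : Qnorm (p * q)%Q = Qnorm p * Qnorm q.
Proof.
  change (sqrt (Qnsq (p * q)%Q) = sqrt (Qnsq p) * sqrt (Qnsq q)).
  rewrite Qnsq_mult. apply sqrt_mult; apply Qnsq_ge_0.
Qed.
Lemma Qinv_l (q : Quat) : q <> RtoQuat 0 -> (Qinv q * q = RtoQuat 1)%Q.
Proof.
  intros H. apply Qnsq_pos in H. unfold Qinv. rewrite Qnorm_sq. unfold Qnsq in *.
  apply Q_ext; unfold Qmult, RtoQuat, Qconj, Qre, Qi, Qj, Qk in *; simpl in *; field; lra.
Qed.
Lemma Qinv_r (q : Quat) : q <> RtoQuat 0 -> (q * Qinv q = RtoQuat 1)%Q.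
Proof.
  intros H. apply Qnsq_pos in H. unfold Qinv. rewrite Qnorm_sq. unfold Qnsq in *.
  apply Q_ext; unfold Qmult, RtoQuat, Qconj, Qre, Qi, Qj, Qk in *; simpl in *; field; lra.
Qed.
(** This passes from the derivative of [|f|^2] on a ray, an inner product, to the real part in the
    starlikeness condition. *)
Lemma Qdot_Qinv (p q : Quat) : p <> RtoQuat 0 -> Qdot p q = Qnsq p * Qre (Qinv p * q)%Q.
Proof.
  intros H. apply Qnsq_pos in H. unfold Qinv. rewrite Qnorm_sq. unfold Qnsq, Qdot in *.
  unfold Qmult, RtoQuat, Qconj, Qre, Qi, Qj, Qk in *; simpl in *; field; lra.
Qed.

(** The imaginary part of [I * I] is twice the real part of [I] times its imaginary part. A nonzero
    real part would make [I] real, with negative square. *)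
Lemma imag_unit_iff (I : Quat) : imag_unit I <-> Qre I = 0 /\ Qnsq I = 1.
Proof.
  destruct I as [[[a b] c] d]. unfold imag_unit, Qnsq, Qmult, RtoQuat, Qre, Qi, Qj, Qk; simpl. split.
  - intros E. injection E; intros E4 E3 E2 E1.
    assert (a = 0).
    { destruct (Req_dec a 0) as [|Na]; auto.
      assert (b = 0) by nra. assert (c = 0) by nra. assert (d = 0) by nra. subst; nra. }
    subst; split; auto. lra.
  - intros [-> H]. apply Q_ext; unfold Qre, Qi, Qj, Qk; simpl; lra.
Qed.

Definition Q_i : Quat := (0, 1, 0, 0).
Lemma imag_unit_Q_i : imag_unit Q_i.
Proof. apply imag_unit_iff; unfold Qnsq, Q_i, Qre, Qi, Qj, Qk; simpl; split; ring. Qed.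
Lemma imag_unit_opp (I : Quat) : imag_unit I -> imag_unit (- I)%Q.
Proof. unfold imag_unit; intros H. now rewrite Qmult_opp_l, Qmult_opp_r, Qopp_opp. Qed.

Lemma imag_unit_conj (c I : Quat) : c <> RtoQuat 0 -> imag_unit I -> imag_unit (c * I * Qinv c)%Q.
Proof.
  unfold imag_unit; intros Hc HI.
  replace (c * I * Qinv c * (c * I * Qinv c))%Q with (c * I * (Qinv c * c) * I * Qinv c)%Q by (now rewrite !Qmult_assoc).
  rewrite Qinv_l, Qmult_1_r by auto. rewrite <- (Qmult_assoc c I I), HI.
  replace (c * RtoQuat (-1))%Q with (RtoQuat (-1) * c)%Q by qcomp.
  rewrite <- Qmult_assoc, Qinv_r by auto. apply Qmult_1_r.
Qed.

Lemma slice_pt_nsq (I : Quat) (x y : R) : imag_unit I -> Qnsq (slice_pt I x y) = x ^ 2 + y ^ 2.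
Proof.
  intros H. apply imag_unit_iff in H. destruct I as [[[a b] c] d].
  unfold Qnsq, slice_pt, Qplus, Qmult, RtoQuat, Qre, Qi, Qj, Qk in *; simpl in *. destruct H as [-> H].
  transitivity (x ^ 2 + y ^ 2 * (0 * (0 * 1) + b * (b * 1) + c * (c * 1) + d * (d * 1))); [ring|].
  rewrite H; ring.
Qed.

Lemma slice_pt_norm (I : Quat) (x y : R) : imag_unit I -> Qnorm (slice_pt I x y) = Cmod (x, y).
Proof.
  intros H. change (sqrt (Qnsq (slice_pt I x y)) = sqrt (x ^ 2 + y ^ 2)). now rewrite slice_pt_nsq.
Qed.

Lemma slice_pt_re (I : Quat) (x y : R) : imag_unit I -> Qre (slice_pt I x y) = x.
Proof.
  intros H. apply imag_unit_iff in H. destruct H as [H _]. revert H.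
  unfold slice_pt, Qplus, Qmult, RtoQuat, Qre, Qi, Qj, Qk; simpl. intros ->. ring.
Qed.

Lemma slice_unit_imag (q : Quat) : imag_unit (slice_unit q).
Proof.
  unfold slice_unit. destruct (Req_dec_T (im_norm q) 0) as [|H]; [apply imag_unit_Q_i|].
  assert (E : im_norm q ^ 2 = Qi q ^ 2 + Qj q ^ 2 + Qk q ^ 2) by (apply pow2_sqrt; nra).
  revert H E. generalize (im_norm q) (Qi q) (Qj q) (Qk q). intros n b c d H E.
  apply imag_unit_iff. unfold Qnsq, Qre, Qi, Qj, Qk; simpl. split; auto.
  field_simplify_eq; auto; lra.
Qed.

Lemma slice_pt_decomp (q : Quat) : slice_pt (slice_unit q) (Qre q) (im_norm q) = q.
Proof.
  unfold slice_unit. destruct (Req_dec_T (im_norm q) 0) as [H|H].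
  - rewrite H. unfold im_norm in H. apply sqrt_eq_0 in H; [|nra].
    apply Q_ext; unfold slice_pt, Qplus, Qmult, RtoQuat, Qre, Qi, Qj, Qk in *; simpl in *; nra.
  - revert H. generalize (im_norm q). intros n H. destruct q as [[[a b] c] d].
    apply Q_ext; unfold slice_pt, Qplus, Qmult, RtoQuat, Qre, Qi, Qj, Qk; simpl; field; auto.
Qed.

(** Elements [a + ib] of the complexified quaternions, [a] and [b] being
    quaternions and [i] a central imaginary unit. *)
Definition CQ : Type := (C * C * C * C)%type.
Definition cq0 (c : CQ) : C := fst (fst (fst c)).
Definition cq1 (c : CQ) : C := snd (fst (fst c)).
Definition cq2 (c : CQ) : C := snd (fst c).
Definition cq3 (c : CQ) : C := snd c.
Definition reQ (c : CQ) : Quat := (Re (cq0 c), Re (cq1 c), Re (cq2 c), Re (cq3 c)).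
Definition imQ (c : CQ) : Quat := (Im (cq0 c), Im (cq1 c), Im (cq2 c), Im (cq3 c)).
Definition CQmult (c d : CQ) : CQ :=
  ((cq0 c * cq0 d - cq1 c * cq1 d - cq2 c * cq2 d - cq3 c * cq3 d)%C,
   (cq0 c * cq1 d + cq1 c * cq0 d + cq2 c * cq3 d - cq3 c * cq2 d)%C,
   (cq0 c * cq2 d - cq1 c * cq3 d + cq2 c * cq0 d + cq3 c * cq1 d)%C,
   (cq0 c * cq3 d + cq1 c * cq2 d - cq2 c * cq1 d + cq3 c * cq0 d)%C).
Definition CQscal (z : C) (c : CQ) : CQ := ((z * cq0 c)%C, (z * cq1 c)%C, (z * cq2 c)%C, (z * cq3 c)%C).
Definition CQconj (c : CQ) : CQ := (cq0 c, (- cq1 c)%C, (- cq2 c)%C, (- cq3 c)%C).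
(** The complex bilinear norm [c * CQconj c], not a squared modulus: it may vanish for [c] nonzero,
    exactly on the zero divisors. On stem functions it is the symmetrization of [f]. *)
Definition CQsq (c : CQ) : C := (cq0 c * cq0 c + cq1 c * cq1 c + cq2 c * cq2 c + cq3 c * cq3 c)%C.

Definition lift (I : Quat) (c : CQ) : Quat := (reQ c + I * imQ c)%Q.

(** Evaluation at a unit is multiplicative only up to a twist: moving the unit past the first factor
    conjugates it, so the second factor is evaluated at [I]. The relation between [I] and [J] is
    stated without inverses. This is the pointwise formula for the star product. *)
Lemma lift_CQmult (I J : Quat) (c d : CQ) : imag_unit J -> (lift J c * I = J * lift J c)%Q ->
  lift J (CQmult c d) = (lift J c * lift I d)%Q.
Proof.
  intros HJ E. unfold lift at 3. rewrite Qmult_plus_distr_l, Qmult_assoc, E.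
  unfold lift. rewrite !Qmult_plus_distr_l, !Qmult_plus_distr_r.
  replace (J * (J * imQ c) * imQ d)%Q with (- (imQ c * imQ d))%Q
    by (now rewrite (Qmult_assoc J J), HJ, Qmult_m1_l, Qmult_opp_l).
  replace (reQ (CQmult c d)) with (reQ c * reQ d + - (imQ c * imQ d))%Q.
  - replace (imQ (CQmult c d)) with (imQ c * reQ d + reQ c * imQ d)%Q.
    + rewrite Qmult_plus_distr_l, !Qmult_assoc.
      generalize (reQ c * reQ d)%Q (imQ c * imQ d)%Q (J * imQ c * reQ d)%Q (J * reQ c * imQ d)%Q.
      intros; qcomp.
    + unfold CQmult, Qmult, Qplus, imQ, reQ, cq0, cq1, cq2, cq3, Qre, Qi, Qj, Qk, Re, Im; simpl.
      apply Q_ext; unfold Qre, Qi, Qj, Qk; simpl; ring.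
  - unfold CQmult, Qmult, Qplus, Qopp, imQ, reQ, cq0, cq1, cq2, cq3, Qre, Qi, Qj, Qk, Re, Im; simpl.
    apply Q_ext; unfold Qre, Qi, Qj, Qk; simpl; ring.
Qed.

Lemma lift_CQscal (J : Quat) (z : C) (c : CQ) : imag_unit J ->
  lift J (CQscal z c) = (slice_pt J (Re z) (Im z) * lift J c)%Q.
Proof.
  intros HJ. unfold lift, slice_pt.
  rewrite !Qmult_plus_distr_l, !Qmult_plus_distr_r.
  replace (RtoQuat (Im z) * J * (J * imQ c))%Q with (- (RtoQuat (Im z) * imQ c))%Q.
  - replace (RtoQuat (Im z) * J * reQ c)%Q with (J * (RtoQuat (Im z) * reQ c))%Q by qcomp.
    replace (RtoQuat (Re z) * (J * imQ c))%Q with (J * (RtoQuat (Re z) * imQ c))%Q by qcomp.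
    replace (reQ (CQscal z c)) with (RtoQuat (Re z) * reQ c + - (RtoQuat (Im z) * imQ c))%Q.
    + replace (imQ (CQscal z c)) with (RtoQuat (Im z) * reQ c + RtoQuat (Re z) * imQ c)%Q.
      * rewrite Qmult_plus_distr_l.
        generalize (RtoQuat (Re z) * reQ c)%Q (RtoQuat (Im z) * imQ c)%Q (J * (RtoQuat (Im z) * reQ c))%Q
          (J * (RtoQuat (Re z) * imQ c))%Q.
        intros; qcomp.
      * unfold CQscal, Qmult, Qplus, imQ, reQ, RtoQuat, cq0, cq1, cq2, cq3, Qre, Qi, Qj, Qk, Re, Im; simpl.
        apply Q_ext; unfold Qre, Qi, Qj, Qk; simpl; ring.
    + unfold CQscal, Qmult, Qplus, Qopp, imQ, reQ, RtoQuat, cq0, cq1, cq2, cq3, Qre, Qi, Qj, Qk, Re, Im; simpl.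
      apply Q_ext; unfold Qre, Qi, Qj, Qk; simpl; ring.
  - rewrite <- Qmult_assoc, (Qmult_assoc J J), HJ, Qmult_m1_l, Qmult_opp_r. reflexivity.
Qed.

(** * Componentwise calculus and the Cauchy-Riemann equations *)

Lemma ex_derive_pair_inv {U V : NormedModule R_AbsRing} (g : R -> U * V) (t : R) :
  ex_derive g t -> ex_derive (fun s => fst (g s)) t /\ ex_derive (fun s => snd (g s)) t.
Proof.
  intros [l Hl]. split.
  - exists (fst l). apply (filterdiff_ext_lin _ (fun y : R => fst (scal y l))).
    + apply (filterdiff_comp' (K := R_AbsRing) g (fun p : U * V => fst p) t (fun y => scal y l) (fun p => fst p)); auto.
      apply filterdiff_linear, is_linear_fst.
    + reflexivity.
  - exists (snd l). apply (filterdiff_ext_lin _ (fun y : R => snd (scal y l))).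
    + apply (filterdiff_comp' (K := R_AbsRing) g (fun p : U * V => snd p) t (fun y => scal y l) (fun p => snd p)); auto.
      apply filterdiff_linear, is_linear_snd.
    + reflexivity.
Qed.

Definition QRder (g : R -> Quat) (t : R) (q : Quat) : Prop :=
  is_derive (fun s => Qre (g s)) t (Qre q) /\ is_derive (fun s => Qi (g s)) t (Qi q) /\
  is_derive (fun s => Qj (g s)) t (Qj q) /\ is_derive (fun s => Qk (g s)) t (Qk q).

Lemma QRder_Qderive (g : R -> Quat) (t : R) : ex_derive g t -> QRder g t (Qderive g t).
Proof.
  intros H. apply ex_derive_pair_inv in H. destruct H as [H H3].
  apply (ex_derive_pair_inv (fun s => fst (g s))) in H. destruct H as [H H2].
  apply (ex_derive_pair_inv (fun s => fst (fst (g s)))) in H. destruct H as [H0 H1].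
  repeat split; apply Derive_correct; assumption.
Qed.

Lemma QRder_unique (g : R -> Quat) (t : R) (q : Quat) : QRder g t q -> Qderive g t = q.
Proof.
  intros [H0 [H1 [H2 H3]]]. apply Q_ext; unfold Qderive, Qre at 1, Qi at 1, Qj at 1, Qk at 1; simpl; now apply is_derive_unique.
Qed.

Lemma QRder_dot (c : Quat) (g : R -> Quat) (t : R) (q : Quat) : QRder g t q ->
  is_derive (fun s => Qdot c (g s)) t (Qdot c q).
Proof.
  intros [H0 [H1 [H2 H3]]]. unfold Qdot.
  apply (is_derive_plus (fun s => Qre c * Qre (g s) + Qi c * Qi (g s) + Qj c * Qj (g s)) (fun s => Qk c * Qk (g s)));
    [|now apply is_derive_scal].
  apply (is_derive_plus (fun s => Qre c * Qre (g s) + Qi c * Qi (g s)) (fun s => Qj c * Qj (g s)));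
    [|now apply is_derive_scal].
  apply (is_derive_plus (fun s => Qre c * Qre (g s)) (fun s => Qi c * Qi (g s))); now apply is_derive_scal.
Qed.

Lemma continuous_Qcomp {T : UniformSpace} (g : T -> Quat) (t : T) : continuous g t ->
  continuous (fun s => Qre (g s)) t /\ continuous (fun s => Qi (g s)) t /\
  continuous (fun s => Qj (g s)) t /\ continuous (fun s => Qk (g s)) t.
Proof.
  assert (F : forall (U V : UniformSpace) (h : T -> U * V), continuous h t -> continuous (fun s => fst (h s)) t).
  { intros U V h H. apply (continuous_comp h (fun p : U * V => fst p)); auto. destruct (h t); apply continuous_fst. }
  assert (S : forall (U V : UniformSpace) (h : T -> U * V), continuous h t -> continuous (fun s => snd (h s)) t).
  { intros U V h H. apply (continuous_comp h (fun p : U * V => snd p)); auto. destruct (h t); apply continuous_snd. }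
  intros H3. assert (H2 := F _ _ _ H3). assert (H1 := F _ _ _ H2).
  repeat split.
  - exact (F _ _ _ H1).
  - exact (S _ _ _ H1).
  - exact (S _ _ _ H2).
  - exact (S _ _ _ H3).
Qed.

Lemma continuous_Qdot {T : UniformSpace} (c : Quat) (g : T -> Quat) (t : T) : continuous g t ->
  continuous (fun s => Qdot c (g s)) t.
Proof.
  intros H. apply continuous_Qcomp in H. destruct H as [H0 [H1 [H2 H3]]].
  assert (K : forall (k : R) (h : T -> R), continuous h t -> continuous (fun s => k * h s) t).
  { intros k h Hh. exact (continuous_Rmult (fun _ => k) h t (continuous_const k t) Hh). }
  exact (continuous_Rplus _ _ t (continuous_Rplus _ _ t (continuous_Rplus _ _ t (K _ _ H0) (K _ _ H1)) (K _ _ H2)) (K _ _ H3)).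
Qed.

Lemma filterdiff_eps (u : R -> R -> R) (x y a b : R) :
  filterdiff (fun p : R * R => u (fst p) (snd p)) (locally (x, y))
    (fun p : R * R => plus (scal (fst p) a) (scal (snd p) b)) ->
  forall eps, 0 < eps -> locally (T := C_UniformSpace) (x, y)
    (fun w : C => Rabs (u (fst w) (snd w) - u x y - ((fst w - x) * a + (snd w - y) * b)) <= eps * Cmod (w - (x, y))).
Proof.
  intros [_ H] eps He. specialize (H (x, y) (fun P HP => HP) (mkposreal eps He)).
  revert H. apply filter_imp. intros w Hw.
  (* The product norm on [R * R] is the Euclidean one, hence equal to [Cmod]. *)
  change (Rabs (u (fst w) (snd w) - u x y - ((fst w - x) * a + (snd w - y) * b)) <=
    eps * sqrt (Rabs (fst w - x) ^ 2 + Rabs (snd w - y) ^ 2)) in Hw.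
  rewrite !pow2_abs in Hw. exact Hw.
Qed.

(** Continuous partial derivatives make [u] and [v] differentiable in the real sense. The
    Cauchy-Riemann equations combine the two linear parts into multiplication by [ux - i uy], each
    error taking half of [eps]. *)
Lemma CR_holo (rho : R) (u v ux uy : R -> R -> R) :
  (forall x y, Cmod (x, y) < rho ->
     is_derive (fun t => u t y) x (ux x y) /\ is_derive (fun t => u x t) y (uy x y) /\
     is_derive (fun t => v t y) x (- uy x y) /\ is_derive (fun t => v x t) y (ux x y) /\
     continuous (fun p : R * R => ux (fst p) (snd p)) (x, y) /\
     continuous (fun p : R * R => uy (fst p) (snd p)) (x, y)) ->
  holo rho (fun z => (u (fst z) (snd z), v (fst z) (snd z)) : C)
           (fun z => (ux (fst z) (snd z), - uy (fst z) (snd z)) : C).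
Proof.
  intros H [x y] Hz. destruct (H x y Hz) as [H1 [H2 [H3 [H4 [H5 H6]]]]]. split.
  - assert (L := locally_Cmod_lt (x, y) rho Hz).
    assert (Du := is_derive_filterdiff u x y ux (uy x y)
      (filter_imp (F := locally (T := C_UniformSpace) (x, y)) _ _ (fun w Hw => proj1 (H (fst w) (snd w) ltac:(destruct w; exact Hw))) L) H2 H5).
    assert (H6' : continuous (fun p : R * R => - uy (fst p) (snd p)) (x, y)) by exact (continuous_Ropp _ _ H6).
    assert (Dv := is_derive_filterdiff v x y (fun a b => - uy a b) (ux x y)
      (filter_imp (F := locally (T := C_UniformSpace) (x, y)) _ _ (fun w Hw => proj1 (proj2 (proj2 (H (fst w) (snd w) ltac:(destruct w; exact Hw))))) L) H4 H6').
    apply Cder_eps. intros eps He. assert (He2 : 0 < eps / 2) by lra.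
    generalize (filter_and _ _ (filterdiff_eps u x y _ _ Du _ He2) (filterdiff_eps v x y _ _ Dv _ He2)).
    apply filter_imp. intros w [A B].
    set (a := u (fst w) (snd w) - u x y - ((fst w - x) * ux x y + (snd w - y) * uy x y)) in A.
    set (b := v (fst w) (snd w) - v x y - ((fst w - x) * - uy x y + (snd w - y) * ux x y)) in B.
    match goal with |- Cmod ?c <= _ => replace c with (RtoC a + Ci * RtoC b)%C end.
    + apply Rle_trans with (1 := Cmod_triangle _ _). rewrite Cmod_mult, Cmod_Ci, !Cmod_R. lra.
    + apply injective_projections; unfold a, b; simpl; ring.
  - apply continuous_C_intro; [exact H5|exact (continuous_Ropp _ _ H6)].
Qed.


Lemma Qdot_imag_mult (I c q : Quat) : imag_unit I -> Qdot (I * c)%Q q = - Qdot c (I * q)%Q.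
Proof.
  intros H. apply imag_unit_iff in H. destruct H as [H _]. revert H.
  unfold Qdot, Qmult, Qre, Qi, Qj, Qk; simpl. intros ->. ring.
Qed.
Lemma Qdot_plus_r (c p q : Quat) : Qdot c (p + q)%Q = Qdot c p + Qdot c q.
Proof. unfold Qdot, Qplus, Qre, Qi, Qj, Qk; simpl; ring. Qed.
Lemma Qdot_opp_r (c p : Quat) : Qdot c (- p)%Q = - Qdot c p.
Proof. unfold Qdot, Qopp, Qre, Qi, Qj, Qk; simpl; ring. Qed.
Lemma Qdot_scal_r (c p : Quat) (k : R) : Qdot c (RtoQuat k * p)%Q = k * Qdot c p.
Proof. unfold Qdot, Qmult, RtoQuat, Qre, Qi, Qj, Qk; simpl; ring. Qed.
Lemma Qdot_basis (p q : Quat) : (forall c, Qdot c p = Qdot c q) -> p = q.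
Proof.
  intros H.
  assert (H0 := H (1, 0, 0, 0)). assert (H1 := H (0, 1, 0, 0)).
  assert (H2 := H (0, 0, 1, 0)). assert (H3 := H (0, 0, 0, 1)).
  unfold Qdot, Qre, Qi, Qj, Qk in *; simpl in *.
  apply Q_ext; unfold Qre, Qi, Qj, Qk; lra.
Qed.

Lemma slice_CR (f : Quat -> Quat) (I : Quat) (x y : R) : slice_regular f -> imag_unit I ->
  in_ball (slice_pt I x y) ->
  slice_dy f I x y = (I * slice_dx f I x y)%Q /\ slice_dx f I x y = (- (I * slice_dy f I x y))%Q.
Proof.
  intros Hf HI Hb. destruct (Hf I HI x y Hb) as [_ [_ [_ [_ H]]]].
  generalize dependent (slice_dx f I x y). generalize (slice_dy f I x y). intros b a H.
  assert (E : a = (- (I * b))%Q).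
  { assert (K : (a + I * b)%Q = RtoQuat 0).
    { transitivity (RtoQuat 2 * (RtoQuat (/ 2) * (a + I * b)))%Q.
      - generalize (a + I * b)%Q; intros c. apply Q_ext; unfold Qmult, RtoQuat, Qre, Qi, Qj, Qk; simpl; field.
      - rewrite H. qcomp. }
    transitivity (a + I * b + - (I * b))%Q; [generalize (I * b)%Q; intros; qcomp|]. rewrite K. generalize (I * b)%Q; intros; qcomp. }
  split; auto. rewrite E, Qmult_opp_r, Qmult_assoc, HI, Qmult_m1_l, Qopp_opp. reflexivity.
Qed.

(** A splitting of [f] on one slice without a choice of basis: left multiplication by [I] is
    skew-adjoint for [Qdot], so pairing with [c] and [I * c] turns [f_y = I f_x] into the
    Cauchy-Riemann equations. *)
Definition slice_coord (f : Quat -> Quat) (I c : Quat) (z : C) : C :=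
  (Qdot c (f (slice_pt I (fst z) (snd z))), Qdot (I * c)%Q (f (slice_pt I (fst z) (snd z)))).

Lemma Holo_slice_coord (f : Quat -> Quat) (I c : Quat) : slice_regular f -> imag_unit I ->
  Holo 1 (slice_coord f I c).
Proof.
  intros Hf HI. eexists.
  apply (CR_holo 1 (fun x y => Qdot c (f (slice_pt I x y))) (fun x y => Qdot (I * c)%Q (f (slice_pt I x y)))
    (fun x y => Qdot c (slice_dx f I x y)) (fun x y => Qdot c (slice_dy f I x y))).
  intros x y Hz.
  assert (Hb : in_ball (slice_pt I x y)) by (unfold in_ball; now rewrite slice_pt_norm).
  destruct (slice_CR f I x y Hf HI Hb) as [E1 E2].
  destruct (Hf I HI x y Hb) as [D1 [D2 [C1 [C2 _]]]].
  assert (A1 := QRder_Qderive _ _ D1). assert (A2 := QRder_Qderive _ _ D2).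
  fold (slice_dx f I x y) in A1. fold (slice_dy f I x y) in A2.
  split; [|split; [|split; [|split; [|split]]]].
  - exact (QRder_dot c _ _ _ A1).
  - exact (QRder_dot c _ _ _ A2).
  - replace (- Qdot c (slice_dy f I x y)) with (Qdot (I * c)%Q (slice_dx f I x y))
      by (now rewrite Qdot_imag_mult, E1).
    exact (QRder_dot (I * c)%Q _ _ _ A1).
  - replace (Qdot c (slice_dx f I x y)) with (Qdot (I * c)%Q (slice_dy f I x y)).
    + exact (QRder_dot (I * c)%Q _ _ _ A2).
    + now rewrite Qdot_imag_mult, E2, Qdot_opp_r by auto.
  - exact (continuous_Qdot c _ _ C1).
  - exact (continuous_Qdot c _ _ C2).
Qed.

(** [stem_re] and [stem_im] are the solution [a], [b] of [f(x + yI) = a + I b] for the two units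
    [I = i] and [I = -i]. *)
Definition stem_re (f : Quat -> Quat) (z : C) : Quat :=
  (RtoQuat (/ 2) * (f (slice_pt Q_i (fst z) (snd z)) + f (slice_pt (- Q_i) (fst z) (snd z))))%Q.
Definition stem_im (f : Quat -> Quat) (z : C) : Quat :=
  (RtoQuat (- / 2) * (Q_i * (f (slice_pt Q_i (fst z) (snd z)) - f (slice_pt (- Q_i) (fst z) (snd z)))))%Q.
Definition stem (f : Quat -> Quat) (z : C) : CQ :=
  let a := stem_re f z in let b := stem_im f z in
  ((Qre a, Qre b), (Qi a, Qi b), (Qj a, Qj b), (Qk a, Qk b)).

(** The pair is the average of the slice coordinates for [i] and [-i]: in the second component the
    opposite units produce the difference of values that occurs in [stem_im]. *)
Lemma Holo_stem_coord (f : Quat -> Quat) (c : Quat) : slice_regular f ->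
  Holo 1 (fun z => (Qdot c (stem_re f z), Qdot c (stem_im f z)) : C).
Proof.
  intros Hf.
  apply (Holo_ext _ (fun z => RtoC (/ 2) * (slice_coord f Q_i c z + slice_coord f (- Q_i)%Q c z))%C).
  - intros z. unfold slice_coord, stem_re, stem_im.
    generalize (f (slice_pt Q_i (fst z) (snd z))) (f (slice_pt (- Q_i) (fst z) (snd z))). intros p q.
    rewrite !Qdot_scal_r, Qdot_plus_r.
    rewrite !Qdot_imag_mult by (auto using imag_unit_Q_i, imag_unit_opp).
    rewrite Qmult_plus_distr_l, Qdot_plus_r, Qmult_opp_r, Qmult_opp_l, !Qdot_opp_r.
    apply injective_projections; simpl; ring.
  - apply Holo_mult; [apply Holo_const|].
    apply Holo_plus; apply Holo_slice_coord; auto using imag_unit_Q_i, imag_unit_opp.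
Qed.

Lemma slice_pt_real (I : Quat) (x : R) : slice_pt I x 0 = RtoQuat x.
Proof. unfold slice_pt. qcomp. Qed.

Lemma stem_re_real (f : Quat -> Quat) (x : R) : stem_re f x = f (RtoQuat x).
Proof.
  unfold stem_re; simpl. rewrite !slice_pt_real. generalize (f (RtoQuat x)); intros c.
  apply Q_ext; unfold Qplus, Qmult, RtoQuat, Qre, Qi, Qj, Qk; simpl; field.
Qed.
Lemma stem_im_real (f : Quat -> Quat) (x : R) : stem_im f x = RtoQuat 0.
Proof.
  unfold stem_im; simpl. rewrite !slice_pt_real. generalize (f (RtoQuat x)); intros c. qcomp.
Qed.

Lemma C_pair_eta (z : C) : z = (fst z, snd z).
Proof. now destruct z. Qed.

(** The representation formula: the two slices [C_i] and [C_(-i)] determine [f]. *)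
Lemma slice_representation (f : Quat -> Quat) (J : Quat) (x y : R) : slice_regular f -> imag_unit J ->
  Cmod (x, y) < 1 -> f (slice_pt J x y) = lift J (stem f (x, y)).
Proof.
  intros Hf HJ Hz. apply Qdot_basis. intros c.
  (* The real part of [D] is the pairing of [c] with [f(x + yJ) - a - J b]. The stem is real on the
     real axis, so [D] vanishes there and the identity principle applies. *)
  set (D := fun z => (slice_coord f J c z -
     ((Qdot c (stem_re f z), Qdot c (stem_im f z)) : C) -
     Ci * ((Qdot (J * c)%Q (stem_re f z), Qdot (J * c)%Q (stem_im f z)) : C))%C).
  assert (HD : Holo 1 D).
  { unfold D. apply Holo_minus; [apply Holo_minus|apply Holo_mult; [apply Holo_const|]].
    - now apply Holo_slice_coord.
    - now apply Holo_stem_coord.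
    - now apply Holo_stem_coord. }
  assert (H0 : D (x, y) = 0%C).
  { apply (identity_principle 1 D); auto. intros t _. unfold D, slice_coord.
    rewrite stem_re_real, stem_im_real. simpl fst; simpl snd. rewrite slice_pt_real.
    generalize (f (RtoQuat t)); intros q.
    apply injective_projections; simpl; unfold Qdot, RtoQuat, Qre, Qi, Qj, Qk; simpl; ring. }
  apply (f_equal (fun w => fst w)) in H0. unfold D, slice_coord in H0. simpl in H0.
  rewrite (Qdot_imag_mult J c (stem_im f (x, y)) HJ) in H0.
  replace (lift J (stem f (x, y))) with (stem_re f (x, y) + J * stem_im f (x, y))%Q.
  - rewrite Qdot_plus_r. lra.
  - reflexivity.
Qed.

Definition holoQ (rho : R) (p p' : C -> CQ) : Prop :=
  holo rho (fun z => cq0 (p z)) (fun z => cq0 (p' z)) /\ holo rho (fun z => cq1 (p z)) (fun z => cq1 (p' z)) /\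
  holo rho (fun z => cq2 (p z)) (fun z => cq2 (p' z)) /\ holo rho (fun z => cq3 (p z)) (fun z => cq3 (p' z)).

Lemma stem_holoQ (f : Quat -> Quat) : slice_regular f -> exists p', holoQ 1 (stem f) p'.
Proof.
  intros Hf.
  assert (H : forall c (g : C -> C), (forall z, (Qdot c (stem_re f z), Qdot c (stem_im f z)) = g z) -> Holo 1 g).
  { intros c g E. apply (Holo_ext _ _ _ E), Holo_stem_coord, Hf. }
  destruct (H (1, 0, 0, 0) (fun z => cq0 (stem f z))) as [p0 H0].
  { intros z. unfold cq0, stem, Qdot, Qre at 1 3, Qi at 1 3, Qj at 1 3, Qk at 1 3; simpl. f_equal; ring. }
  destruct (H (0, 1, 0, 0) (fun z => cq1 (stem f z))) as [p1 H1].
  { intros z. unfold cq1, stem, Qdot, Qre at 1 3, Qi at 1 3, Qj at 1 3, Qk at 1 3; simpl. f_equal; ring. }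
  destruct (H (0, 0, 1, 0) (fun z => cq2 (stem f z))) as [p2 H2].
  { intros z. unfold cq2, stem, Qdot, Qre at 1 3, Qi at 1 3, Qj at 1 3, Qk at 1 3; simpl. f_equal; ring. }
  destruct (H (0, 0, 0, 1) (fun z => cq3 (stem f z))) as [p3 H3].
  { intros z. unfold cq3, stem, Qdot, Qre at 1 3, Qi at 1 3, Qj at 1 3, Qk at 1 3; simpl. f_equal; ring. }
  exists (fun z => (p0 z, p1 z, p2 z, p3 z)). exact (conj H0 (conj H1 (conj H2 H3))).
Qed.

Lemma lift_QRder (J : Quat) (c : R -> CQ) (c' : CQ) (t : R) :
  Rder (fun s => cq0 (c s)) t (cq0 c') -> Rder (fun s => cq1 (c s)) t (cq1 c') ->
  Rder (fun s => cq2 (c s)) t (cq2 c') -> Rder (fun s => cq3 (c s)) t (cq3 c') ->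
  QRder (fun s => lift J (c s)) t (lift J c').
Proof.
  intros [A0 B0] [A1 B1] [A2 B2] [A3 B3].
  assert (S : forall (k : R) (h : R -> R) l, is_derive h t l -> is_derive (fun s => k * h s) t (k * l))
    by (intros; now apply is_derive_scal).
  assert (P : forall (h k : R -> R) l m, is_derive h t l -> is_derive k t m -> is_derive (fun s => h s + k s) t (l + m))
    by (intros h k l m; exact (is_derive_plus h k t l m)).
  assert (M : forall (h k : R -> R) l m, is_derive h t l -> is_derive k t m -> is_derive (fun s => h s - k s) t (l - m))
    by (intros h k l m; exact (is_derive_minus h k t l m)).
  split; [|split; [|split]].
  - exact (P _ _ _ _ A0 (M _ _ _ _ (M _ _ _ _ (M _ _ _ _ (S (Qre J) _ _ B0) (S (Qi J) _ _ B1)) (S (Qj J) _ _ B2)) (S (Qk J) _ _ B3))).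
  - exact (P _ _ _ _ A1 (M _ _ _ _ (P _ _ _ _ (P _ _ _ _ (S (Qre J) _ _ B1) (S (Qi J) _ _ B0)) (S (Qj J) _ _ B3)) (S (Qk J) _ _ B2))).
  - exact (P _ _ _ _ A2 (P _ _ _ _ (P _ _ _ _ (M _ _ _ _ (S (Qre J) _ _ B2) (S (Qi J) _ _ B3)) (S (Qj J) _ _ B0)) (S (Qk J) _ _ B1))).
  - exact (P _ _ _ _ A3 (P _ _ _ _ (M _ _ _ _ (P _ _ _ _ (S (Qre J) _ _ B3) (S (Qi J) _ _ B2)) (S (Qj J) _ _ B1)) (S (Qk J) _ _ B0))).
Qed.

Lemma lift_holoQ_QRder (J : Quat) (rho : R) (p p' : C -> CQ) (g : R -> C) (t : R) (l : C) :
  holoQ rho p p' -> Cmod (g t) < rho -> Rder g t l ->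
  QRder (fun s => lift J (p (g s))) t (lift J (CQscal l (p' (g t)))).
Proof.
  intros [H0 [H1 [H2 H3]]] Hz Dg.
  assert (K : forall F F' : C -> C, holo rho F F' -> Rder (fun s => F (g s)) t (l * F' (g t))).
  { intros F F' HF. rewrite Cmult_comm. apply Rder_comp; auto. now apply HF. }
  apply (lift_QRder J (fun s => p (g s))).
  - exact (K _ _ H0).
  - exact (K _ _ H1).
  - exact (K _ _ H2).
  - exact (K _ _ H3).
Qed.

Lemma CQscal_1 (c : CQ) : CQscal 1 c = c.
Proof.
  destruct c as [[[a b] c] d]. unfold CQscal, cq0, cq1, cq2, cq3; simpl. now rewrite !Cmult_1_l.
Qed.

Lemma QRder_ext_loc (g h : R -> Quat) (t : R) (q : Quat) : locally t (fun s => g s = h s) -> QRder g t q -> QRder h t q.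
Proof.
  intros L [H0 [H1 [H2 H3]]].
  split; [|split; [|split]].
  - apply (is_derive_ext_loc (fun s => Qre (g s))); auto. revert L; apply filter_imp; now intros s ->.
  - apply (is_derive_ext_loc (fun s => Qi (g s))); auto. revert L; apply filter_imp; now intros s ->.
  - apply (is_derive_ext_loc (fun s => Qj (g s))); auto. revert L; apply filter_imp; now intros s ->.
  - apply (is_derive_ext_loc (fun s => Qk (g s))); auto. revert L; apply filter_imp; now intros s ->.
Qed.

(** Arbitrary curves in a slice are allowed because two kinds are needed: horizontal lines for the
    slice derivative, rays for the growth estimate. *)
Lemma slice_curve_QRder (f : Quat -> Quat) (p' : C -> CQ) (J : Quat) (g : R -> C) (t : R) (l : C) :
  slice_regular f -> holoQ 1 (stem f) p' -> imag_unit J -> Cmod (g t) < 1 -> Rder g t l ->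
  QRder (fun s => f (slice_pt J (fst (g s)) (snd (g s)))) t (lift J (CQscal l (p' (g t)))).
Proof.
  intros Hf Hp HJ Hz Dg.
  apply (QRder_ext_loc (fun s => lift J (stem f (g s)))); [|now apply (lift_holoQ_QRder J 1)].
  assert (L := Rder_continuous _ _ _ Dg _ (locally_Cmod_lt _ _ Hz)). unfold filtermap in L.
  revert L; apply filter_imp. intros s Hs. rewrite slice_representation by (auto; now rewrite <- C_pair_eta).
  now rewrite <- C_pair_eta.
Qed.

Lemma slice_dx_stem (f : Quat -> Quat) (p' : C -> CQ) (J : Quat) (x y : R) :
  slice_regular f -> holoQ 1 (stem f) p' -> imag_unit J -> Cmod (x, y) < 1 ->
  slice_dx f J x y = lift J (p' (x, y)).
Proof.
  intros Hf Hp HJ Hz. apply QRder_unique. rewrite <- (CQscal_1 (p' (x, y))).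
  apply (slice_curve_QRder f p' J (fun t => (t, y) : C) x 1); auto.
  split; unfold Re, Im; simpl; auto_derive; auto.
Qed.

Lemma slice_derivative_dx (f : Quat -> Quat) (q : Quat) : slice_regular f -> in_ball q ->
  slice_derivative f q = slice_dx f (slice_unit q) (Qre q) (im_norm q).
Proof.
  intros Hf Hq. unfold slice_derivative.
  destruct (slice_CR f (slice_unit q) (Qre q) (im_norm q) Hf (slice_unit_imag q)) as [_ E].
  { now rewrite slice_pt_decomp. }
  rewrite <- E. generalize (slice_dx f (slice_unit q) (Qre q) (im_norm q)); intros c.
  apply Q_ext; unfold Qplus, Qmult, RtoQuat, Qre, Qi, Qj, Qk; simpl; field.
Qed.

(** [I], [y] are determined by [q] only up to a common sign, which does not affect
    the horizontal line [t + y I]. *)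
Lemma slice_derivative_stem (f : Quat -> Quat) (p' : C -> CQ) (J : Quat) (x y : R) :
  slice_regular f -> holoQ 1 (stem f) p' -> imag_unit J -> Cmod (x, y) < 1 ->
  slice_derivative f (slice_pt J x y) = lift J (p' (x, y)).
Proof.
  intros Hf Hp HJ Hz. set (q := slice_pt J x y).
  assert (Hq : in_ball q) by (unfold in_ball, q; now rewrite slice_pt_norm).
  rewrite slice_derivative_dx by auto. rewrite <- (slice_dx_stem f p' J x y) by auto.
  unfold slice_dx. unfold Qderive.
  assert (E : forall t, slice_pt (slice_unit q) t (im_norm q) = slice_pt J t y).
  { intros t.
    assert (D := slice_pt_decomp q).
    assert (Ex : Qre q = x) by (now apply slice_pt_re).
    rewrite Ex in D. unfold q at 3 in D.
    transitivity (slice_pt (slice_unit q) x (im_norm q) + RtoQuat (t - x))%Q.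
    - unfold slice_pt. generalize (slice_unit q) (im_norm q); intros; qcomp.
    - rewrite D. unfold slice_pt. qcomp. }
  assert (Ex : Qre q = x) by (now apply slice_pt_re). rewrite Ex.
  f_equal; [f_equal; [f_equal|]|]; apply Derive_ext; intros t; now rewrite E.
Qed.

(** * The logarithmic derivative of a starlike function *)

Definition CQ1 : CQ := (RtoC 1, RtoC 0, RtoC 0, RtoC 0).
Definition HoloQ (rho : R) (g : C -> CQ) : Prop :=
  Holo rho (fun z => cq0 (g z)) /\ Holo rho (fun z => cq1 (g z)) /\
  Holo rho (fun z => cq2 (g z)) /\ Holo rho (fun z => cq3 (g z)).

Lemma CQ_ext (c d : CQ) : cq0 c = cq0 d -> cq1 c = cq1 d -> cq2 c = cq2 d -> cq3 c = cq3 d -> c = d.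
Proof.
  destruct c as [[[a b] c] d'], d as [[[a' b'] c'] d'']; unfold cq0, cq1, cq2, cq3; simpl.
  now intros -> -> -> ->.
Qed.

Lemma lift_real (J : Quat) (c : CQ) : imQ c = RtoQuat 0 -> lift J c = reQ c.
Proof.
  intros E. unfold lift. rewrite E. generalize (reQ c); intros; qcomp.
Qed.

(** Applied to the four components of the stem, this makes its derivative at 0 real, so that the
    single equation [f'(0) = 1] determines all of it. *)
Lemma real_on_reals_derive (F F' : C -> C) : holo 1 F F' -> (forall x : R, Rabs x < 1 -> Im (F x) = 0) ->
  Im (F' 0%C) = 0.
Proof.
  intros HF H0.
  assert (Hz : Cmod 0 < 1) by (rewrite Cmod_0; lra).
  assert (D : Rder (fun s => F (RtoC s)) 0 (F' 0 * 1)%C).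
  { apply Rder_comp; [now apply HF|apply Rder_RtoC]. }
  destruct D as [_ D]. rewrite Cmult_1_r in D.
  apply is_derive_unique in D. rewrite <- D.
  rewrite (Derive_ext_loc _ (fun _ => 0)); [apply Derive_const|].
  exists (mkposreal 1 Rlt_0_1). intros y Hy. apply H0.
  unfold ball in Hy; simpl in Hy; unfold AbsRing_ball, abs, minus, plus, opp in Hy; simpl in Hy.
  now rewrite Ropp_0, Rplus_0_r in Hy.
Qed.

Lemma holo_div_zero (F F' : C -> C) : holo 1 F F' -> F 0%C = 0%C ->
  exists G, Holo 1 G /\ (forall z, Cmod z < 1 -> F z = z * G z)%C /\ G 0%C = F' 0%C.
Proof.
  intros HF H0. destruct (Holo_div 1 F Rlt_0_1 (ex_intro _ F' HF)) as [G [HG E]].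
  assert (E' : forall z, Cmod z < 1 -> F z = (z * G z)%C).
  { intros z Hz. rewrite E, H0 by auto. ring. }
  exists G. split; [|split]; auto.
  assert (Hz : Cmod 0 < 1) by (rewrite Cmod_0; lra).
  destruct HG as [G' HG]. apply (Cder_unique F 0%C); [|now apply HF].
  apply (Cder_ext_loc (fun z => z * G z)%C).
  - generalize (locally_Cmod_lt 0 1 Hz). apply filter_imp. intros z Hz'. symmetry. now apply E'.
  - apply (Cder_eq _ _ (1 * G 0 + 0 * G' 0)%C); [ring|].
    apply (Cder_mult (fun z => z)); [apply Cder_id|now apply HG].
Qed.

(** Dividing out the zero at the origin leaves a factor [g] with nonzero [CQsq] at 0, so that the
    logarithmic derivative can be formed there too, with value 1. *)
Lemma starlike_stem (f : Quat -> Quat) : class_S f ->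
  exists p' g, holoQ 1 (stem f) p' /\ HoloQ 1 g /\ p' 0%C = CQ1 /\ g 0%C = CQ1 /\
    forall z, Cmod z < 1 -> stem f z = CQscal z (g z).
Proof.
  intros [Hf [Hz0 Hd]]. destruct (stem_holoQ f Hf) as [p' Hp]. exists p'.
  assert (H0 : Cmod 0 < 1) by (rewrite Cmod_0; lra).
  assert (Eim : forall x : R, imQ (stem f x) = RtoQuat 0).
  { intros x. rewrite <- (stem_im_real f x). reflexivity. }
  assert (Ere : forall x : R, reQ (stem f x) = f (RtoQuat x)).
  { intros x. rewrite <- (stem_re_real f x). reflexivity. }
  assert (F0 : f (RtoQuat 0) = RtoQuat 0).
  { apply Hz0; auto. unfold in_ball, Qnorm, RtoQuat, Qre, Qi, Qj, Qk; simpl.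
    replace (0 * (0 * 1) + 0 * (0 * 1) + 0 * (0 * 1) + 0 * (0 * 1)) with 0 by ring. rewrite sqrt_0; lra. }
  assert (S0 : stem f (RtoC 0) = (RtoC 0, RtoC 0, RtoC 0, RtoC 0)).
  { unfold stem. rewrite stem_re_real, stem_im_real, F0. reflexivity. }
  assert (D0 : lift Q_i (p' 0%C) = RtoQuat 1).
  { rewrite <- Hd. replace (RtoQuat 0) with (slice_pt Q_i 0 0) by (unfold slice_pt; qcomp).
    symmetry. apply (slice_derivative_stem f p'); auto using imag_unit_Q_i. }
  destruct Hp as [P0 [P1 [P2 P3]]].
  assert (I0 : imQ (p' 0%C) = RtoQuat 0).
  { unfold imQ. rewrite (real_on_reals_derive _ _ P0), (real_on_reals_derive _ _ P1),
      (real_on_reals_derive _ _ P2), (real_on_reals_derive _ _ P3); [reflexivity|..];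
      intros x _; specialize (Eim x); unfold imQ, RtoQuat in Eim; injection Eim; auto. }
  rewrite lift_real in D0 by auto.
  assert (E1 : p' 0%C = CQ1).
  { unfold imQ, reQ, RtoQuat in *. injection I0; injection D0; intros.
    apply CQ_ext; apply injective_projections; assumption. }
  assert (S0' := S0). apply (f_equal cq0) in S0 as Z0. apply (f_equal cq1) in S0 as Z1.
  apply (f_equal cq2) in S0 as Z2. apply (f_equal cq3) in S0 as Z3.
  destruct (holo_div_zero _ _ P0 Z0) as [g0 [G0 [X0 Y0]]].
  destruct (holo_div_zero _ _ P1 Z1) as [g1 [G1 [X1 Y1]]].
  destruct (holo_div_zero _ _ P2 Z2) as [g2 [G2 [X2 Y2]]].
  destruct (holo_div_zero _ _ P3 Z3) as [g3 [G3 [X3 Y3]]].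
  exists (fun z => (g0 z, g1 z, g2 z, g3 z)).
  split; [exact (conj P0 (conj P1 (conj P2 P3)))|].
  split; [exact (conj G0 (conj G1 (conj G2 G3)))|].
  split; [auto|]. split.
  - rewrite Y0, Y1, Y2, Y3, E1. reflexivity.
  - intros z Hz. apply CQ_ext; [exact (X0 z Hz)|exact (X1 z Hz)|exact (X2 z Hz)|exact (X3 z Hz)].
Qed.

Lemma CQsq_scal (z : C) (c : CQ) : CQsq (CQscal z c) = (z * z * CQsq c)%C.
Proof. unfold CQsq, CQscal, cq0, cq1, cq2, cq3; simpl. ring. Qed.

Lemma CQsq_parts (c : CQ) : CQsq c = (Qnsq (reQ c) - Qnsq (imQ c), 2 * Qdot (reQ c) (imQ c)).
Proof.
  destruct c as [[[[a a'] [b b']] [c c']] [d d']].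
  unfold CQsq, Qnsq, Qdot, reQ, imQ, cq0, cq1, cq2, cq3, Qre, Qi, Qj, Qk, Re, Im; simpl.
  apply injective_projections; simpl; ring.
Qed.

(** For [c = a + ib] the hypothesis says that [a] and [b] are orthogonal of equal norm. If [b] is
    nonzero, [J = - a b^(-1)] is then purely imaginary of norm 1 and solves [a + J b = 0]. *)
Lemma CQsq_zero_unit (c : CQ) : CQsq c = 0%C -> exists J, imag_unit J /\ lift J c = RtoQuat 0.
Proof.
  intros H. rewrite CQsq_parts in H. injection H; intros H2 H1.
  set (a := reQ c) in *. set (b := imQ c) in *.
  destruct (Req_dec (Qnsq b) 0) as [Z|N].
  - exists Q_i. split; [apply imag_unit_Q_i|]. unfold lift. fold a b.
    rewrite (Qnsq_eq_0 b Z), (Qnsq_eq_0 a) by lra. qcomp.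
  - exists (- (a * Qinv b))%Q.
    assert (Nb : b <> RtoQuat 0).
    { intros E; apply N; rewrite E; unfold Qnsq, RtoQuat, Qre, Qi, Qj, Qk; simpl; ring. }
    split.
    + apply imag_unit_iff. split.
      * unfold Qinv. rewrite Qnorm_sq. 
        transitivity (- (/ Qnsq b * Qdot a b)); [|replace (Qdot a b) with 0 by lra; ring].
        generalize (/ Qnsq b). intros k. unfold Qdot, Qopp, Qmult, Qconj, RtoQuat, Qre, Qi, Qj, Qk; simpl. ring.
      * transitivity (Qnsq (a * Qinv b)%Q); [unfold Qnsq, Qopp, Qre, Qi, Qj, Qk; simpl; ring|].
        rewrite Qnsq_mult. replace (Qnsq a) with (Qnsq b) by lra. rewrite <- Qnsq_mult, Qinv_r by auto.
        unfold Qnsq, RtoQuat, Qre, Qi, Qj, Qk; simpl; ring.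
    + unfold lift. fold a b. rewrite Qmult_opp_l, <- Qmult_assoc, Qinv_l, Qmult_1_r by auto. qcomp.
Qed.

(** With [c = a + ib], the equation [(a + J b) I = J (a + J b)] rearranges to [J e = e I] for
    [e = a - b I], solved by [J = e I e^(-1)]. If [e] were 0, then [a = b I] would be orthogonal to
    [b] and of the same norm, against [CQsq c <> 0]. *)
Lemma intertwine_unit (c : CQ) (I : Quat) : imag_unit I -> CQsq c <> 0%C ->
  exists J, imag_unit J /\ (lift J c * I = J * lift J c)%Q.
Proof.
  intros HI N. set (a := reQ c) in *. set (b := imQ c) in *.
  set (e := (a - b * I)%Q).
  assert (Ne : e <> RtoQuat 0).
  { intros E. apply N. rewrite CQsq_parts. fold a b.
    assert (Ea : a = (b * I)%Q).
    { transitivity (e + b * I)%Q; [unfold e; generalize (b * I)%Q; intros; qcomp|].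
      rewrite E. generalize (b * I)%Q; intros; qcomp. }
    rewrite Ea, Qnsq_mult. apply imag_unit_iff in HI. destruct HI as [I0 I1]. rewrite I1.
    apply injective_projections; simpl; [ring|].
    unfold Qdot, Qmult. revert I0. unfold Qre, Qi, Qj, Qk; simpl. intros ->. ring. }
  exists (e * I * Qinv e)%Q. split; [now apply imag_unit_conj|].
  set (J := (e * I * Qinv e)%Q).
  assert (HJ : imag_unit J) by now apply imag_unit_conj.
  assert (EJ : (J * e = e * I)%Q).
  { unfold J. rewrite <- Qmult_assoc, Qinv_l by auto. apply Qmult_1_r. }
  unfold lift. fold a b. rewrite Qmult_plus_distr_l, Qmult_assoc, HJ, Qmult_m1_l, Qmult_plus_distr_r.
  assert (E1 : (J * a = e * I + J * (b * I))%Q).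
  { rewrite <- EJ, <- Qmult_plus_distr_l. f_equal. unfold e. generalize (b * I)%Q; intros; qcomp. }
  rewrite E1.
  assert (E2 : (e * I = a * I + b)%Q).
  { unfold e. replace ((a - b * I) * I)%Q with (a * I - b * (I * I))%Q by qcomp. rewrite HI. qcomp. }
  rewrite E2, Qmult_assoc. generalize (J * b * I)%Q (a * I)%Q; intros; qcomp.
Qed.

Lemma CQsq_stem_neq (f : Quat -> Quat) (z : C) : class_S f -> Cmod z < 1 -> z <> 0%C ->
  CQsq (stem f z) <> 0%C.
Proof.
  intros [Hf [Hz0 _]] Hz Nz E. destruct (CQsq_zero_unit _ E) as [J [HJ EJ]].
  destruct z as [x y]. rewrite <- slice_representation in EJ by auto.
  assert (Hb : in_ball (slice_pt J x y)) by (red; rewrite slice_pt_norm; auto).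
  apply (proj1 (Hz0 _ Hb)) in EJ.
  apply Nz. apply Cmod_eq_0. rewrite <- (slice_pt_norm J) by auto. rewrite EJ.
  unfold Qnorm, RtoQuat, Qre, Qi, Qj, Qk; simpl.
  replace (0 * (0 * 1) + 0 * (0 * 1) + 0 * (0 * 1) + 0 * (0 * 1)) with 0 by ring. apply sqrt_0.
Qed.

(** The inverse of [g] is [CQconj g] divided by [CQsq g]. In the proof that scalar is abstracted to
    [k] with [k * CQsq g = 1], leaving polynomial identities. *)
Lemma CQ_divide (z : C) (g P : CQ) : CQsq g <> 0%C ->
  CQmult (CQscal z g) (CQscal (/ CQsq g) (CQmult (CQconj g) P)) = CQscal z P.
Proof.
  intros N. set (k := (/ CQsq g)%C). assert (Hk : (k * CQsq g = 1)%C) by (unfold k; now apply Cinv_l).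
  assert (E : forall X Y : C, (X = z * (k * CQsq g) * Y -> X = z * Y)%C) by (intros X Y ->; rewrite Hk; ring).
  clearbody k. unfold CQsq in *.
  destruct g as [[[a b] c] d], P as [[[x y] u] v].
  unfold CQmult, CQscal, CQconj, cq0, cq1, cq2, cq3 in *; simpl in *.
  apply CQ_ext; unfold cq0, cq1, cq2, cq3; simpl; apply E; ring.
Qed.

(** For fixed [I] this is complex linear in [c], hence holomorphic along a holomorphic [c], although
    [lift I c] is not complex-valued. Its real part agrees with that of [lift I c], since
    multiplying by [i] turns imaginary parts into minus real parts. *)
Definition slice_proj (I : Quat) (c : CQ) : C :=
  (cq0 c + Ci * (RtoC (Qi I) * cq1 c + RtoC (Qj I) * cq2 c + RtoC (Qk I) * cq3 c))%C.

Lemma Re_slice_proj (I : Quat) (c : CQ) : imag_unit I -> Re (slice_proj I c) = Qre (lift I c).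
Proof.
  intros H. apply imag_unit_iff in H. destruct H as [H _]. revert H.
  unfold slice_proj, lift, reQ, imQ, Qplus, Qmult, Qre, Qi, Qj, Qk, Re, Im; simpl. intros ->. ring.
Qed.

(** The stem of the slice regular logarithmic derivative, after the factor [z] of [z f'] has
    cancelled the one in [stem f = z g]. *)
Definition ratio_stem (g p' : C -> CQ) (z : C) : CQ :=
  CQscal (/ CQsq (g z)) (CQmult (CQconj (g z)) (p' z)).

Lemma Holo_ratio (I : Quat) (g p' : C -> CQ) : HoloQ 1 g -> HoloQ 1 p' ->
  (forall z, Cmod z < 1 -> CQsq (g z) <> 0%C) ->
  Holo 1 (fun z => slice_proj I (ratio_stem g p' z)).
Proof.
  intros [G0 [G1 [G2 G3]]] [P0 [P1 [P2 P3]]] HN.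
  apply (Holo_ext _ (fun z =>
    / CQsq (g z) * (cq0 (g z) * cq0 (p' z) - - cq1 (g z) * cq1 (p' z) - - cq2 (g z) * cq2 (p' z) - - cq3 (g z) * cq3 (p' z)) +
    Ci * (RtoC (Qi I) * (/ CQsq (g z) * (cq0 (g z) * cq1 (p' z) + - cq1 (g z) * cq0 (p' z) + - cq2 (g z) * cq3 (p' z) - - cq3 (g z) * cq2 (p' z))) +
          RtoC (Qj I) * (/ CQsq (g z) * (cq0 (g z) * cq2 (p' z) - - cq1 (g z) * cq3 (p' z) + - cq2 (g z) * cq0 (p' z) + - cq3 (g z) * cq1 (p' z))) +
          RtoC (Qk I) * (/ CQsq (g z) * (cq0 (g z) * cq3 (p' z) + - cq1 (g z) * cq2 (p' z) - - cq2 (g z) * cq1 (p' z) + - cq3 (g z) * cq0 (p' z)))))%C);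
    [reflexivity|].
  assert (Hi : Holo 1 (fun z => / CQsq (g z))%C).
  { apply Holo_inv; auto. unfold CQsq. repeat (apply Holo_plus || apply Holo_mult); assumption. }
  assert (forall F, Holo 1 F -> Holo 1 (fun z => - F z)%C) by (intros; now apply Holo_opp).
  repeat first [ assumption | apply Holo_const
    | lazymatch goal with
      | |- Holo _ (fun z => Cplus _ _) => apply Holo_plus
      | |- Holo _ (fun z => Cminus _ _) => apply Holo_minus
      | |- Holo _ (fun z => Cmult _ _) => apply Holo_mult
      | |- Holo _ (fun z => Copp _) => apply Holo_opp
      end ].
Qed.

(** With [I = f(q)^(-1) J f(q)], the value at [x + yI] of the slice regular quotient
    [f^{-*} * q f'], star products, is the pointwise product [f(q)^(-1) q f'(q)] at [q = x + yJ]. *)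
Lemma log_derivative_ratio (f : Quat -> Quat) (g p' : C -> CQ) (I J : Quat) (x y : R) :
  slice_regular f -> holoQ 1 (stem f) p' -> imag_unit I -> imag_unit J -> Cmod (x, y) < 1 ->
  stem f (x, y) = CQscal (x, y) (g (x, y)) -> CQsq (g (x, y)) <> 0%C ->
  f (slice_pt J x y) <> RtoQuat 0 ->
  (f (slice_pt J x y) * I = J * f (slice_pt J x y))%Q ->
  Qre (Qinv (f (slice_pt J x y)) * slice_pt J x y * slice_derivative f (slice_pt J x y))%Q =
  Re (slice_proj I (ratio_stem g p' (x, y))).
Proof.
  intros Hf Hp HI HJ Hz Eg N F0 E. rewrite Re_slice_proj by auto.
  rewrite (slice_derivative_stem f p') by auto.
  rewrite (slice_representation f J x y) in * by auto.
  rewrite <- Qmult_assoc. rewrite <- (lift_CQscal J (x, y)) by auto.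
  rewrite <- (CQ_divide (x, y) (g (x, y)) (p' (x, y)) N), <- Eg.
  fold (ratio_stem g p' (x, y)). rewrite (lift_CQmult I J) by auto.
  rewrite Qmult_assoc, Qinv_l by auto. now rewrite Qmult_1_l.
Qed.

(** Harnack's inequality on the unit disc, for a function with value 1 at the centre; the product
    form spares a division by [1 - |z|]. *)
Lemma starlike_upper (f : Quat -> Quat) (J : Quat) (x y : R) : slice_starlike f -> imag_unit J ->
  Cmod (x, y) < 1 -> (x, y) <> RtoC 0 ->
  (1 - Cmod (x, y)) *
    Qre (Qinv (f (slice_pt J x y)) * slice_pt J x y * slice_derivative f (slice_pt J x y))%Q <=
  1 + Cmod (x, y).
Proof.
  intros [HS Hpos] HJ Hz Nz. assert (HS' := HS). destruct HS' as [Hf [Hz0 _]].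
  destruct (starlike_stem f HS) as [p' [g [Hp [Hg [P0 [G0 Eg]]]]]].
  assert (HN : forall z, Cmod z < 1 -> CQsq (g z) <> 0%C).
  { intros z Hzz. destruct (Ceq_dec z 0) as [->|N0].
    - rewrite G0. unfold CQsq, CQ1, cq0, cq1, cq2, cq3; simpl.
      replace (1 * 1 + 0 * 0 + 0 * 0 + 0 * 0)%C with (RtoC 1) by ring. apply C1_nz.
    - intros E. apply (CQsq_stem_neq f z HS Hzz N0). rewrite Eg, CQsq_scal, E by auto. ring. }
  assert (HP' : HoloQ 1 p').
  { destruct Hp as [A0 [A1 [A2 A3]]]. repeat split; eapply Holo_derive; eassumption. }
  assert (Hnz : forall (K : Quat) (a b : R), imag_unit K -> Cmod (a, b) < 1 -> (a, b) <> RtoC 0 ->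
    in_ball (slice_pt K a b) /\ slice_pt K a b <> RtoQuat 0 /\ f (slice_pt K a b) <> RtoQuat 0).
  { intros K a b HK Hab Nab.
    assert (B : in_ball (slice_pt K a b)) by (unfold in_ball; now rewrite slice_pt_norm).
    assert (N1 : slice_pt K a b <> RtoQuat 0).
    { intros E. apply Nab, Cmod_eq_0. rewrite <- (slice_pt_norm K) by auto. rewrite E.
      unfold Qnorm, RtoQuat, Qre, Qi, Qj, Qk; simpl.
      replace (0 * (0 * 1) + 0 * (0 * 1) + 0 * (0 * 1) + 0 * (0 * 1)) with 0 by ring. apply sqrt_0. }
    split; [auto|split]; auto. intros E. apply N1, (proj1 (Hz0 _ B)), E. }
  assert (H00 : forall I, slice_proj I (ratio_stem g p' 0%C) = 1%C).
  { intros I. unfold ratio_stem. rewrite G0, P0.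
    unfold slice_proj, CQsq, CQscal, CQmult, CQconj, CQ1, cq0, cq1, cq2, cq3; simpl.
    field. }
  destruct (Hnz J x y HJ Hz Nz) as [B [N1 N2]].
  set (F := f (slice_pt J x y)) in *.
  (* This [I] depends on the point [x + yJ]. From here on it is frozen, and the same [I] is used
     over the whole disc. *)
  set (I := (Qinv F * J * F)%Q).
  assert (NI : Qinv F <> RtoQuat 0).
  { intros E. assert (K := Qinv_l F N2). rewrite E in K.
    apply (f_equal Qre) in K. unfold Qmult, RtoQuat, Qre, Qi, Qj, Qk in K; simpl in K. lra. }
  assert (EF : (F * I = J * F)%Q).
  { unfold I. rewrite !Qmult_assoc, Qinv_r, Qmult_1_l by auto. reflexivity. }
  assert (HI : imag_unit I).
  { unfold imag_unit, I.
    replace (Qinv F * J * F * (Qinv F * J * F))%Q with (Qinv F * J * (F * Qinv F) * J * F)%Q by (now rewrite !Qmult_assoc).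
    rewrite Qinv_r, Qmult_1_r by auto. rewrite <- (Qmult_assoc (Qinv F) J J), HJ.
    replace (Qinv F * RtoQuat (-1))%Q with (RtoQuat (-1) * Qinv F)%Q by (generalize (Qinv F); intros; qcomp).
    rewrite <- Qmult_assoc, Qinv_l by auto. apply Qmult_1_r. }
  unfold F. rewrite (log_derivative_ratio f g p' I J) by auto.
  assert (HK := Harnack 1 (fun z => slice_proj I (ratio_stem g p' z)) (x, y) (Holo_ratio I g p' Hg HP' HN) Hz).
  cbv beta in HK. rewrite H00 in HK. replace (Re 1) with 1 in HK by reflexivity. rewrite Rmult_1_r in HK.
  apply HK. intros [a b] Hw.
  destruct (Ceq_dec (a, b) 0) as [E|Nw].
  - rewrite E, H00. simpl; lra.
  (* At another point the unit [K] adapted to [I] differs from [J]; starlikeness is applied on that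
     slice. *)
  - destruct (intertwine_unit (stem f (a, b)) I HI (CQsq_stem_neq f _ HS Hw Nw)) as [K [HKu EK]].
    destruct (Hnz K a b HKu Hw Nw) as [B' [N1' N2']].
    rewrite <- (log_derivative_ratio f g p' I K a b); auto.
    + left. now apply Hpos.
    + now rewrite slice_representation.
Qed.

(** * Growth along rays *)

Lemma slice_pt_scal (J : Quat) (r x y : R) :
  (RtoQuat r * slice_pt J x y)%Q = slice_pt J (r * x) (r * y).
Proof. unfold slice_pt. qcomp. Qed.

Lemma Qnorm_RtoQuat (r : R) : 0 <= r -> Qnorm (RtoQuat r) = r.
Proof.
  intros H. unfold Qnorm, RtoQuat, Qre, Qi, Qj, Qk; simpl.
  replace (r * (r * 1) + 0 * (0 * 1) + 0 * (0 * 1) + 0 * (0 * 1)) with (r * r) by ring. now apply sqrt_square.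
Qed.

Lemma Cmod_scal_unit (r x y : R) : 0 <= r -> Cmod (x, y) = 1 -> Cmod (r * x, r * y) = r.
Proof.
  intros Hr H1. replace ((r * x, r * y) : C) with (RtoC r * (x, y))%C by (apply injective_projections; simpl; ring).
  rewrite Cmod_mult, H1, Cmod_R, Rabs_right; lra.
Qed.

Lemma unit_decomp (v : Quat) : Qnorm v = 1 ->
  exists J x y, imag_unit J /\ Cmod (x, y) = 1 /\ v = slice_pt J x y.
Proof.
  intros Hv. exists (slice_unit v), (Qre v), (im_norm v).
  split; [apply slice_unit_imag|]. split; [|now rewrite slice_pt_decomp].
  rewrite <- (slice_pt_norm (slice_unit v)), slice_pt_decomp by apply slice_unit_imag. exact Hv.
Qed.

Lemma Qnsq_derive (h : R -> Quat) (t : R) (q : Quat) : QRder h t q ->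
  is_derive (fun s => Qnsq (h s)) t (2 * Qdot (h t) q).
Proof.
  intros [H0 [H1 [H2 H3]]].
  assert (S : forall (k : R -> R) l, is_derive k t l -> is_derive (fun s => k s ^ 2) t (2 * k t * l)).
  { intros k l Hk. evar_last; [apply is_derive_pow, Hk|]. simpl. ring. }
  evar_last.
  - exact (is_derive_plus _ _ t _ _ (is_derive_plus _ _ t _ _ (is_derive_plus _ _ t _ _ (S _ _ H0) (S _ _ H1)) (S _ _ H2)) (S _ _ H3)).
  - unfold plus, Qdot; simpl. ring.
Qed.

(** For the ray derivative [X] of [f], [r X = q f'(q)] with [q = ru], so [r d] is twice [|f(q)|^2]
    times the real part bounded by [starlike_upper]. *)
Lemma ray_derivative (f : Quat -> Quat) (J : Quat) (a b r : R) : slice_starlike f -> imag_unit J ->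
  Cmod (a, b) = 1 -> 0 < r < 1 ->
  exists d, is_derive (fun t => Qnsq (f (slice_pt J (t * a) (t * b)))) r d /\
    (1 - r) * (r * d) <= 2 * Qnsq (f (slice_pt J (r * a) (r * b))) * (1 + r).
Proof.
  intros Hs HJ Hab Hr. assert (Hs' := Hs). destruct Hs' as [[Hf [Hz0 _]] _].
  destruct (stem_holoQ f Hf) as [p' Hp].
  assert (Hm : Cmod (r * a, r * b) = r) by (apply Cmod_scal_unit; lra).
  assert (Hlt : Cmod (r * a, r * b) < 1) by lra.
  assert (Nz : (r * a, r * b) <> RtoC 0) by (intros E; rewrite E, Cmod_0 in Hm; lra).
  assert (D : QRder (fun t => f (slice_pt J (t * a) (t * b))) r (lift J (CQscal (a, b) (p' (r * a, r * b))))).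
  { apply (slice_curve_QRder f p' J (fun t => (t * a, t * b) : C) r (a, b)); auto.
    split; unfold Re, Im; simpl; auto_derive; auto; ring. }
  set (X := lift J (CQscal (a, b) (p' (r * a, r * b)))) in *.
  eexists. split; [exact (Qnsq_derive _ _ _ D)|]. cbv beta.
  assert (U := starlike_upper f J _ _ Hs HJ Hlt Nz). rewrite Hm in U.
  set (q := slice_pt J (r * a) (r * b)) in *.
  assert (Hq : in_ball q) by (unfold in_ball, q; rewrite slice_pt_norm; auto).
  assert (Nf : f q <> RtoQuat 0).
  { intros E. apply (proj1 (Hz0 q Hq)) in E. assert (K : Qnorm q = r) by (unfold q; rewrite slice_pt_norm; auto).
    rewrite E, Qnorm_RtoQuat in K; lra. }
  assert (E : (RtoQuat r * X = q * slice_derivative f q)%Q).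
  { unfold X, q. rewrite (slice_derivative_stem f p') by auto.
    rewrite lift_CQscal by auto. rewrite Qmult_assoc. simpl. now rewrite slice_pt_scal. }
  replace (r * (2 * Qdot (f q) X)) with
    (2 * Qdot (f q) (RtoQuat r * X)%Q) by (rewrite Qdot_scal_r; ring).
  rewrite E, Qdot_Qinv, Qmult_assoc by auto.
  assert (Hn := Qnsq_pos _ Nf). nra.
Qed.

(** The square of the desired quantity is used, so that no square root has to be differentiated. *)
Lemma ray_decreasing_sq (f : Quat -> Quat) (J : Quat) (a b r s : R) : slice_starlike f -> imag_unit J ->
  Cmod (a, b) = 1 -> 0 < r -> r <= s -> s < 1 ->
  (1 - s) ^ 4 * Qnsq (f (slice_pt J (s * a) (s * b))) / s ^ 2 <=
  (1 - r) ^ 4 * Qnsq (f (slice_pt J (r * a) (r * b))) / r ^ 2.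
Proof.
  intros Hs HJ Hab Hr Hrs Hs1.
  set (n := fun t => Qnsq (f (slice_pt J (t * a) (t * b)))).
  change ((1 - s) ^ 4 * n s / s ^ 2 <= (1 - r) ^ 4 * n r / r ^ 2).
  assert (HD : forall t, exists d, 0 < t < 1 -> is_derive n t d /\ (1 - t) * (t * d) <= 2 * n t * (1 + t)).
  { intros t. destruct (Rlt_dec 0 t) as [H0|H0]; [|exists 0; lra].
    destruct (Rlt_dec t 1) as [H1|H1]; [|exists 0; lra].
    destruct (ray_derivative f J a b t Hs HJ Hab (conj H0 H1)) as [d Hd]. now exists d. }
  apply functional_choice in HD. destruct HD as [d Hd].
  destruct (MVT_gen (fun t => (1 - t) ^ 4 * n t / t ^ 2) r s
    (fun t => (1 - t) ^ 3 / t ^ 3 * (- 4 * t * n t + (1 - t) * (t * d t) - 2 * (1 - t) * n t))) as [c [Hc E]].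
  - rewrite Rmin_left, Rmax_right by auto. intros t Ht.
    destruct (Hd t) as [D _]; [lra|]. auto_derive.
    + split; [now exists (d t)|]. split; auto. nra.
    + replace (Derive (fun x : R => n x) t) with (d t) by (symmetry; apply is_derive_unique, D). field. lra.
  - rewrite Rmin_left, Rmax_right by auto. intros t Ht.
    destruct (Hd t) as [D _]; [lra|].
    apply continuity_pt_filterlim.
    apply (ex_derive_continuous (fun t => (1 - t) ^ 4 * n t / t ^ 2)). auto_derive.
    split; [now exists (d t)|]. split; auto. nra.
  - rewrite Rmin_left, Rmax_right in Hc by auto.
    destruct (Hd c) as [_ B]; [lra|].
    assert (K : (1 - c) ^ 3 / c ^ 3 * (- 4 * c * n c + (1 - c) * (c * d c) - 2 * (1 - c) * n c) <= 0).
    { assert (0 <= (1 - c) ^ 3 / c ^ 3).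
      { apply Rdiv_le_0_compat; [apply pow_le; lra|apply pow_lt; lra]. }
      (* The bound cancels exactly: [2 n (1 + c) - 4 c n - 2 (1 - c) n = 0]. *)
      assert (- 4 * c * n c + (1 - c) * (c * d c) - 2 * (1 - c) * n c <= 0) by lra. nra. }
    assert (K2 := Rmult_le_compat_r (s - r) _ _ ltac:(lra) K). rewrite <- E in K2. lra.
Qed.

(** The directional counterpart of [phi], which is its maximum over unit [v]. *)
Definition psi (f : Quat -> Quat) (v : Quat) (r : R) : R :=
  1 / r * (1 - r) ^ 2 * Qnorm (f (RtoQuat r * v)%Q).

Lemma psi_decreasing (f : Quat -> Quat) (v : Quat) (r s : R) : slice_starlike f -> Qnorm v = 1 ->
  0 < r -> r <= s -> s < 1 -> psi f v s <= psi f v r.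
Proof.
  intros Hs Hv Hr Hrs Hs1. destruct (unit_decomp v Hv) as [J [a [b [HJ [Hab ->]]]]].
  assert (E : forall t, 0 < t < 1 -> psi f (slice_pt J a b) t =
    sqrt ((1 - t) ^ 4 * Qnsq (f (slice_pt J (t * a) (t * b))) / t ^ 2)).
  { intros t Ht. unfold psi. rewrite slice_pt_scal.
    set (q := f (slice_pt J (t * a) (t * b))). symmetry. apply sqrt_lem_1.
    - apply Rdiv_le_0_compat; [|apply pow_lt; lra]. apply Rmult_le_pos; [apply pow_le; lra|apply Qnsq_ge_0].
    - apply Rmult_le_pos; [apply Rmult_le_pos|apply Qnorm_ge_0].
      + apply Rdiv_le_0_compat; lra.
      + apply pow_le; lra.
    - rewrite <- Qnorm_sq. field. lra. }
  rewrite !E by lra. apply sqrt_le_1_alt. now apply ray_decreasing_sq.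
Qed.

(** * Continuity across slices and compactness of the sphere of directions *)

Lemma filterlim_C_seq (x y : nat -> R) (a b : R) : is_lim_seq x a -> is_lim_seq y b ->
  filterlim (fun n => (x n, y n)) eventually (locally (T := C_UniformSpace) (a, b)).
Proof.
  intros Hx Hy. apply (proj2 (filterlim_locally (U := C_UniformSpace) (fun n => (x n, y n)) (a, b))).
  intros eps.
  assert (Hx' := proj1 (filterlim_locally x a) Hx eps). assert (Hy' := proj1 (filterlim_locally y b) Hy eps).
  generalize (filter_and _ _ Hx' Hy'). apply filter_imp. intros n [A B]. split; assumption.
Qed.

(** [lift] is polynomial in the unit and the components of the stem, so joint continuity in unit and
    point needs only continuity of the stem. *)
Lemma is_lim_seq_Qnsq_lift (J : nat -> Quat) (J0 : Quat) (x y : nat -> R) (a b : R) (g : C -> CQ) :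
  is_lim_seq (fun n => Qre (J n)) (Qre J0) -> is_lim_seq (fun n => Qi (J n)) (Qi J0) ->
  is_lim_seq (fun n => Qj (J n)) (Qj J0) -> is_lim_seq (fun n => Qk (J n)) (Qk J0) ->
  is_lim_seq x a -> is_lim_seq y b -> HoloQ 1 g -> Cmod (a, b) < 1 ->
  is_lim_seq (fun n => Qnsq (lift (J n) (g (x n, y n)))) (Qnsq (lift J0 (g (a, b)))).
Proof.
  intros L0 L1 L2 L3 Lx Ly [G0 [G1 [G2 G3]]] Hab.
  assert (K : forall F : C -> C, Holo 1 F ->
    is_lim_seq (fun n => Re (F (x n, y n))) (Re (F (a, b))) /\ is_lim_seq (fun n => Im (F (x n, y n))) (Im (F (a, b)))).
  { intros F HF. assert (CF := Holo_continuous _ _ _ HF Hab). split.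
    - exact (filterlim_comp _ _ _ _ _ _ _ _ (filterlim_C_seq x y a b Lx Ly) (continuous_Re _ _ CF)).
    - exact (filterlim_comp _ _ _ _ _ _ _ _ (filterlim_C_seq x y a b Lx Ly) (continuous_Im _ _ CF)). }
  destruct (K _ G0) as [R0 I0]. destruct (K _ G1) as [R1 I1].
  destruct (K _ G2) as [R2 I2]. destruct (K _ G3) as [R3 I3].
  assert (P : forall u v : nat -> R, forall l m : R, is_lim_seq u l -> is_lim_seq v m -> is_lim_seq (fun n => u n + v n) (l + m))
    by (intros; now apply is_lim_seq_plus').
  assert (M : forall u v : nat -> R, forall l m : R, is_lim_seq u l -> is_lim_seq v m -> is_lim_seq (fun n => u n - v n) (l - m))
    by (intros; now apply is_lim_seq_minus').
  assert (T : forall u v : nat -> R, forall l m : R, is_lim_seq u l -> is_lim_seq v m -> is_lim_seq (fun n => u n * v n) (l * m))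
    by (intros; now apply is_lim_seq_mult').
  assert (S : forall u : nat -> R, forall l : R, is_lim_seq u l -> is_lim_seq (fun n => u n ^ 2) (l ^ 2)).
  { intros u l Hu. apply (is_lim_seq_ext (fun n => u n * u n)); [intros; ring|].
    replace (l ^ 2) with (l * l) by ring. now apply T. }
  assert (A0 := P _ _ _ _ R0 (M _ _ _ _ (M _ _ _ _ (M _ _ _ _ (T _ _ _ _ L0 I0) (T _ _ _ _ L1 I1)) (T _ _ _ _ L2 I2)) (T _ _ _ _ L3 I3))).
  assert (A1 := P _ _ _ _ R1 (M _ _ _ _ (P _ _ _ _ (P _ _ _ _ (T _ _ _ _ L0 I1) (T _ _ _ _ L1 I0)) (T _ _ _ _ L2 I3)) (T _ _ _ _ L3 I2))).
  assert (A2 := P _ _ _ _ R2 (P _ _ _ _ (P _ _ _ _ (M _ _ _ _ (T _ _ _ _ L0 I2) (T _ _ _ _ L1 I3)) (T _ _ _ _ L2 I0)) (T _ _ _ _ L3 I1))).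
  assert (A3 := P _ _ _ _ R3 (P _ _ _ _ (M _ _ _ _ (P _ _ _ _ (T _ _ _ _ L0 I3) (T _ _ _ _ L1 I2)) (T _ _ _ _ L2 I1)) (T _ _ _ _ L3 I0))).
  exact (P _ _ _ _ (P _ _ _ _ (P _ _ _ _ (S _ _ A0) (S _ _ A1)) (S _ _ A2)) (S _ _ A3)).
Qed.

Lemma Qnsq_lift_CQ1 (J : Quat) : Qnsq (lift J CQ1) = 1.
Proof.
  unfold Qnsq, lift, CQ1, reQ, imQ, Qplus, Qmult, cq0, cq1, cq2, cq3, Re, Im, Qre, Qi, Qj, Qk; simpl. ring.
Qed.

(** By monotonicity the value at [r] is at most the values near 0, where [|f(q)| / |q|] is [|g|] and
    tends to [|g(0)| = 1]. *)
Lemma psi_le_1 (f : Quat -> Quat) (v : Quat) (r : R) : slice_starlike f -> Qnorm v = 1 ->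
  0 < r < 1 -> psi f v r <= 1.
Proof.
  intros Hs Hv Hr. destruct (unit_decomp v Hv) as [J [a [b [HJ [Hab Ev]]]]].
  destruct (starlike_stem f (proj1 Hs)) as [p' [g [_ [Hg [_ [G0 Eg]]]]]].
  (* The [+ 1] makes the sequence start at [r], so every [s n] lies in [(0, r]]. *)
  set (s := fun n : nat => r * / (INR n + 1)).
  assert (Hn : forall n, 0 < / (INR n + 1) <= 1).
  { intros n. assert (Hn := pos_INR n). split; [apply Rinv_0_lt_compat; lra|].
    rewrite <- Rinv_1. apply Rinv_le_contravar; lra. }
  assert (Hsn : forall n, 0 < s n <= r) by (intros n; specialize (Hn n); unfold s; nra).
  assert (Ls : is_lim_seq s 0).
  { unfold s. replace (Finite 0) with (Rbar_mult r 0) by (simpl; f_equal; ring).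
    apply is_lim_seq_scal_l.
    apply (is_lim_seq_ext (fun n => / INR (S n))); [intros n; now rewrite S_INR|].
    apply (is_lim_seq_incr_1 (fun n => / INR n)).
    replace (Finite 0) with (Rbar_inv p_infty) by reflexivity.
    apply is_lim_seq_inv; [apply is_lim_seq_INR|discriminate]. }
  assert (Lc : forall c : R, is_lim_seq (fun n => s n * c) 0).
  { intros c. replace (Finite 0) with (Rbar_mult 0 c) by (simpl; f_equal; ring). now apply is_lim_seq_scal_r. }
  assert (L := is_lim_seq_Qnsq_lift (fun _ => J) J (fun n => s n * a) (fun n => s n * b) 0 0 g
    (is_lim_seq_const _) (is_lim_seq_const _) (is_lim_seq_const _) (is_lim_seq_const _) (Lc a) (Lc b) Hg).
  replace ((0, 0) : C) with (RtoC 0) in L by reflexivity.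
  rewrite Cmod_0, G0, Qnsq_lift_CQ1 in L. specialize (L Rlt_0_1).
  assert (B : forall n, psi f v r ^ 2 <= Qnsq (lift J (g (s n * a, s n * b)))).
  { intros n. destruct (Hsn n) as [S1 S2].
    assert (P : 0 <= psi f v r).
    { unfold psi. apply Rmult_le_pos; [apply Rmult_le_pos|apply Qnorm_ge_0].
      - apply Rdiv_le_0_compat; lra.
      - apply pow_le; lra. }
    rewrite <- Qnorm_sq. apply pow_incr. split; auto.
    apply Rle_trans with (psi f v (s n)); [apply psi_decreasing; auto; lra|].
    unfold psi. rewrite Ev, slice_pt_scal.
    assert (Hm : Cmod (s n * a, s n * b) = s n) by (apply Cmod_scal_unit; lra).
    rewrite (slice_representation f) by (try apply (proj1 Hs); auto; lra).
    rewrite Eg by lra. rewrite lift_CQscal by auto.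
    rewrite Qnorm_mult. change (Re (s n * a, s n * b)) with (s n * a). change (Im (s n * a, s n * b)) with (s n * b).
    rewrite slice_pt_norm, Hm by auto.
    set (Q := Qnorm (lift J (g (s n * a, s n * b)))). assert (Q0 : 0 <= Q) by apply Qnorm_ge_0.
    replace (1 / s n * (1 - s n) ^ 2 * (s n * Q)) with ((1 - s n) ^ 2 * Q) by (field; lra).
    assert ((1 - s n) ^ 2 <= 1) by nra. nra. }
  assert (F := is_lim_seq_le _ _ _ _ B (is_lim_seq_const _) L). simpl in F. nra.
Qed.

(** [sigma] need not be increasing; [n <= sigma n] already makes it tend to infinity, which is all
    that limits along it require. *)
Lemma Bolzano_Weierstrass_subseq (u : nat -> R) : (forall n, Rabs (u n) <= 1) ->
  exists (sigma : nat -> nat) (l : R), (forall n, (n <= sigma n)%nat) /\ is_lim_seq (fun n => u (sigma n)) l.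
Proof.
  intros Hu.
  destruct (Bolzano_Weierstrass u (fun x => -1 <= x <= 1) (compact_P3 (-1) 1)) as [l Hl].
  { intros n. now apply Rabs_le_between. }
  assert (HC : forall n, exists m, (n <= m)%nat /\ Rabs (u m - l) < / (INR n + 1)).
  { intros n. assert (Hp : 0 < / (INR n + 1)) by (apply Rinv_0_lt_compat; generalize (pos_INR n); lra).
    apply (Hl (fun x => Rabs (x - l) < / (INR n + 1)) n).
    exists (mkposreal _ Hp). intros x Hx. exact Hx. }
  apply functional_choice in HC. destruct HC as [sigma Hsig].
  exists sigma, l. split; [intros n; apply Hsig|].
  apply is_lim_seq_spec. intros eps.
  destruct (archimed_cor1 eps (cond_pos eps)) as [N [HN HN0]]. exists N. intros n Hn.
  apply Rlt_trans with (1 := proj2 (Hsig n)), Rle_lt_trans with (2 := HN).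
  apply Rinv_le_contravar; [apply lt_0_INR; auto|]. apply le_INR in Hn. lra.
Qed.

Lemma filterlim_ge_id (sigma : nat -> nat) : (forall n, (n <= sigma n)%nat) -> filterlim sigma eventually eventually.
Proof.
  intros H P [N HN]. exists N. intros n Hn. apply HN. specialize (H n). lia.
Qed.

Lemma Bolzano_Weierstrass_family (us : nat -> nat -> R) (k : nat) :
  (forall i n, Rabs (us i n) <= 1) ->
  exists (sigma : nat -> nat) (l : nat -> R), (forall n, (n <= sigma n)%nat) /\
    forall i, (i < k)%nat -> is_lim_seq (fun n => us i (sigma n)) (l i).
Proof.
  intros Hu. induction k as [|k [sigma [l [Hs Hl]]]].
  - exists (fun n => n), (fun _ => 0). split; [auto|]. intros i Hi; lia.
  - destruct (Bolzano_Weierstrass_subseq (fun n => us k (sigma n))) as [tau [m [Ht Hm]]]; [auto|].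
    exists (fun n => sigma (tau n)), (fun i => if Nat.eq_dec i k then m else l i). split.
    + intros n. apply Nat.le_trans with (1 := Ht n), Hs.
    + intros i Hi. destruct (Nat.eq_dec i k) as [->|N]; [exact Hm|].
      apply (is_lim_seq_subseq (fun n => us i (sigma n)) _ tau); [now apply filterlim_ge_id|].
      apply Hl; lia.
Qed.

(** One [v] serves every radius [r] simultaneously, as the final argument demands. Values of [f] are
    compared through the representation formula along convergent units and slice coordinates. *)
Lemma sphere_cluster (f : Quat -> Quat) (u : nat -> Quat) : slice_regular f -> (forall n, Qnorm (u n) = 1) ->
  exists v, Qnorm v = 1 /\ forall r, 0 < r < 1 -> forall eps, 0 < eps -> forall N,
    exists n, (N <= n)%nat /\ Rabs (Qnorm (f (RtoQuat r * u n)%Q) - Qnorm (f (RtoQuat r * v)%Q)) < eps.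
Proof.
  intros Hf Hu.
  (* The unit is followed as separate coordinates because [slice_unit] is discontinuous at real
     points: if [u n] tends to a real point, the units may converge to something other than the
     slice unit of the limit. *)
  set (us := fun i n => match i with
    | O => Qre (u n) | 1%nat => im_norm (u n) | 2%nat => Qi (slice_unit (u n))
    | 3%nat => Qj (slice_unit (u n)) | _ => Qk (slice_unit (u n)) end).
  assert (Hxy : forall n, Qre (u n) ^ 2 + im_norm (u n) ^ 2 = 1).
  { intros n. rewrite <- (slice_pt_nsq (slice_unit (u n))) by apply slice_unit_imag.
    rewrite slice_pt_decomp, <- Qnorm_sq, Hu. ring. }
  assert (HJ : forall n, Qi (slice_unit (u n)) ^ 2 + Qj (slice_unit (u n)) ^ 2 + Qk (slice_unit (u n)) ^ 2 = 1).
  { intros n. assert (H := proj1 (imag_unit_iff _) (slice_unit_imag (u n))). unfold Qnsq in H.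
    destruct H as [H0 H1]. rewrite H0 in H1. lra. }
  destruct (Bolzano_Weierstrass_family us 5) as [sigma [l [Hs Hl]]].
  { intros i n. specialize (Hxy n). specialize (HJ n). apply Rabs_le_between.
    destruct i as [|[|[|[|i]]]]; simpl; nra. }
  assert (L0 := Hl 0%nat ltac:(lia)). assert (L1 := Hl 1%nat ltac:(lia)). assert (L2 := Hl 2%nat ltac:(lia)).
  assert (L3 := Hl 3%nat ltac:(lia)). assert (L4 := Hl 4%nat ltac:(lia)). simpl in L0, L1, L2, L3, L4.
  set (x := l 0%nat) in *. set (y := l 1%nat) in *.
  set (J := (0, l 2%nat, l 3%nat, l 4%nat) : Quat).
  assert (S : forall (w : nat -> R) (m : R), is_lim_seq w m -> is_lim_seq (fun n => w n ^ 2) (m ^ 2)).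
  { intros w m Hw. apply (is_lim_seq_ext (fun n => w n * w n)); [intros; ring|].
    replace (m ^ 2) with (m * m) by ring. now apply is_lim_seq_mult'. }
  assert (Exy : x ^ 2 + y ^ 2 = 1).
  { assert (L := is_lim_seq_plus' _ _ _ _ (S _ _ L0) (S _ _ L1)).
    apply (is_lim_seq_ext _ (fun _ => 1)) in L; [|intros; apply Hxy].
    apply is_lim_seq_unique in L. rewrite Lim_seq_const in L. now injection L. }
  assert (EJ : imag_unit J).
  { assert (L := is_lim_seq_plus' _ _ _ _ (is_lim_seq_plus' _ _ _ _ (S _ _ L2) (S _ _ L3)) (S _ _ L4)).
    apply (is_lim_seq_ext _ (fun _ => 1)) in L; [|intros; apply HJ].
    apply is_lim_seq_unique in L. rewrite Lim_seq_const in L. injection L; intros L'.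
    apply imag_unit_iff. unfold J, Qnsq, Qre, Qi, Qj, Qk; simpl. split; [auto|]. simpl in L'. lra. }
  assert (Mxy : Cmod (x, y) = 1).
  { unfold Cmod; simpl fst; simpl snd. rewrite Exy. apply sqrt_1. }
  exists (slice_pt J x y). split; [now rewrite slice_pt_norm|].
  intros r Hr eps Heps N.
  destruct (stem_holoQ f Hf) as [p' [P0 [P1 [P2 P3]]]].
  assert (Hg : HoloQ 1 (stem f)).
  { split; [|split; [|split]]; eexists; eassumption. }
  assert (Hm : Cmod (r * x, r * y) = r) by (apply Cmod_scal_unit; lra).
  assert (Lc : forall (w : nat -> R) (m : R), is_lim_seq w m -> is_lim_seq (fun n => r * w n) (r * m)).
  { intros w m Hw. apply is_lim_seq_mult'; [apply is_lim_seq_const|exact Hw]. }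
  assert (LQ := is_lim_seq_Qnsq_lift (fun n => slice_unit (u (sigma n))) J
    (fun n => r * Qre (u (sigma n))) (fun n => r * im_norm (u (sigma n))) (r * x) (r * y) (stem f)
    ltac:(apply (is_lim_seq_ext (fun _ => 0));
          [intros n; symmetry; apply (proj1 (imag_unit_iff _) (slice_unit_imag (u (sigma n))))|apply is_lim_seq_const])
    L2 L3 L4 (Lc _ _ L0) (Lc _ _ L1) Hg ltac:(lra)).
  apply (is_lim_seq_ext _ (fun n => Qnsq (f (RtoQuat r * u (sigma n))%Q))) in LQ.
  2:{ intros n. rewrite <- slice_representation.
      - rewrite <- slice_pt_scal, slice_pt_decomp. reflexivity.
      - auto.
      - apply slice_unit_imag.
      - rewrite Cmod_scal_unit; [lra|lra|].
        unfold Cmod; simpl fst; simpl snd. rewrite Hxy. apply sqrt_1. }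
  rewrite <- slice_representation in LQ by (auto; lra). rewrite <- slice_pt_scal in LQ.
  assert (LN := filterlim_comp _ _ _ _ _ _ _ _ LQ (continuous_sqrt (Qnsq (f (RtoQuat r * slice_pt J x y)%Q)))).
  assert (LE := proj1 (filterlim_locally _ _) LN (mkposreal eps Heps)).
  destruct LE as [n0 Hn0].
  exists (sigma (Nat.max N n0)). split.
  - apply Nat.le_trans with (2 := Hs _). lia.
  - apply Hn0. lia.
Qed.


(** * The maximum modulus and the theorem *)

Lemma sphere_scal (q : Quat) (r : R) : 0 < r -> Qnorm q = r ->
  exists v, Qnorm v = 1 /\ q = (RtoQuat r * v)%Q.
Proof.
  intros Hr Hq. exists (RtoQuat (/ r) * q)%Q. split.
  - rewrite Qnorm_mult, Qnorm_RtoQuat, Hq by (left; now apply Rinv_0_lt_compat). field; lra.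
  - apply Q_ext; unfold Qmult, RtoQuat, Qre, Qi, Qj, Qk; simpl; field; lra.
Qed.

(** A maximising sequence of directions has a cluster direction, where the supremum is attained.
    Boundedness follows from the same compactness applied to a sequence of unbounded values. *)
Lemma max_modulus_attained (f : Quat -> Quat) (r : R) : slice_regular f -> 0 < r < 1 ->
  exists v, Qnorm v = 1 /\ forall w, Qnorm w = 1 -> Qnorm (f (RtoQuat r * w)%Q) <= Qnorm (f (RtoQuat r * v)%Q).
Proof.
  intros Hf Hr.
  set (h := fun v => Qnorm (f (RtoQuat r * v)%Q)).
  destruct (classic (exists m, forall w, Qnorm w = 1 -> h w <= m)) as [[m Hm]|Hunb].
  - destruct (completeness (fun t => exists w, Qnorm w = 1 /\ t = h w)) as [S [Sub Slub]].
    + exists m. intros t [w [Hw ->]]. auto.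
    + exists (h Q_i), Q_i. split; auto. change (sqrt (Qnsq Q_i) = 1).
      rewrite (proj2 (proj1 (imag_unit_iff _) imag_unit_Q_i)). apply sqrt_1.
    + assert (HC : forall n : nat, exists w, Qnorm w = 1 /\ S - / (INR n + 1) < h w).
      { intros n. apply NNPP. intros N.
        assert (Hp : 0 < / (INR n + 1)) by (apply Rinv_0_lt_compat; generalize (pos_INR n); lra).
        assert (K : S <= S - / (INR n + 1)); [|lra].
        apply Slub. intros t [w [Hw ->]]. apply Rnot_lt_le. intros L. apply N. now exists w. }
      apply functional_choice in HC. destruct HC as [u Hu].
      destruct (sphere_cluster f u Hf (fun n => proj1 (Hu n))) as [v [Hv Hc]].
      exists v. split; auto. intros w Hw. apply Rle_trans with S; [apply Sub; now exists w|].
      apply Rnot_lt_le. intros L. fold (h v) in L.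
      assert (He : 0 < (S - h v) / 2) by lra.
      destruct (archimed_cor1 _ He) as [N [HN HN0]].
      destruct (Hc r Hr _ He N) as [n [Hn Hd]]. fold (h (u n)) (h v) in Hd.
      apply Rabs_def2 in Hd. destruct (Hu n) as [_ B].
      assert (/ (INR n + 1) <= / INR N).
      { apply Rinv_le_contravar; [apply lt_0_INR; auto|]. apply le_INR in Hn. lra. }
      lra.
  - assert (HC : forall n : nat, exists w, Qnorm w = 1 /\ INR n < h w).
    { intros n. apply NNPP. intros N. apply Hunb. exists (INR n). intros w Hw.
      apply Rnot_lt_le. intros L. apply N. now exists w. }
    apply functional_choice in HC. destruct HC as [u Hu].
    destruct (sphere_cluster f u Hf (fun n => proj1 (Hu n))) as [v [Hv Hc]].
    exfalso. destruct (INR_unbounded (h v + 1)) as [N HN].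
    destruct (Hc r Hr 1 Rlt_0_1 N) as [n [Hn Hd]]. fold (h (u n)) (h v) in Hd.
    apply Rabs_def2 in Hd. destruct (Hu n) as [_ B]. apply le_INR in Hn. lra.
Qed.

(** Attainment makes the extended supremum finite, so [real] returns its genuine value and not its
    default. *)
Lemma M_infty_attained (f : Quat -> Quat) (r : R) : slice_regular f -> 0 < r < 1 ->
  exists v, Qnorm v = 1 /\ M_infty r f = Qnorm (f (RtoQuat r * v)%Q) /\
    forall w, Qnorm w = 1 -> Qnorm (f (RtoQuat r * w)%Q) <= M_infty r f.
Proof.
  intros Hf Hr. destruct (max_modulus_attained f r Hf Hr) as [v [Hv Hmax]].
  exists v. split; auto.
  assert (E : M_infty r f = Qnorm (f (RtoQuat r * v)%Q)).
  { unfold M_infty. rewrite (is_lub_Rbar_unique _ (Finite (Qnorm (f (RtoQuat r * v)%Q)))); [reflexivity|].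
    split.
    - intros m [q [Hq ->]]. destruct (sphere_scal q r (proj1 Hr) Hq) as [w [Hw ->]]. now apply Hmax.
    - intros b Hb. apply Hb. exists (RtoQuat r * v)%Q. split; auto.
      rewrite Qnorm_mult, Qnorm_RtoQuat, Hv; lra. }
  split; auto. intros w Hw. rewrite E. auto.
Qed.

Lemma phi_psi (f : Quat -> Quat) (r : R) : slice_regular f -> 0 < r < 1 ->
  exists v, Qnorm v = 1 /\ phi f r = psi f v r /\ forall w, Qnorm w = 1 -> psi f w r <= phi f r.
Proof.
  intros Hf Hr. destruct (M_infty_attained f r Hf Hr) as [v [Hv [E Hmax]]].
  exists v. split; auto. unfold phi, psi. split; [now rewrite E|].
  intros w Hw. apply Rmult_le_compat_l; auto.
  apply Rmult_le_pos; [apply Rdiv_le_0_compat; lra|apply pow_le; lra].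
Qed.

Lemma at_left_intro (P : R -> Prop) (a b : R) : a < b -> (forall s, a < s < b -> P s) -> at_left b P.
Proof.
  intros Hab H. assert (Hp : 0 < b - a) by lra. exists (mkposreal _ Hp).
  intros s Hs Hsb. apply H.
  unfold ball in Hs; simpl in Hs; unfold AbsRing_ball, abs, minus, plus, opp in Hs; simpl in Hs.
  apply Rabs_def2 in Hs. lra.
Qed.

Theorem theorem5p7 : forall f : Quat -> Quat, slice_starlike f ->
  (forall r : R, 0 < r < 1 -> is_max_modulus f r (M_infty r f)) /\
  (forall r s : R, 0 < r -> r <= s -> s < 1 -> phi f s <= phi f r) /\
  exists alpha : R,
    0 <= alpha <= 1 /\
    filterlim (phi f) (at_left 1) (locally alpha) /\
    exists u : Quat, Qnorm u = 1 /\
      filterlim (fun r : R => (1 - r) ^ 2 * Qnorm (f (RtoQuat r * u)%Q))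
        (at_left 1) (locally alpha).
Proof.
  intros f Hs. assert (Hf : slice_regular f) by apply Hs.
  (* The direction is taken maximal at the larger radius [s]: then
     [phi s = psi v s <= psi v r <= phi r]. *)
  assert (Hdec : forall r s : R, 0 < r -> r <= s -> s < 1 -> phi f s <= phi f r).
  { intros r s Hr Hrs Hs1.
    destruct (phi_psi f s Hf ltac:(lra)) as [v [Hv [E _]]]. rewrite E.
    destruct (phi_psi f r Hf ltac:(lra)) as [_ [_ [_ H]]].
    apply Rle_trans with (2 := H v Hv). now apply psi_decreasing. }
  split; [|split]; auto.
  { intros r Hr. destruct (M_infty_attained f r Hf Hr) as [v [Hv [E Hmax]]]. split.
    - exists (RtoQuat r * v)%Q. split; [|auto]. rewrite Qnorm_mult, Qnorm_RtoQuat, Hv; lra.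
    - intros q Hq. destruct (sphere_scal q r (proj1 Hr) Hq) as [w [Hw ->]]. auto. }
  assert (Hpos : forall v r, 0 < r < 1 -> 0 <= psi f v r).
  { intros v r Hr. unfold psi. apply Rmult_le_pos; [apply Rmult_le_pos|apply Qnorm_ge_0].
    - apply Rdiv_le_0_compat; lra.
    - apply pow_le; lra. }
  assert (Hphi0 : forall r, 0 < r < 1 -> 0 <= phi f r <= 1).
  { intros r Hr. destruct (phi_psi f r Hf Hr) as [v [Hv [E _]]]. rewrite E. split; auto.
    now apply psi_le_1. }
  (* The limit of a decreasing function is its infimum, obtained as minus the supremum of
     [- phi f]. *)
  destruct (completeness (fun t => exists r, 0 < r < 1 /\ t = - phi f r)) as [m [Hub Hlub]].
  { exists 0. intros t [r [Hr ->]]. specialize (Hphi0 r Hr). lra. }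
  { exists (- phi f (1 / 2)), (1 / 2). split; auto; lra. }
  set (alpha := - m).
  assert (Ha1 : forall r, 0 < r < 1 -> alpha <= phi f r).
  { intros r Hr. assert (H := Hub (- phi f r)). unfold alpha. 
    assert (- phi f r <= m) by (apply H; now exists r). lra. }
  assert (Ha2 : forall eps, 0 < eps -> exists r, 0 < r < 1 /\ phi f r < alpha + eps).
  { intros eps He. apply NNPP. intros N. assert (m <= m - eps); [|lra].
    apply Hlub. intros t [r [Hr ->]]. apply Rnot_lt_le. intros L. apply N. exists r. unfold alpha. split; auto; lra. }
  assert (Ha01 : 0 <= alpha <= 1).
  { split.
    - apply Rnot_lt_le. intros L. destruct (Ha2 (- alpha)) as [r [Hr B]]; [lra|]. specialize (Hphi0 r Hr). lra.
    - specialize (Ha1 (1 / 2) ltac:(lra)). specialize (Hphi0 (1 / 2) ltac:(lra)). lra. }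
  exists alpha. split; [auto|]. split.
  { apply (proj2 (filterlim_locally (phi f) alpha)). intros eps.
    destruct (Ha2 eps (cond_pos eps)) as [r [Hr B]].
    apply (at_left_intro _ r); [lra|]. intros s Hsr.
    assert (A := Ha1 s ltac:(lra)). assert (C := Hdec r s ltac:(lra) ltac:(lra) ltac:(lra)).
    change (Rabs (phi f s - alpha) < eps). apply Rabs_def1; lra. }
  (* Radii tending to 1; with [+ 2] the first one is [1 / 2], inside [(0, 1)]. *)
  set (rr := fun n : nat => 1 - / (INR n + 2)).
  assert (Hrr : forall n, 0 < rr n < 1).
  { intros n. assert (H := pos_INR n). unfold rr.
    assert (/ (INR n + 2) <= / 2) by (apply Rinv_le_contravar; lra).
    assert (0 < / (INR n + 2)) by (apply Rinv_0_lt_compat; lra). lra. }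
  assert (HC : forall n : nat, exists v, Qnorm v = 1 /\ phi f (rr n) = psi f v (rr n)).
  { intros n. destruct (phi_psi f (rr n) Hf (Hrr n)) as [v [Hv [E _]]]. now exists v. }
  apply functional_choice in HC. destruct HC as [u Hu].
  destruct (sphere_cluster f u Hf (fun n => proj1 (Hu n))) as [v [Hv Hc]].
  (* For [rr n >= r], [psi f (u n) r >= psi f (u n) (rr n) = phi f (rr n) >= alpha]. The bound
     passes to the cluster direction [v] at fixed [r]; the factor [k] converts closeness of moduli
     into closeness of [psi]. *)
  assert (Hge : forall r, 0 < r < 1 -> alpha <= psi f v r).
  { intros r Hr. apply Rnot_lt_le. intros L.
    set (k := 1 / r * (1 - r) ^ 2).
    assert (Hk : 0 < k) by (apply Rmult_lt_0_compat; [apply Rdiv_lt_0_compat; lra|apply pow_lt; lra]).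
    assert (He : 0 < (alpha - psi f v r) / k) by (apply Rdiv_lt_0_compat; lra).
    assert (Hr1 : 0 < 1 - r) by lra.
    destruct (archimed_cor1 _ Hr1) as [N [HN HN0]].
    destruct (Hc r Hr _ He N) as [n [Hn Hd]].
    apply Rabs_def2 in Hd. destruct Hd as [Hd _]. apply Rlt_div_r in Hd; auto.
    assert (Hrn : r <= rr n).
    { unfold rr. assert (/ (INR n + 2) <= / INR N); [|lra].
      apply Rinv_le_contravar; [apply lt_0_INR; auto|]. apply le_INR in Hn. lra. }
    destruct (Hu n) as [Hun En]. specialize (Hrr n).
    assert (A := psi_decreasing f (u n) r (rr n) Hs Hun (proj1 Hr) Hrn (proj2 Hrr)).
    rewrite <- En in A. specialize (Ha1 (rr n) Hrr).
    unfold psi in A, L, Hd. fold k in A, L, Hd. lra. }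
  exists v. split; auto.
  apply (proj2 (filterlim_locally (fun r : R => (1 - r) ^ 2 * Qnorm (f (RtoQuat r * v)%Q)) alpha)). intros eps.
  destruct (Ha2 eps (cond_pos eps)) as [r [Hr B]].
  (* The target function is [s * psi f v s], without the factor [1 / s]. Above [1 - eps],
     [s * alpha > alpha - eps] because [0 <= alpha <= 1]; above [r],
     [psi f v s <= phi f s < alpha + eps]. *)
  apply (at_left_intro _ (Rmax r (1 - eps))).
  { apply Rmax_lub_lt; [lra|]. generalize (cond_pos eps); lra. }
  intros s [Hsr Hs1]. assert (Hsr' := Rle_lt_trans _ _ _ (Rmax_l _ _) Hsr).
  assert (Hse := Rle_lt_trans _ _ _ (Rmax_r _ _) Hsr).
  assert (A := Hge s ltac:(lra)). assert (C := Hdec r s ltac:(lra) ltac:(lra) ltac:(lra)).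
  destruct (phi_psi f s Hf ltac:(lra)) as [_ [_ [_ Hle]]]. specialize (Hle v Hv).
  assert (E : (1 - s) ^ 2 * Qnorm (f (RtoQuat s * v)%Q) = s * psi f v s) by (unfold psi; field; lra).
  change (Rabs ((1 - s) ^ 2 * Qnorm (f (RtoQuat s * v)%Q) - alpha) < eps).
  rewrite E. apply Rabs_def1; nra.
Qed.
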